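(* Let $\alpha\in(0,2]$. The harmonizable operator scaling stable random field $X_\alpha$ admits a modification $X^*_\alpha$ on $\mathbb{R}^d$ which almost surely has locally $H$-Hölder sample paths on $\mathbb{R}^d$ for every $H\in(0,H_m)$; that is, almost surely, for every $H\in(0,H_m)$ and every compact $K\subset\mathbb{R}^d$ there is a finite $A$ with $|X^*_\alpha(x)-X^*_\alpha(y)|\le A\|x-y\|^{H}$ for all $x,y\in K$.
   Context: Let $d\ge1$ and let $E$ be a real $d\times d$ matrix all of whose complex eigenvalues have real part $>1$. Let $a_m$ be the largest real part of an eigenvalue of $E$ and $H_m=1/a_m\in(0,1)$. Put $q=\mathrm{trace}(E)$, and for $c>0$ and a square matrix $A$ put $c^A=\exp(A\log c)$. $\|\cdot\|$ denotes the Euclidean norm and $E^t$ the transpose of $E$. The field: let $\psi:\mathbb{R}^d\to[0,\infty)$ be continuous with $\psi(c^{E^t}x)=c\,\psi(x)$ for all $c>0$, $x\in\mathbb{R}^d$, and $\psi(x)\ne0$ for $x\ne0$. Let $W_\alpha(d\xi)$ be a complex isotropic $\alpha$-stable random measure on $\mathbb{R}^d$ with Lebesgue control measure (complex isotropic Gaussian if $\alpha=2$), i.e. for every complex-valued $h\in L^\alpha(\mathbb{R}^d)$ and $z\in\mathbb{C}$, $\mathbb{E}\exp\big(i\Re(\bar z\int h\,dW_\alpha)\big)=\exp\big(-|z|^\alpha\,\frac1{2\pi}\int_0^\pi|\cos t|^\alpha dt\,\int_{\mathbb{R}^d}|h(\xi)|^\alpha d\xi\big)$. Then $$X_\alpha(x)=\Re\int_{\mathbb{R}^d}\big(e^{i\langle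 x,\xi\rangle}-1\big)\psi(\xi)^{-1-q/\alpha}\,W_\alpha(d\xi),\quad x\in\mathbb{R}^d,$$ which is well defined. A modification of $X_\alpha$ is a family $(X^*_\alpha(x))_{x\in\mathbb{R}^d}$ on the same probability space with $\mathbb{P}(X^*_\alpha(x)=X_\alpha(x))=1$ for each $x$. *)

(* Defs.v *)
From HB Require Import structures.
From mathcomp Require Import all_boot all_order all_algebra.
From mathcomp Require Import complex.
From mathcomp Require Import all_classical all_reals all_analysis.

Set Implicit Arguments.
Unset Strict Implicit.
Unset Printing Implicit Defensive.

Import Order.TTheory GRing.Theory Num.Theory.
Import numFieldNormedType.Exports.

Local Open Scope classical_set_scope.
Local Open Scope ring_scope.

Section measurable_cvec.
Context {disp : measure_display} {T : sigmaRingType disp}.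
Variable n : nat.

Let coord (i : 'I_n) (v : 'cV[T]_n) : T := v i ord0.

Let cvec_set0 : g_sigma_preimage coord set0.
Proof. exact: sigma_algebra0. Qed.

Let cvec_setC A : g_sigma_preimage coord A -> g_sigma_preimage coord (~` A).
Proof. exact: sigma_algebraC. Qed.

Let cvec_bigcup (F : _^nat) : (forall i, g_sigma_preimage coord (F i)) ->
  g_sigma_preimage coord (\bigcup_i (F i)).
Proof. exact: sigma_algebra_bigcup. Qed.

(** The sigma-algebra generated by the coordinates, as the library does for
    [n.-tuple T]; over the reals it is the Borel sigma-algebra. *)
HB.instance Definition _ := @isMeasurable.Build (measure_tuple_display disp)
  'cV[T]_n (g_sigma_preimage coord) cvec_set0 cvec_setC cvec_bigcup.

End measurable_cvec.

Lemma measurable_fun_cvec (d1 d2 : measure_display) (T1 : measurableType d1)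
    (T2 : measurableType d2) (n : nat) (f : T1 -> 'cV[T2]_n) :
  (forall i, measurable_fun [set: T1] (fun x => f x i ord0)) ->
  measurable_fun [set: T1] f.
Proof.
move=> mf _ A; rewrite /measurable/= => gA.
suff : image_set_system setT f measurable A by [].
apply: gA; split; first by apply: sigma_algebra_image; exact: sigma_algebra_measurable.
rewrite -bigcup_seq; apply: bigcup_sub => i _ B [C mC <-].
rewrite /image_set_system/= !setTI.
by rewrite -[X in measurable X]setTI; apply: (mf i).
Qed.

Lemma measurable_coord (disp : measure_display) (T : sigmaRingType disp)
    (n : nat) (i : 'I_n) :
  measurable_fun [set: 'cV[T]_n] (fun v => v i ord0).
Proof.
move=> _ Y mY; rewrite setTI; apply: sub_sigma_algebra => /=.
rewrite -bigcup_seq/=; exists i => /=; first by rewrite mem_index_enum.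
by exists Y => //; rewrite setTI.
Qed.

Section lebesgue_cvec.
Variable R : realType.

Definition cv_cons (n : nat) (p : measurableTypeR R * 'cV[R]_n) : 'cV[R]_n.+1 :=
  \col_i (if unlift ord0 i is Some j then p.2 j ord0 else p.1).

Definition cv_uncons (n : nat) (v : 'cV[R]_n.+1) : measurableTypeR R * 'cV[R]_n :=
  (v ord0 ord0, \col_i v (lift ord0 i) ord0).

Lemma cv_consK (n : nat) : cancel (@cv_cons n) (@cv_uncons n).
Proof.
case=> x v; rewrite /cv_uncons; congr pair; first by rewrite mxE unlift_none.
by apply/matrixP => i j; rewrite !mxE/= liftK !ord1.
Qed.

Lemma measurable_cv_cons (n : nat) :
  measurable_fun [set: measurableTypeR R * 'cV[R]_n] (@cv_cons n).
Proof.
apply: measurable_fun_cvec => i.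
under eq_fun do rewrite mxE.
case: unliftP => [j|] _; last exact: measurable_fst.
by apply: (measurableT_comp (measurable_coord j)); exact: measurable_snd.
Qed.

Lemma measurable_cv_uncons (n : nat) :
  measurable_fun [set: 'cV[R]_n.+1] (@cv_uncons n).
Proof.
apply: measurable_fun_pair; first exact: measurable_coord.
apply: measurable_fun_cvec => i.
under eq_fun do rewrite mxE.
exact: measurable_coord.
Qed.

Section step.
Variables (n : nat) (mu : {sigma_finite_measure set 'cV[R]_n -> \bar R}).

Definition lebesgue_step : set 'cV[R]_n.+1 -> \bar R :=
  pushforward (@lebesgue_measure R \x mu)%E (@cv_cons n).

Let lebesgue_step0 : lebesgue_step set0 = 0%E.
Proof. by rewrite /lebesgue_step /pushforward preimage_set0 measure0. Qed.

Let lebesgue_step_ge0 A : (0 <= lebesgue_step A)%E.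
Proof. by rewrite /lebesgue_step /pushforward; exact: measure_ge0. Qed.

Let lebesgue_step_sigma_additive : semi_sigma_additive lebesgue_step.
Proof.
exact: (@measure_semi_sigma_additive _ _ _
  (measure_function_pushforward__canonical__measure_function_Measure
    (@lebesgue_measure R \x mu)%E (@measurable_cv_cons n))).
Qed.

HB.instance Definition _ := isMeasure.Build _ _ _ lebesgue_step
  lebesgue_step0 lebesgue_step_ge0 lebesgue_step_sigma_additive.

Let lebesgue_step_sigma_finite : sigma_finite setT lebesgue_step.
Proof.
have /sigma_finiteP[F [TF ndF Foo]] := sigma_finiteT (@lebesgue_measure R).
have /sigma_finiteP[G [TG ndG Goo]] := sigma_finiteT mu.
exists (fun k => @cv_uncons n @^-1` (F k `*` G k)).
  rewrite -preimage_bigcup predeqE => v; split=> // _ /=.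
  have [i _ Fi] : (\bigcup_i F i) (cv_uncons v).1 by rewrite -TF.
  have [j _ Gj] : (\bigcup_i G i) (cv_uncons v).2 by rewrite -TG.
  exists (maxn i j) => //; split.
    by move: Fi; apply/subsetPset/ndF/leq_maxl.
  by move: Gj; apply/subsetPset/ndG/leq_maxr.
move=> k; have [mF Fk] := Foo k; have [mG Gk] := Goo k; split.
  rewrite -[X in measurable X]setTI; apply: measurable_cv_uncons => //.
  exact: measurableX.
rewrite /lebesgue_step /pushforward -comp_preimage.
rewrite (_ : _ \o _ = id) ?preimage_id; last first.
  by apply/funext => p /=; rewrite cv_consK.
by rewrite product_measure1E// lte_mul_pinfty// ge0_fin_numE.
Qed.

HB.instance Definition _ := Measure_isSigmaFinite.Build _ _ _ lebesgue_step
  lebesgue_step_sigma_finite.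

End step.

Fixpoint lebesgue_cv (n : nat) : {sigma_finite_measure set 'cV[R]_n -> \bar R} :=
  match n with
  | 0 => @dirac _ _ (0 : 'cV[R]_0) R
  | m.+1 => lebesgue_step (lebesgue_cv m)
  end.

End lebesgue_cvec.

Lemma measurable_box (disp : measure_display) (T : measurableType disp)
    (n : nat) (A : 'I_n -> set T) :
  (forall i, measurable (A i)) ->
  measurable [set v : 'cV[T]_n | forall i, A i (v i ord0)].
Proof.
move=> mA.
rewrite (_ : [set _ | _] =
  \bigcap_(i in [set: 'I_n]) ((fun v : 'cV[T]_n => v i ord0) @^-1` A i)); last first.
  by apply/seteqP; split=> v /= Av i; [move=> _|]; exact: Av.
apply: fin_bigcap_measurable => [|i _]; first exact: finite_finset.
by rewrite -[X in measurable X]setTI; apply: measurable_coord.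
Qed.

Lemma lebesgue_cv_box (R : realType) (n : nat) (A : 'I_n -> set R) :
  (forall i, measurable (A i)) ->
  lebesgue_cv R n [set v | forall i, A i (v i ord0)] =
  (\prod_(i < n) @lebesgue_measure R (A i))%E.
Proof.
elim: n A => [|n IH] A mA.
  rewrite big_ord0 /= diracE mem_set//=; by case.
rewrite big_ord_recl/= /lebesgue_step /pushforward.
rewrite (_ : _ @^-1` _ =
  A ord0 `*` [set v : 'cV[R]_n | forall i, A (lift ord0 i) (v i ord0)]); last first.
  apply/seteqP; split=> -[x v] /=.
    move=> H; split; first by have := H ord0; rewrite mxE unlift_none.
    by move=> i; have := H (lift ord0 i); rewrite mxE liftK.
  by case=> Ax Av i; rewrite mxE; case: unliftP => [j|] ->.
rewrite product_measure1E.
- by congr (_ * _)%E; apply: IH => i; exact: mA.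
- exact: mA.
- exact: (measurable_box (fun i => mA (lift ord0 i))).
Qed.

Section linear_algebra.
Variables (R : realType) (d : nat).

(* The norm [`|x|] of the library on matrices is the sup norm. *)
Definition enorm (x : 'cV[R]_d) : R := Num.sqrt (\sum_i x i ord0 ^+ 2).

Definition dotv (x y : 'cV[R]_d) : R := \sum_i x i ord0 * y i ord0.

Definition expmx (A : 'M[R]_d) : 'M[R]_d :=
  limn (series (fun k => (k`!%:R)^-1 *: A ^+ k)).

Definition powmx (c : R) (A : 'M[R]_d) : 'M[R]_d := expmx (ln c *: A).

Definition cplx_eigenvalue (E : 'M[R]_d) (l : R[i]) : Prop :=
  eigenvalue (map_mx (real_complex R) E) l.

(** The largest real part [a_m] of an eigenvalue, and [H_m = 1 / a_m]. *)
Definition max_re_eigenvalue (E : 'M[R]_d) : R :=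
  sup [set complex.Re l | l in cplx_eigenvalue E].

Definition Hmax (E : 'M[R]_d) : R := (max_re_eigenvalue E)^-1.

End linear_algebra.

Section complex_valued.
Variable R : realType.

Definition cmod (z : R[i]) : R := ComplexField.Normc.normc z.

Definition expi (t : R) : R[i] := (cos t +i* sin t)%C.

Definition cmeasurable (disp : measure_display) (T : measurableType disp)
    (f : T -> R[i]) : Prop :=
  measurable_fun [set: T] (fun t => complex.Re (f t)) /\
  measurable_fun [set: T] (fun t => complex.Im (f t)).

Definition cexpectation (disp : measure_display) (Omega : measurableType disp)
    (P : probability Omega R) (Z : Omega -> R[i]) : R[i] :=
  ((\int[P]_w complex.Re (Z w)) +i* (\int[P]_w complex.Im (Z w)))%C.

Definition cvg_in_probability (disp : measure_display)
    (Omega : measurableType disp) (P : probability Omega R)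
    (Z_ : nat -> Omega -> R[i]) (Z : Omega -> R[i]) : Prop :=
  forall eps : R, 0 < eps ->
    P [set w | eps <= cmod (Z_ n w - Z w)] @[n --> \oo] --> 0%E.

End complex_valued.

Section stable_random_measure.
Variables (R : realType) (d : nat).
Variables (disp : measure_display) (Omega : measurableType disp).
Variables (P : probability Omega R) (alpha : R).
Variable W : set 'cV[R]_d -> Omega -> R[i].

Definition finite_volume (A : set 'cV[R]_d) : Prop :=
  measurable A /\ (lebesgue_cv R d A < +oo)%E.

Definition in_Lalpha (h : 'cV[R]_d -> R[i]) : Prop :=
  cmeasurable h /\
  (\int[lebesgue_cv R d]_xi (cmod (h xi) `^ alpha)%:E < +oo)%E.

(** The list [s] of pairs [(c, A)] encodes the simple function
    [\sum_((c, A) in s) c * 1_A]. *)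
Definition simple_fun (s : seq (R[i] * set 'cV[R]_d)) (xi : 'cV[R]_d) : R[i] :=
  \sum_(p <- s) p.1 * \1_(p.2) xi.

Definition simple_integral (s : seq (R[i] * set 'cV[R]_d)) (w : Omega) : R[i] :=
  \sum_(p <- s) p.1 * W p.2 w.

(** [Y] is (a version of) the stochastic integral [\int h dW]: the limit in
    probability of the integrals of simple functions converging to [h] in
    L^alpha. *)
Definition is_stochastic_integral (h : 'cV[R]_d -> R[i]) (Y : Omega -> R[i])
    : Prop :=
  cmeasurable Y /\
  exists s : nat -> seq (R[i] * set 'cV[R]_d),
    [/\ forall n p, p \in s n -> finite_volume p.2,
        (\int[lebesgue_cv R d]_xi
           (cmod (simple_fun (s n) xi - h xi) `^ alpha)%:E)%E
          @[n --> \oo] --> 0%E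
      & cvg_in_probability P (fun n => simple_integral (s n)) Y].

(** Complex isotropic [alpha]-stable random measure with Lebesgue control
    measure. In [stable_independent] it is enough to test the independence of
    the complex variables [W (A i)] on rectangles [B i x C i]. *)
Record isotropic_stable_measure : Prop := {
  stable_measurable : forall A, finite_volume A -> cmeasurable (W A) ;
  stable_independent : forall (n : nat) (A : 'I_n -> set 'cV[R]_d),
    (forall i, finite_volume (A i)) -> trivIset setT A ->
    forall B C : 'I_n -> set R,
    (forall i, measurable (B i)) -> (forall i, measurable (C i)) ->
    P [set w | forall i, B i (complex.Re (W (A i) w)) /\
                         C i (complex.Im (W (A i) w))] =
    (\prod_(i < n) P [set w | B i (complex.Re (W (A i) w)) /\
                              C i (complex.Im (W (A i) w))])%E ;
  stable_sigma_additive : forall A : nat -> set 'cV[R]_d,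
    (forall k, finite_volume (A k)) -> trivIset setT A ->
    finite_volume (\bigcup_k A k) ->
    {ae P, forall w,
      cmod (\sum_(k < n) W (A k) w - W (\bigcup_k A k) w) @[n --> \oo]
        --> (0 : R)} ;
  stable_characteristic : forall (h : 'cV[R]_d -> R[i]) (Y : Omega -> R[i]),
    in_Lalpha h -> is_stochastic_integral h Y -> forall z : R[i],
    cexpectation P (fun w => expi (complex.Re (conjc z * Y w))) =
    (expR (- (cmod z `^ alpha
              * ((2 * pi)^-1
                 * \int[@lebesgue_measure R]_(t in `[0, pi]) (`|cos t| `^ alpha))
              * \int[lebesgue_cv R d]_xi (cmod (h xi) `^ alpha))))%:C%C
}.

End stable_random_measure.

Section random_fields.
Variables (R : realType) (d : nat).
Variables (disp : measure_display) (Omega : measurableType disp).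
Variable P : probability Omega R.

Definition harmonizable_kernel (alpha : R) (E : 'M[R]_d) (psi : 'cV[R]_d -> R)
    (x xi : 'cV[R]_d) : R[i] :=
  (expi (dotv x xi) - 1) * (psi xi `^ (- 1 - \tr E / alpha))%:C%C.

(** Stochastic integrals being defined up to null events, [X] is one choice of
    a version for each [x]. *)
Definition harmonizable_field (alpha : R) (E : 'M[R]_d) (psi : 'cV[R]_d -> R)
    (W : set 'cV[R]_d -> Omega -> R[i]) (X : 'cV[R]_d -> Omega -> R) : Prop :=
  forall x, exists2 Y : Omega -> R[i],
    is_stochastic_integral P alpha W (harmonizable_kernel alpha E psi x) Y &
    forall w, X x w = complex.Re (Y w).

Definition modification (X Xs : 'cV[R]_d -> Omega -> R) : Prop :=
  forall x, measurable_fun [set: Omega] (Xs x) /\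
            P [set w | Xs x w = X x w] = 1%E.

Definition locally_holder (H : R) (f : 'cV[R]_d -> R) : Prop :=
  forall K : set 'cV[R]_d, compact K ->
    exists A : R, forall x y, K x -> K y ->
      `|f x - f y| <= A * enorm (x - y) `^ H.

End random_fields.

(* Main.v *)
Require Import Defs.
From HB Require Import structures.
From mathcomp Require Import all_boot all_order all_algebra all_fingroup.
From mathcomp Require Import complex.
From mathcomp Require Import all_classical all_reals all_analysis.
From mathcomp Require Import measurable_realfun ring lra zify.

Import Order.TTheory GRing.Theory Num.Theory.
Import numFieldNormedType.Exports.
Local Open Scope classical_set_scope.
Local Open Scope ring_scope.

(** Kolmogorov's criterion is useless for small [alpha], since moments of order
    [alpha] are infinite; instead the heavy tail is paid for once per scale.
    For disjoint cells [B j] the variables [Re (c j * W (B j))] are independent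
    and symmetric, so their Riesz product
    [\prod_j (1 + sin (Re (c j * W (B j))) / 2)] has expectation [1], and it
    dominates [expR (S / 2 - 1)], with [S] their sum, as soon as the sum of their
    squares is at most [1]. If [cmod (c j) <= g j], this smallness holds outside
    an event of probability [O (\int g ^ alpha)] which does not depend on [c], and
    on it the sums [S] have exponential tails. Hence the maximum of [N] stochastic
    integrals with kernels dominated by [g] exceeds [lam] with probability
    [O (\int g ^ alpha + N exp (- lam / 2))].

    When [|x - y| <= rho <= 1], the kernel of an increment is at most a constant
    times [rho ^ H' * min (|xi| ^ H', |xi|) * psi xi ^ (- 1 - q / alpha)], whose
    [alpha]-th power is integrable if [0 < H' < H_m]: the dilation [2 ^ E^T]
    doubles [psi], multiplies volumes by [2 ^ q], and in a suitable norm multiplies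
    lengths by a factor in [[2 ^ lo, 2 ^ hi]] with [1 < lo] and [H' * hi < 1].
    Thus for [H < H'] the polynomially many increments along neighbours of a grid
    of mesh [rho] are all at most [rho ^ H] with probability [1 - O (rho ^ eps)].
    The Borel-Cantelli lemma and dyadic chaining conclude. *)

(** * Complex moduli and trigonometric inequalities *)

(** For [alpha < 2] stable integrals have in general neither second nor exponential moments, yet
    chaining needs a union bound over polynomially many increments. What the characteristic function
    does give is the expectation of bounded trigonometric expressions: sums of [1 - cos] control
    truncated second moments, and Riesz products replace exponentials. Large values come from few
    cells, the same for all kernels below a common envelope; so their price does not grow with the
    number of increments.

    Stochastic integrals are only limits in probability, so finitely many kernels are approximated
    by simple functions on common cells and the estimate passes to the limit.

    The exponents balance exactly. On the [j]-th image of the shell, the [alpha]-th power of the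
    density times the volume is of order [2 ^ (- j (alpha + q)) * 2 ^ (j q) = 2 ^ (- j alpha)]: the
    trace cancels. Lengths contribute at most [2 ^ (j H' hi alpha)] for [j > 0] and
    [2 ^ (j lo alpha)] for [j < 0]; hence the conditions [H' hi < 1] and [1 < lo], the threshold
    [H_m], and the role of real parts above [1]. *)

Section modulus.
Variable R : realType.
Implicit Types z w : R[i].

Lemma cReD z w : complex.Re (z + w) = complex.Re z + complex.Re w.
Proof. by case: z; case: w. Qed.

Lemma cImD z w : complex.Im (z + w) = complex.Im z + complex.Im w.
Proof. by case: z; case: w. Qed.

Lemma cReN z : complex.Re (- z) = - complex.Re z.
Proof. by case: z. Qed.

Lemma cImN z : complex.Im (- z) = - complex.Im z.
Proof. by case: z. Qed.

Lemma cReM z w :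
  complex.Re (z * w) = complex.Re z * complex.Re w - complex.Im z * complex.Im w.
Proof. by case: z; case: w. Qed.

Lemma cImM z w :
  complex.Im (z * w) = complex.Re z * complex.Im w + complex.Im z * complex.Re w.
Proof. by case: z; case: w. Qed.

Lemma cRe_sum (I : Type) (s : seq I) (F : I -> R[i]) :
  complex.Re (\sum_(i <- s) F i) = \sum_(i <- s) complex.Re (F i).
Proof. by elim/big_rec2: _ => //= i x y _ <-; rewrite cReD. Qed.

Lemma cmodE z : cmod z = Num.sqrt (complex.Re z ^+ 2 + complex.Im z ^+ 2).
Proof. by case: z. Qed.

Lemma cmod_sqr z : cmod z ^+ 2 = complex.Re z ^+ 2 + complex.Im z ^+ 2.
Proof. by rewrite cmodE sqr_sqrtr// addr_ge0// sqr_ge0. Qed.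

Lemma cmod_ge0 z : 0 <= cmod z.
Proof. by rewrite cmodE sqrtr_ge0. Qed.

Lemma cmodM z w : cmod (z * w) = cmod z * cmod w.
Proof. exact: ComplexField.Normc.normcM. Qed.

Lemma cmodD z w : cmod (z + w) <= cmod z + cmod w.
Proof. exact: le_normcD. Qed.

Lemma cmodN z : cmod (- z) = cmod z.
Proof. exact: normcN. Qed.

Lemma cmod0 : cmod (0 : R[i]) = 0.
Proof. exact: ComplexField.Normc.normc0. Qed.

Lemma cmod_real (a : R) : cmod a%:C%C = `|a|.
Proof. by rewrite cmodE /= expr0n addr0 sqrtr_sqr. Qed.

Lemma normr_Re_le z : `|complex.Re z| <= cmod z.
Proof.
by rewrite cmodE -sqrtr_sqr ler_wsqrtr// lerDl sqr_ge0.
Qed.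

End modulus.

Section complex_measurable.
Context {R : realType} {disp : measure_display} {T : measurableType disp}.
Implicit Types f g : T -> R[i].

Lemma cmeasurableD f g :
  cmeasurable f -> cmeasurable g -> cmeasurable (fun x => f x + g x).
Proof.
move=> [f1 f2] [g1 g2]; split.
- by under eq_fun do rewrite cReD; apply: measurable_funD.
- by under eq_fun do rewrite cImD; apply: measurable_funD.
Qed.

Lemma cmeasurableN f : cmeasurable f -> cmeasurable (fun x => - f x).
Proof.
move=> [f1 f2]; split.
- by under eq_fun do rewrite cReN; apply: measurableT_comp.
- by under eq_fun do rewrite cImN; apply: measurableT_comp.
Qed.

Lemma cmeasurableB f g :
  cmeasurable f -> cmeasurable g -> cmeasurable (fun x => f x - g x).
Proof. by move=> mf mg; apply: cmeasurableD => //; exact: cmeasurableN. Qed.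

Lemma cmeasurable_cst (c : R[i]) : cmeasurable (fun _ : T => c).
Proof. by split; exact: measurable_cst. Qed.

Lemma cmeasurableM f g :
  cmeasurable f -> cmeasurable g -> cmeasurable (fun x => f x * g x).
Proof.
move=> [f1 f2] [g1 g2]; split.
- under eq_fun do rewrite cReM.
  by apply: measurable_funB; apply: measurable_funM.
- under eq_fun do rewrite cImM.
  by apply: measurable_funD; apply: measurable_funM.
Qed.

Lemma cmeasurable_sum (I : eqType) (s : seq I) (F : I -> T -> R[i]) :
  (forall i, i \in s -> cmeasurable (F i)) ->
  cmeasurable (fun x => \sum_(i <- s) F i x).
Proof.
elim: s => [|i s IH] mF.
  by under eq_fun do rewrite big_nil; exact: cmeasurable_cst.
under eq_fun do rewrite big_cons.
apply: cmeasurableD; first by apply: mF; rewrite mem_head.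
by apply: IH => j js; apply: mF; rewrite inE js orbT.
Qed.

Lemma measurable_cmod f :
  cmeasurable f -> measurable_fun setT (fun x => cmod (f x)).
Proof.
move=> [f1 f2]; under eq_fun do rewrite cmodE.
apply: (measurableT_comp (continuous_measurable_fun (@sqrt_continuous R))).
by apply: measurable_funD; apply: measurable_funX.
Qed.

Lemma measurable_cmod_powR (a : R) f :
  cmeasurable f -> measurable_fun setT (fun x => cmod (f x) `^ a).
Proof.
move=> mf; apply: (measurableT_comp (measurable_powR a)).
exact: measurable_cmod.
Qed.

Lemma cmeasurable_indic (c : R[i]) (A : set T) :
  measurable A -> cmeasurable (fun x => c * \1_A x).
Proof.
move=> mA; apply: cmeasurableM; first exact: cmeasurable_cst.
have e (x : T) : (\1_A x : R[i]) = (\1_A x : R)%:C%C.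
  by rewrite !indicE; case: (x \in A).
split; under eq_fun do rewrite e /=.
  exact: measurable_indic.
exact: measurable_cst.
Qed.

End complex_measurable.

Section elementary_inequalities.
Variable R : realType.
Implicit Types x t : R.

(** The sum is at most twice the larger term. This treats exponents below and above [1] alike and
    serves as triangle inequality for [modulus_integral]. *)
Lemma powR_add_le (a : R) x y : 0 <= a -> 0 <= x -> 0 <= y ->
  (x + y) `^ a <= 2 `^ a * (x `^ a + y `^ a).
Proof.
move=> a0 x0 y0; wlog xy : x y x0 y0 / x <= y.
  move=> H; case/orP: (le_total x y) => h; first exact: H.
  by rewrite addrC [X in _ * X]addrC; exact: H.
apply: (@le_trans _ _ ((2 * y) `^ a)).
  by rewrite ge0_ler_powR// ?nnegrE ?mulr_ge0 ?addr_ge0//; lra.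
rewrite powRM// ler_wpM2l ?powR_ge0// lerDr powR_ge0 //.
Qed.

(** First of four alternating Taylor bounds. Each of the next three applies the mean value theorem
    to a function whose derivative is controlled by the preceding bound. *)
Lemma sin_le_id x : 0 <= x -> sin x <= x.
Proof.
rewrite le_eqVlt => /predU1P[<-|x0]; first by rewrite sin0.
have D y : y \in `]0, x[ -> is_derive y 1 sin (cos y) by move=> _; exact: is_derive_sin.
have C : {within `[0, x], continuous (@sin R)}.
  by apply: continuous_subspaceT => y; exact: continuous_sin.
have [c _] := MVT x0 D C.
rewrite sin0 !subr0 => ->.
by rewrite -[leRHS]mul1r ler_wpM2r ?cos_le1// ltW.
Qed.

Lemma cos_ge_quadratic x : 1 - x ^+ 2 / 2 <= cos x.
Proof.
wlog x0 : x / 0 <= x.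
  move=> H; case/orP: (le_total 0 x) => h; first exact: H.
  by rewrite -cosN -sqrrN; apply: H; rewrite oppr_ge0.
move: x0; rewrite le_eqVlt => /predU1P[<-|x0].
  by rewrite cos0 expr0n mul0r subr0.
have D (y : R) : is_derive y 1 (fun y => cos y + y ^+ 2 / 2) (- sin y + y).
  by apply: is_derive_eq; rewrite /GRing.scale /=; field.
have [|y /itvP xy] := MVT x0 (fun y _ => D y).
  by apply: derivable_within_continuous => y _; case: (D y).
rewrite cos0 expr0n mul0r addr0 subr0 => E.
have /sin_le_id sy : 0 <= y by rewrite xy.
have : 0 <= (- sin y + y) * x by rewrite mulr_ge0 ?(ltW x0)//; lra.
by rewrite -E; lra.
Qed.

Lemma sin_ge_cubic x : 0 <= x -> x - x ^+ 3 / 6 <= sin x.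
Proof.
rewrite le_eqVlt => /predU1P[<-|x0].
  by rewrite sin0 expr0n mul0r subr0.
have D (y : R) : is_derive y 1 (fun y => sin y + y ^+ 3 / 6) (cos y + y ^+ 2 / 2).
  by apply: is_derive_eq; rewrite /GRing.scale /=; field.
have [|y /itvP xy] := MVT x0 (fun y _ => D y).
  by apply: derivable_within_continuous => y _; case: (D y).
rewrite sin0 expr0n mul0r addr0 !subr0 => E.
have cy := cos_ge_quadratic y.
have : 1 * x <= (cos y + y ^+ 2 / 2) * x by rewrite ler_wpM2r ?(ltW x0)//; lra.
by rewrite -E; lra.
Qed.

Lemma cos_le_quartic x : cos x <= 1 - x ^+ 2 / 2 + x ^+ 4 / 24.
Proof.
wlog x0 : x / 0 <= x.
  move=> H; case/orP: (le_total 0 x) => h; first exact: H.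
  have := H (- x); rewrite cosN sqrrN (_ : (- x) ^+ 4 = x ^+ 4); last by ring.
  by apply; rewrite oppr_ge0.
move: x0; rewrite le_eqVlt => /predU1P[<-|x0].
  by rewrite cos0 !expr0n !mul0r subr0 addr0.
have D (y : R) : is_derive y 1 (fun y => y ^+ 4 / 24 - y ^+ 2 / 2 - cos y)
    (y ^+ 3 / 6 - y + sin y).
  by apply: is_derive_eq; rewrite /GRing.scale /=; field.
have [|y /itvP xy] := MVT x0 (fun y _ => D y).
  by apply: derivable_within_continuous => y _; case: (D y).
rewrite cos0 !expr0n !mul0r !subr0 => E.
have sy : y - y ^+ 3 / 6 <= sin y by apply: sin_ge_cubic; rewrite xy.
have : 0 <= (y ^+ 3 / 6 - y + sin y) * x by rewrite mulr_ge0 ?(ltW x0)//; lra.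
by rewrite -E; lra.
Qed.

Lemma sqr_le_one_sub_cos x : `|x| <= 1 -> x ^+ 2 <= 4 * (1 - cos x).
Proof.
move=> x1; have := cos_le_quartic x.
have x2 : x ^+ 2 <= 1.
  by rewrite -[x ^+ 2]ger0_norm ?sqr_ge0// normrX exprn_ile1.
have -> : x ^+ 4 = x ^+ 2 * x ^+ 2 by ring.
have := sqr_ge0 x; nra.
Qed.

(** If [|x| <= 1] the term [k = 0] suffices. Otherwise the first scale with [|2 ^- k * x| <= 1]
    still has modulus above [1 / 2], so that its term alone is at least [1 / 16]. Unlike a square,
    each [1 - cos] has an expectation given by the characteristic function. *)
Lemma min_sqr_one_le_cos_sum x : exists n : nat,
  Num.min (x ^+ 2) 1 <= 16 * \sum_(k < n) (1 - cos (2^-1 ^+ k * x)).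
Proof.
have [x1|x1] := lerP `|x| 1.
  exists 1%N; rewrite big_ord1 expr0 mul1r.
  apply: (@le_trans _ _ (x ^+ 2)); first by rewrite ge_min lexx.
  have := sqr_le_one_sub_cos _ x1; have := cos_le1 x; lra.
have ex : exists n, `|2^-1 ^+ n * x| <= 1.
  have [n] : exists n : nat, `|x| < n%:R by exists (Num.bound `|x|); exact: archi_boundP.
  move=> xn; exists n; rewrite normrM ger0_norm ?exprn_ge0// exprVn.
  rewrite ler_pdivrMl ?exprn_gt0// mulr1 (le_trans (ltW xn))//.
  by rewrite -natrX ler_nat ltnW// ltn_expl.
have [[|n] nP nmin] := ex_minnP ex.
  by move: nP; rewrite expr0 mul1r leNgt x1.
exists n.+2; rewrite big_ord_recr /=.
apply: (@le_trans _ _ 1); first by rewrite ge_min lexx orbT.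
have s0 : 0 <= \sum_(i < n.+1) (1 - cos (2^-1 ^+ i * x)).
  by apply: sumr_ge0 => i _; rewrite subr_ge0 cos_le1.
have h : 1 < `|2^-1 ^+ n * x|.
  rewrite ltNge; apply/negP => /nmin; by rewrite ltnn.
have := sqr_le_one_sub_cos _ nP.
have -> : (2^-1 ^+ n.+1 * x) ^+ 2 = 4^-1 * (2^-1 ^+ n * x) ^+ 2.
  by rewrite (exprS 2^-1 n) -mulrA exprMn; congr (_ * _); field.
have : 1 <= (2^-1 ^+ n * x) ^+ 2.
  by rewrite -[X in _ <= X]ger0_norm ?sqr_ge0// normrX exprn_ege1// ltW.
lra.
Qed.

End elementary_inequalities.

(** * Simple functions and their integrals *)

Section bounded_random_variables.
Context {R : realType} {disp : measure_display} {T : measurableType disp}.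
Variable P : probability T R.

(** Expectations are manipulated as real numbers only within this class: stable integrals may fail
    to be integrable, but their sines, cosines and Riesz products belong to it. *)
Definition bounded_rv (f : T -> R) : Prop :=
  measurable_fun setT f /\ exists M, forall w, `|f w| <= M.

Lemma bounded_rv_cst (c : R) : bounded_rv (fun=> c).
Proof. by split; [exact: measurable_cst|exists `|c|]. Qed.

Lemma bounded_rvD f g :
  bounded_rv f -> bounded_rv g -> bounded_rv (fun w => f w + g w).
Proof.
move=> [mf [M fM]] [mg [N gN]]; split; first exact: measurable_funD.
by exists (M + N) => w; rewrite (le_trans (ler_normD _ _))// lerD.
Qed.

Lemma bounded_rvM f g :
  bounded_rv f -> bounded_rv g -> bounded_rv (fun w => f w * g w).
Proof.
move=> [mf [M fM]] [mg [N gN]]; split; first exact: measurable_funM.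
by exists (M * N) => w; rewrite normrM ler_pM.
Qed.

Lemma bounded_rv_cos f :
  measurable_fun setT f -> bounded_rv (fun w => cos (f w)).
Proof.
move=> mf; split; last by exists 1 => w; exact: cos_max.
exact: (measurableT_comp (continuous_measurable_fun (@continuous_cos R))).
Qed.

Lemma bounded_rv_sin f :
  measurable_fun setT f -> bounded_rv (fun w => sin (f w)).
Proof.
move=> mf; split; last by exists 1 => w; exact: sin_max.
exact: (measurableT_comp (continuous_measurable_fun (@continuous_sin R))).
Qed.

Lemma bounded_rv_prod (I : Type) (s : seq I) (F : I -> T -> R) :
  (forall i, bounded_rv (F i)) -> bounded_rv (fun w => \prod_(i <- s) F i w).
Proof.
move=> bF; elim: s => [|i s IH].
  by under eq_fun do rewrite big_nil; exact: bounded_rv_cst.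
by under eq_fun do rewrite big_cons; exact: bounded_rvM.
Qed.

Lemma bounded_rv_integrable f : bounded_rv f -> P.-integrable setT (EFin \o f).
Proof.
move=> [mf [M fM]]; apply: measurable_bounded_integrable => //.
  by apply: (le_lt_trans (probability_le1 P measurableT)); rewrite ltry.
exists M; split; first exact: num_real.
by move=> x Mx w _; exact: le_trans (fM w) (ltW Mx).
Qed.

Lemma Rintegral_boundedD f g : bounded_rv f -> bounded_rv g ->
  \int[P]_w (f w + g w) = \int[P]_w f w + \int[P]_w g w.
Proof. by move=> bf bg; rewrite RintegralD//; exact: bounded_rv_integrable. Qed.

Lemma Rintegral_boundedZ c f : bounded_rv f ->
  \int[P]_w (c * f w) = c * \int[P]_w f w.
Proof. by move=> bf; rewrite RintegralZl//; exact: bounded_rv_integrable. Qed.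

Lemma Rintegral_probability_cst (c : R) : \int[P]_w c = c.
Proof. by rewrite Rintegral_cst//= probability_setT /= mulr1. Qed.

Lemma EFin_Rintegral_bounded f : bounded_rv f ->
  (\int[P]_w (f w)%:E)%E = (\int[P]_w f w)%:E.
Proof.
move=> bf; rewrite /Rintegral fineK//.
by apply: integrable_fin_num => //; exact: bounded_rv_integrable.
Qed.

(** Markov's inequality, in the form in which all the union bounds below are made: exhibit a
    nonnegative function that is at least [1] on the event. *)
Lemma probability_le_integral (A : set T) (f : T -> \bar R) :
  measurable A -> measurable_fun setT f -> (forall w, 0 <= f w)%E ->
  (forall w, A w -> 1 <= f w)%E -> (P A <= \int[P]_w f w)%E.
Proof.
move=> mA mf f0 f1.
rewrite -[A in P A]setIT -integral_indic//.
apply: ge0_le_integral => //.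
- by apply/measurable_EFinP; exact: measurable_indic.
- move=> x _; rewrite indicE; case: (boolP (x \in A)) => [|_]; last exact: f0.
  by rewrite inE => /f1.
Qed.

End bounded_random_variables.

Section Lalpha.
Context {R : realType} {d : nat}.
Variable alpha : R.
Hypothesis alpha_gt0 : 0 < alpha.
Local Notation mu := (lebesgue_cv R d).
Implicit Types f g : 'cV[R]_d -> R[i].

(** The [alpha]-th power of the [L^alpha] quasi-norm, without the root: the exponent of the
    characteristic function and all tail bounds are linear in it. *)
Definition modulus_integral f : \bar R :=
  (\int[mu]_xi (cmod (f xi) `^ alpha)%:E)%E.

Lemma modulus_integral_ge0 f : (0 <= modulus_integral f)%E.
Proof. by apply: integral_ge0 => x _; rewrite lee_fin powR_ge0. Qed.

Lemma modulus_integralD f g : cmeasurable f -> cmeasurable g ->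
  (modulus_integral (fun x => f x + g x)%R
   <= (2 `^ alpha)%:E * (modulus_integral f + modulus_integral g))%E.
Proof.
move=> mf mg.
have m1 := measurable_cmod_powR alpha f mf.
have m2 := measurable_cmod_powR alpha g mg.
rewrite /modulus_integral -ge0_integralD//; do ?[exact/measurable_EFinP | by move=> x _; rewrite lee_fin powR_ge0].
rewrite -ge0_integralZl//; do ?[by apply/measurable_EFinP; exact: measurable_funD
  | by move=> x _; rewrite -EFinD lee_fin addr_ge0 ?powR_ge0].
apply: ge0_le_integral => //.
- by move=> x _; rewrite lee_fin powR_ge0.
- by apply/measurable_EFinP; apply: measurable_cmod_powR; exact: cmeasurableD.
- by apply/measurable_EFinP/measurable_funM => //; exact: measurable_funD.
- move=> x _; rewrite -EFinD -EFinM lee_fin.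
  apply: le_trans (powR_add_le _ _ _ _ _ _ _); rewrite ?cmod_ge0 ?(ltW alpha_gt0)//.
  by rewrite ge0_ler_powR ?nnegrE ?addr_ge0 ?cmod_ge0 ?cmodD// ltW.
Qed.

Lemma modulus_integralZ (c : R[i]) f : cmeasurable f ->
  modulus_integral (fun x => c * f x) =
  ((cmod c `^ alpha)%:E * modulus_integral f)%E.
Proof.
move=> mf; rewrite /modulus_integral -ge0_integralZl//; do ?[by apply/measurable_EFinP; exact: measurable_cmod_powR
  | by move=> x _; rewrite lee_fin powR_ge0 | by move=> x _; rewrite lee_fin | by rewrite lee_fin powR_ge0].
apply: eq_integral => x _.
by rewrite -EFinM cmodM powRM// cmod_ge0.
Qed.

Lemma modulus_integral_indic (c : R[i]) (A : set 'cV[R]_d) : measurable A ->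
  modulus_integral (fun x => c * \1_A x) = ((cmod c `^ alpha)%:E * mu A)%E.
Proof.
move=> mA; rewrite -[A in mu A]setIT -integral_indic//.
rewrite -ge0_integralZl//; do ?[by apply/measurable_EFinP; exact: measurable_indic
  | by move=> x _; rewrite lee_fin powR_ge0 | by move=> x _; rewrite lee_fin | by rewrite lee_fin powR_ge0].
apply: eq_integral => x _.
rewrite -EFinM !indicE; case: (x \in A); first by rewrite !mulr1.
by rewrite !mulr0 cmod0 powR0 ?gt_eqF.
Qed.

Lemma modulus_integral0 : modulus_integral (fun=> 0) = 0%E.
Proof.
rewrite /modulus_integral; under eq_integral do rewrite cmod0 powR0 ?gt_eqF//.
by rewrite integral0_eq.
Qed.

End Lalpha.

Section simple_functions.
Context {R : realType} {d : nat}.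
Variable alpha : R.
Hypothesis alpha_gt0 : 0 < alpha.
Local Notation mu := (lebesgue_cv R d).
Implicit Types s t : seq (R[i] * set 'cV[R]_d).

Definition simple_finite s : Prop := forall p, p \in s -> finite_volume p.2.

Definition simple_scale (c : R[i]) s := [seq (c * p.1, p.2) | p <- s].

Lemma simple_finite_cat s t :
  simple_finite s -> simple_finite t -> simple_finite (s ++ t).
Proof.
by move=> fs ft p; rewrite mem_cat => /orP[/fs|/ft].
Qed.

Lemma simple_finite_scale c s : simple_finite s -> simple_finite (simple_scale c s).
Proof. by move=> fs p /mapP[q /fs fq ->]. Qed.

Lemma simple_fun_cat s t x :
  simple_fun (s ++ t) x = simple_fun s x + simple_fun t x.
Proof. by rewrite /simple_fun big_cat. Qed.

Lemma simple_fun_scale c s x : simple_fun (simple_scale c s) x = c * simple_fun s x.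
Proof.
by rewrite /simple_fun big_map mulr_sumr; apply: eq_bigr => p _; rewrite mulrA.
Qed.

Lemma simple_integral_cat (disp : measure_display) (Omega : measurableType disp)
    (W : set 'cV[R]_d -> Omega -> R[i]) s t w :
  simple_integral W (s ++ t) w = simple_integral W s w + simple_integral W t w.
Proof. by rewrite /simple_integral big_cat. Qed.

Lemma simple_integral_scale (disp : measure_display) (Omega : measurableType disp)
    (W : set 'cV[R]_d -> Omega -> R[i])
    c s w :
  simple_integral W (simple_scale c s) w = c * simple_integral W s w.
Proof.
by rewrite /simple_integral big_map mulr_sumr; apply: eq_bigr => p _; rewrite mulrA.
Qed.

Lemma cmeasurable_simple_fun s : simple_finite s -> cmeasurable (simple_fun s).
Proof.
move=> fs; apply: cmeasurable_sum => p /fs [mp _].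
exact: cmeasurable_indic.
Qed.

Lemma simple_modulus_lty s : simple_finite s ->
  (modulus_integral alpha (simple_fun s) < +oo)%E.
Proof.
elim: s => [|p s IH] fs.
  rewrite (_ : simple_fun [::] = fun=> 0) ?modulus_integral0 ?ltry//.
  by apply/funext => x; rewrite /simple_fun big_nil.
have fs' : simple_finite s by move=> q qs; apply: fs; rewrite inE qs orbT.
have [mp volp] : finite_volume p.2 by apply: fs; rewrite mem_head.
rewrite (_ : simple_fun _ = fun x => p.1 * \1_p.2 x + simple_fun s x); last first.
  by apply/funext => x; rewrite /simple_fun big_cons.
apply: le_lt_trans.
  apply: modulus_integralD => //; last exact: cmeasurable_simple_fun.
  exact: cmeasurable_indic.
rewrite modulus_integral_indic// lte_mul_pinfty ?lee_fin ?powR_ge0//.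
rewrite lte_add_pinfty ?IH// lte_mul_pinfty ?lee_fin ?powR_ge0//.
Qed.

(** At most one cell contributes at each point, so the power passes through the sum; off the cells
    both sides vanish because zero to the power [alpha] is zero when [alpha > 0]. *)
Lemma simple_fun_disjoint (I : eqType) (B : I -> set 'cV[R]_d) (c : I -> R[i])
    (r : seq I) x : uniq r -> trivIset setT B ->
  cmod (simple_fun [seq (c j, B j) | j <- r] x) `^ alpha =
  \sum_(j <- r) cmod (c j) `^ alpha * \1_(B j) x.
Proof.
move=> ur tB; rewrite /simple_fun big_map /=.
have [[j jr Bj]|nB] := pselect (exists2 j, j \in r & B j x).
  have Bk k : k != j -> (x \in B k) = false.
    move=> kj; apply/negP; rewrite inE => Bk.
    move/eqP: kj; apply; apply: (tB k j) => //; by exists x.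
  rewrite !(bigD1_seq j)//= !big1 ?addr0.
  - by rewrite !indicE mem_set// !mulr1.
  - by move=> k kj; rewrite indicE Bk// mulr0.
  - by move=> k kj; rewrite indicE Bk// mulr0.
have Bk k : k \in r -> (x \in B k) = false.
  by move=> kr; apply/negP; rewrite inE => Bk; apply: nB; exists k.
rewrite !big_seq !big1 ?cmod0 ?powR0 ?gt_eqF//.
- by move=> k kr; rewrite indicE Bk// mulr0.
- by move=> k kr; rewrite indicE Bk// mulr0.
Qed.

Lemma modulus_integral_disjoint (I : eqType) (B : I -> set 'cV[R]_d)
    (c : I -> R[i]) (r : seq I) : uniq r -> trivIset setT B ->
  (forall j, measurable (B j)) ->
  modulus_integral alpha (simple_fun [seq (c j, B j) | j <- r]) =
  (\sum_(j <- r) (cmod (c j) `^ alpha)%:E * mu (B j))%E.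
Proof.
move=> ur tB mB; rewrite /modulus_integral.
under eq_integral do rewrite simple_fun_disjoint// -sumEFin.
rewrite ge0_integral_sum//; last 2 first.
- move=> j; apply/measurable_EFinP/measurable_funM => //.
- by move=> j x _; rewrite lee_fin mulr_ge0 ?powR_ge0.
apply: eq_bigr => j _; rewrite -[B j in RHS]setIT -integral_indic//.
rewrite -ge0_integralZl//; do ?[by apply/measurable_EFinP; exact: measurable_indic
  | by move=> x _; rewrite lee_fin powR_ge0 | by move=> x _; rewrite lee_fin | by rewrite lee_fin powR_ge0].
Qed.

End simple_functions.

(** * Moments of integrals of simple functions *)

Section stable_measure.
Context {R : realType} {d : nat} {disp : measure_display}
  {Omega : measurableType disp}.
Variables (P : probability Omega R) (alpha : R)
  (W : set 'cV[R]_d -> Omega -> R[i]).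
Hypothesis alpha_gt0 : 0 < alpha.
Hypothesis W_stable : isotropic_stable_measure P alpha W.
Local Notation SI := (simple_integral W).
Local Notation power := (modulus_integral alpha).
Implicit Types s t : seq (R[i] * set 'cV[R]_d).

Definition scale_constant : R :=
  (2 * pi)^-1 * \int[@lebesgue_measure R]_(t in `[0, pi]) (`|cos t| `^ alpha).

Lemma scale_constant_ge0 : 0 <= scale_constant.
Proof.
rewrite /scale_constant mulr_ge0 ?invr_ge0 ?mulr_ge0 ?pi_ge0//.
by apply: Rintegral_ge0 => x _; exact: powR_ge0.
Qed.

Lemma cmeasurable_simple_integral s : simple_finite s -> cmeasurable (SI s).
Proof.
move=> fs; apply: cmeasurable_sum => p /fs fp.
apply: cmeasurableM; first exact: cmeasurable_cst.
exact: (stable_measurable W_stable).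
Qed.

Lemma measurable_Re_simple_integral s : simple_finite s ->
  measurable_fun setT (fun w => complex.Re (SI s w)).
Proof. by move=> /cmeasurable_simple_integral []. Qed.

(** The constant sequence approximates. This brings simple integrals within the scope of
    [stable_characteristic], which speaks of stochastic integrals. *)
Lemma simple_stochastic_integral s : simple_finite s ->
  is_stochastic_integral P alpha W (simple_fun s) (SI s).
Proof.
move=> fs; split; first exact: cmeasurable_simple_integral.
exists (fun=> s); split; first by move=> _ p; exact: fs.
- rewrite (_ : (fun _ => _) = cst 0%E); first exact: cvg_cst.
  apply/funext => n /=; under eq_integral do rewrite subrr cmod0 powR0 ?gt_eqF//.
  by rewrite integral0_eq.
- move=> e e0; rewrite (_ : (fun _ => _) = cst 0%E); first exact: cvg_cst.
  apply/funext => n /=; rewrite (_ : [set w | _] = set0) ?measure0//.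
  by apply/seteqP; split => w //=; rewrite subrr cmod0 leNgt e0.
Qed.

(** Real and imaginary parts of the characteristic function at [z = 1]; other arguments are absorbed
    in the coefficients of [s]. The vanishing sine is the symmetry of the law. *)
Lemma simple_characteristic s : simple_finite s ->
  \int[P]_w cos (complex.Re (SI s w)) =
    expR (- (scale_constant * fine (power (simple_fun s)))) /\
  \int[P]_w sin (complex.Re (SI s w)) = 0.
Proof.
move=> fs.
have Ls : in_Lalpha alpha (simple_fun s).
  by split; [exact: cmeasurable_simple_fun|exact: simple_modulus_lty].
have := stable_characteristic W_stable Ls (simple_stochastic_integral s fs) 1.
rewrite /cexpectation.
have c1 : (1 : R[i])^*%C = 1 by apply/eqP; rewrite eq_complex /= oppr0 !eqxx.
under eq_Rintegral do rewrite c1 mul1r /=.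
under [X in (_ +i* X)%C]eq_Rintegral do rewrite c1 mul1r /=.
rewrite (_ : cmod 1 = 1); last exact: ComplexField.Normc.normc1.
by rewrite powR1 mul1r => -[-> ->].
Qed.

Lemma integral_one_sub_cos s : simple_finite s ->
  (\int[P]_w (1 - cos (complex.Re (SI s w)))%:E
   <= scale_constant%:E * power (simple_fun s))%E.
Proof.
move=> fs; have mR := measurable_Re_simple_integral s fs.
have bc := bounded_rv_cos _ mR.
have -> : (fun w => (1 - cos (complex.Re (SI s w)))%:E)%R =
    (fun w => (1 + -1 * cos (complex.Re (SI s w)))%:E)%R.
  by apply/funext => w; rewrite mulN1r.
rewrite EFin_Rintegral_bounded; last first.
  by apply: bounded_rvD; [|apply: bounded_rvM => //]; exact: bounded_rv_cst.
rewrite Rintegral_boundedD//; [|exact: bounded_rv_cst|]; last first.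
  by apply: bounded_rvM => //; exact: bounded_rv_cst.
rewrite Rintegral_boundedZ// Rintegral_probability_cst.
rewrite (simple_characteristic s fs).1.
rewrite -[power _]fineK; last first.
  by rewrite ge0_fin_numE ?modulus_integral_ge0 ?simple_modulus_lty.
rewrite -EFinM lee_fin.
set u := scale_constant * _; have := expR_ge1Dx (- u); lra.
Qed.

(** The [16] comes from [min_sqr_one_le_cos_sum], the denominator from the geometric series over the
    scales. *)
Definition tail_constant : R := 16 * scale_constant / (1 - 2^-1 `^ alpha).

Lemma half_powR_lt1 : 2^-1 `^ alpha < 1 :> R.
Proof.
rewrite -[ltRHS](congr1 (@^~ alpha) (powR1 R)) gt0_ltr_powR ?nnegrE ?invr_ge0 ?ler01 ?ler0n//.
by rewrite invf_lt1 ?ltr1n.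
Qed.

Lemma tail_constant_ge0 : 0 <= tail_constant.
Proof.
apply: divr_ge0; first by rewrite mulr_ge0 ?scale_constant_ge0 ?ler0n.
by rewrite subr_ge0 ltW// half_powR_lt1.
Qed.

(* Sum [1 - cos (2 ^- k * x)] over all scales [k]; by stability the expectations
   form a geometric series of ratio [2 ^- alpha]. *)
Lemma truncated_second_moment s : simple_finite s ->
  (\int[P]_w (Num.min (complex.Re (SI s w) ^+ 2) 1)%:E
   <= tail_constant%:E * power (simple_fun s))%E.
Proof.
move=> fs; have mR := measurable_Re_simple_integral s fs.
(* The number of scales in [min_sqr_one_le_cos_sum] depends on [w], so all scales are summed; being
   nonnegative, the series is integrated term by term. *)
pose F k w := (16 * (1 - cos (2^-1 ^+ k * complex.Re (SI s w))))%:E.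
have mF k : measurable_fun setT (F k).
  apply/measurable_EFinP/measurable_funM => //; apply: measurable_funB => //.
  apply: (bounded_rv_cos _ _).1; exact: measurable_funM.
have F0 k w : (0 <= F k w)%E by rewrite lee_fin mulr_ge0 ?ler0n// subr_ge0 cos_le1.
have mmin : measurable_fun setT
    (fun w => (Num.min (complex.Re (SI s w) ^+ 2) 1)%:E).
  by apply/measurable_EFinP/measurable_minr => //; exact: measurable_funX.
apply: (@le_trans _ _ (\int[P]_w (\sum_(0 <= k <oo) F k w))%E).
  apply: ge0_le_integral => //.
  - by move=> w _; rewrite lee_fin le_min sqr_ge0 ler01.
  - by apply: ge0_emeasurable_sum => // k w _ _; exact: F0.
  - move=> w _; have [n nP] := min_sqr_one_le_cos_sum R (complex.Re (SI s w)).
    apply: (@le_trans _ _ (\sum_(0 <= k < n) F k w)%E).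
      by rewrite sumEFin lee_fin -mulr_sumr big_mkord.
    exact: nneseries_lim_ge.
rewrite integral_nneseries//.
apply: lime_le; first by apply: is_cvg_nneseries => k _ _; exact: integral_ge0.
apply: nearW => n.
have Ik k : (\int[P]_w F k w <=
    (16 * scale_constant * (2^-1 `^ alpha) ^+ k)%:E * power (simple_fun s))%E.
  have := integral_one_sub_cos _ (simple_finite_scale (2^-1 ^+ k)%:C%C _ fs).
  rewrite (_ : simple_fun _ = fun x => (2^-1 ^+ k)%:C%C * simple_fun s x); last first.
    by apply/funext => x; rewrite simple_fun_scale.
  rewrite modulus_integralZ//; last exact: cmeasurable_simple_fun.
  rewrite cmod_real ger0_norm ?exprn_ge0 ?invr_ge0 ?ler0n// => h.
  rewrite /F; under eq_integral do rewrite EFinM.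
  rewrite ge0_integralZl//; last first.
    apply/measurable_EFinP; apply: measurable_funB => //.
    apply: (bounded_rv_cos _ _).1; exact: measurable_funM.
  have -> : (2^-1 `^ alpha) ^+ k = (2^-1 ^+ k) `^ alpha :> R.
    rewrite -!powR_mulrn ?powR_ge0 ?invr_ge0 ?ler0n// -!powRrM.
    by rewrite mulrC.
  rewrite -mulrA EFinM -muleA lee_pmul2l ?lte_fin ?ltr0n//.
  move: h; rewrite muleA -EFinM; congr (_ <= _)%E; apply: eq_integral => w _.
  by rewrite simple_integral_scale cReM /= mul0r subr0.
apply: (@le_trans _ _ (\sum_(0 <= k < n)
    (16 * scale_constant * (2^-1 `^ alpha) ^+ k)%:E * power (simple_fun s))%E).
  by apply: lee_sum => k _; exact: Ik.
rewrite -ge0_sume_distrl; last first.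
  move=> k _; rewrite lee_fin; apply: mulr_ge0; last by rewrite exprn_ge0 ?powR_ge0.
  by rewrite mulr_ge0 ?scale_constant_ge0 ?ler0n.
rewrite sumEFin lee_wpmul2r ?modulus_integral_ge0// lee_fin.
rewrite -mulr_sumr /tail_constant; apply: ler_wpM2l.
  by apply: mulr_ge0 => //; exact: scale_constant_ge0.
rewrite big_mkord.
have h1 : 0 < 1 - 2^-1 `^ alpha :> R by rewrite subr_gt0 half_powR_lt1.
rewrite -[leRHS]mul1r ler_pdivlMr// mulrC.
have -> : (1 - 2^-1 `^ alpha) * \sum_(i < n) (2^-1 `^ alpha) ^+ i = 1 - (2^-1 `^ alpha) ^+ n :> R.
  by rewrite -opprB mulNr -subrX1 opprB.
by rewrite gerBl exprn_ge0// powR_ge0.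
Qed.

End stable_measure.

(** * Riesz products and the maximal inequality *)

(** By [expR t <= 1 / (1 - t)] with [t = x / 2 - x ^+ 2], it remains to see that [(1 + sin x / 2) *
    (1 - x / 2 + x ^+ 2) >= 1]. There [sin x] is replaced by [x - x ^+ 2 / 6] if [x >= 0] and by [x]
    if [x < 0]. The term [- x ^+ 2] pays for the second order. *)
Lemma expR_le_one_add_sin (R : realType) (x : R) : `|x| <= 1 ->
  expR (2^-1 * x - x ^+ 2) <= 1 + 2^-1 * sin x.
Proof.
move=> x1; have [xl xu] : -1 <= x /\ x <= 1 by move: x1; rewrite ler_norml => /andP.
have D0 : 0 < 1 - 2^-1 * x + x ^+ 2 by nra.
rewrite -[leLHS]invrK -expRN opprB.
apply: (@le_trans _ _ (1 - 2^-1 * x + x ^+ 2)^-1).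
  rewrite lef_pV2 ?posrE ?expR_gt0//.
  by have := expR_ge1Dx (x ^+ 2 - 2^-1 * x); lra.
rewrite -[leLHS]mul1r ler_pdivrMr//.
have [x0|x0] := leP 0 x.
  have h : x - x ^+ 2 / 6 <= sin x.
    by apply: le_trans (sin_ge_cubic _ _ x0); nra.
  have : (1 + 2^-1 * (x - x ^+ 2 / 6)) * (1 - 2^-1 * x + x ^+ 2)
      <= (1 + 2^-1 * sin x) * (1 - 2^-1 * x + x ^+ 2).
    by rewrite ler_wpM2r ?(ltW D0)//; lra.
  apply: le_trans.
  have -> : (1 + 2^-1 * (x - x ^+ 2 / 6)) * (1 - 2^-1 * x + x ^+ 2) =
      1 + x ^+ 2 * (2 / 3 + 13 / 24 * x - x ^+ 2 / 12) by field.
  by rewrite lerDl mulr_ge0 ?sqr_ge0//; nra.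
have h : x <= sin x.
  by rewrite -[x]opprK sinN lerN2 sin_le_id// oppr_ge0 ltW.
have : (1 + 2^-1 * x) * (1 - 2^-1 * x + x ^+ 2)
    <= (1 + 2^-1 * sin x) * (1 - 2^-1 * x + x ^+ 2).
  by rewrite ler_wpM2r ?(ltW D0)//; lra.
apply: le_trans.
have -> : (1 + 2^-1 * x) * (1 - 2^-1 * x + x ^+ 2) =
    1 + x ^+ 2 * (3 / 4 + x / 2) by field.
by rewrite lerDl mulr_ge0 ?sqr_ge0//; lra.
Qed.

Section riesz_products.
Context {R : realType} {d : nat} {disp : measure_display}
  {Omega : measurableType disp}.
Variables (P : probability Omega R) (alpha : R)
  (W : set 'cV[R]_d -> Omega -> R[i]).
Hypothesis alpha_gt0 : 0 < alpha.
Hypothesis W_stable : isotropic_stable_measure P alpha W.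
Context {I : eqType}.
Variable B : I -> set 'cV[R]_d.
Hypothesis fB : forall j, finite_volume (B j).
Hypothesis tB : trivIset setT B.
Implicit Types (c : I -> R[i]) (r : seq I).

Definition phase c r w := \sum_(j <- r) complex.Re (c j * W (B j) w).

Definition riesz_product c r w :=
  \prod_(j <- r) (1 + 2^-1 * sin (complex.Re (c j * W (B j) w))).

Let cells c r := [seq (c j, B j) | j <- r].

Let cells_finite c r : simple_finite (cells c r).
Proof. by move=> p /mapP[j _ ->]; exact: fB. Qed.

Let phaseE c r w : phase c r w = complex.Re (simple_integral W (cells c r) w).
Proof. by rewrite /simple_integral big_map cRe_sum. Qed.

Lemma measurable_phase c r : measurable_fun setT (phase c r).
Proof.
rewrite (_ : phase c r = fun w => complex.Re (simple_integral W (cells c r) w)).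
  exact: (measurable_Re_simple_integral P alpha).
by apply/funext => w; rewrite phaseE.
Qed.

Lemma phase_cons c j r w :
  phase c (j :: r) w = complex.Re (c j * W (B j) w) + phase c r w.
Proof. by rewrite /phase big_cons. Qed.

Lemma bounded_riesz_product c r : bounded_rv (riesz_product c r).
Proof.
apply: bounded_rv_prod => j.
apply: bounded_rvD; first exact: bounded_rv_cst.
apply: bounded_rvM; first exact: bounded_rv_cst.
apply: bounded_rv_sin.
have := measurable_phase c [:: j].
by rewrite /phase; under eq_fun do rewrite big_seq1.
Qed.

Lemma eq_riesz_product c c' r w : {in r, c =1 c'} ->
  riesz_product c r w = riesz_product c' r w.
Proof.
by move=> cc; rewrite /riesz_product big_seq [RHS]big_seq; apply: eq_bigr => j /cc ->.
Qed.

(* Each factor only shifts the phase by [+- c j * W (B j)], and flipping the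
   sign of a coefficient of a disjoint family does not change its law. *)
Lemma riesz_product_orthogonal r r' c : uniq (r' ++ r) ->
  \int[P]_w (cos (phase c r' w) * riesz_product c r w) =
    \int[P]_w cos (phase c r' w) /\
  \int[P]_w (sin (phase c r' w) * riesz_product c r w) = 0.
Proof.
elim: r r' c => [|i r IH] r' c u.
  split.
    by under eq_Rintegral do rewrite /riesz_product big_nil mulr1.
  under eq_Rintegral do rewrite /riesz_product big_nil mulr1 phaseE.
  exact: (simple_characteristic P alpha W alpha_gt0 W_stable _ (cells_finite c r')).2.
have ui : i \notin r' ++ r.
  by move: u; rewrite -cat1s uniq_catCA cat1s cons_uniq => /andP[].
have [ir' ir] : i \notin r' /\ i \notin r.
  by apply/andP; rewrite -negb_or -mem_cat.
have u' : uniq ((i :: r') ++ r) by move: u; rewrite -cat1s uniq_catCA.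
(* The induction moves [i] from the product into the phase. With [e = 1] or [-1], the coefficients
   [cs e] add or subtract the [i]-th term there and leave the product over [r] unchanged. *)
pose cs (e : R[i]) j := if j == i then e * c i else c j.
have csr e : {in r, c =1 cs e}.
  by move=> j jr; rewrite /cs; case: eqP => // ji; move: ir; rewrite -ji jr.
have csr' e w : phase (cs e) r' w = phase c r' w.
  rewrite /phase big_seq [RHS]big_seq; apply: eq_bigr => j jr'.
  by rewrite /cs; case: eqP => // ji; move: ir'; rewrite -ji jr'.
have phN w : phase (cs (-1)) (i :: r') w =
    phase c r' w - complex.Re (c i * W (B i) w).
  by rewrite phase_cons csr' /cs eqxx mulN1r mulNr cReN addrC.
have phP w : phase (cs 1) (i :: r') w =
    phase c r' w + complex.Re (c i * W (B i) w).
  by rewrite phase_cons csr' /cs eqxx mul1r addrC.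
have [cP sP] := IH _ (cs 1) u'; have [cN sN] := IH _ (cs (-1)) u'.
have [c0 s0] : _ /\ _ := IH r' c (andP (u' : _ && _)).2.
have eqc : \int[P]_w cos (phase (cs (-1)) (i :: r') w) =
    \int[P]_w cos (phase (cs 1) (i :: r') w).
  under eq_Rintegral do rewrite phaseE.
  under [RHS]eq_Rintegral do rewrite phaseE.
  have chE e := (simple_characteristic P alpha W alpha_gt0 W_stable _
    (cells_finite (cs e) (i :: r'))).1.
  rewrite (chE (-1)) (chE 1).
  have ui' : uniq (i :: r') by move: u'; rewrite cat_uniq => /andP[].
  have pE e := modulus_integral_disjoint alpha alpha_gt0 I B (cs e) _ ui' tB
    (fun j => (fB j).1).
  rewrite (pE (-1)) (pE 1).
  congr (expR (- (_ * fine _))); apply: eq_bigr => j _.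
  by rewrite /cs; case: (j == i); rewrite ?mulN1r ?mul1r ?cmodN.
have bR e := bounded_riesz_product (cs e) r.
have bc f : measurable_fun setT f -> bounded_rv (fun w => cos (f w) * riesz_product c r w).
  by move=> mf; apply: bounded_rvM; [exact: bounded_rv_cos|exact: bounded_riesz_product].
have bs f : measurable_fun setT f -> bounded_rv (fun w => sin (f w) * riesz_product c r w).
  by move=> mf; apply: bounded_rvM; [exact: bounded_rv_sin|exact: bounded_riesz_product].
have bZ k f : bounded_rv f -> bounded_rv (fun w => k * f w).
  by move=> bf; apply: bounded_rvM => //; exact: bounded_rv_cst.
have mph e := measurable_phase (cs e) (i :: r').
have mp := measurable_phase c r'.
split.
(* Product-to-sum formulas: with [a] the new term, [cos p * sin a] is half of
   [sin (p + a) - sin (p - a)], where both expectations vanish by induction. In the other half,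
   [sin p * sin a] is half of [cos (p - a) - cos (p + a)], where they cancel by [eqc]. *)
- transitivity (\int[P]_w (cos (phase c r' w) * riesz_product c r w +
    (4^-1 * (sin (phase (cs 1) (i :: r') w) * riesz_product c r w) +
     (- 4^-1) * (sin (phase (cs (-1)) (i :: r') w) * riesz_product c r w)))).
    apply: eq_Rintegral => w _; rewrite /riesz_product big_cons -/(riesz_product c r w).
    by rewrite phP phN sinD sinB; field.
  rewrite Rintegral_boundedD ?Rintegral_boundedD; do ?[exact: bc | exact: bs
    | by apply: bounded_rvD; apply: bZ; exact: bs | by apply: bZ; exact: bs].
  rewrite !Rintegral_boundedZ; do ?exact: bs.
  under [X in _ + (_ * X + _)]eq_Rintegral do rewrite (eq_riesz_product _ _ _ _ (csr 1)).
  under [X in _ + (_ + _ * X)]eq_Rintegral do rewrite (eq_riesz_product _ _ _ _ (csr (-1))).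
  by rewrite sP sN c0 !mulr0 !addr0.
- transitivity (\int[P]_w (sin (phase c r' w) * riesz_product c r w +
    (4^-1 * (cos (phase (cs (-1)) (i :: r') w) * riesz_product c r w) +
     (- 4^-1) * (cos (phase (cs 1) (i :: r') w) * riesz_product c r w)))).
    apply: eq_Rintegral => w _; rewrite /riesz_product big_cons -/(riesz_product c r w).
    by rewrite phP phN cosB cosD; field.
  rewrite Rintegral_boundedD ?Rintegral_boundedD; do ?[exact: bc | exact: bs
    | by apply: bounded_rvD; apply: bZ; exact: bc | by apply: bZ; exact: bc].
  rewrite !Rintegral_boundedZ; do ?exact: bc.
  under [X in _ + (_ + _ * X)]eq_Rintegral do rewrite (eq_riesz_product _ _ _ _ (csr 1)).
  under [X in _ + (_ * X + _)]eq_Rintegral do rewrite (eq_riesz_product _ _ _ _ (csr (-1))).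
  by rewrite cP cN s0 eqc add0r mulNr subrr.
Qed.

Lemma expectation_riesz_product c r : uniq r -> \int[P]_w riesz_product c r w = 1.
Proof.
move=> ur; have [h _] := riesz_product_orthogonal r [::] c ur.
move: h; under eq_Rintegral do rewrite /phase big_nil cos0 mul1r.
move=> ->.
under eq_Rintegral do rewrite /phase big_nil cos0.
exact: Rintegral_probability_cst.
Qed.

Lemma riesz_product_ge0 c r w : 0 <= riesz_product c r w.
Proof.
apply: prodr_ge0 => j _.
have := sin_geN1 (complex.Re (c j * W (B j) w)); lra.
Qed.

(** The product of [expR_le_one_add_sin] over the cells; the squares, of sum at most [1], cost the
    [- 1] in the exponent. *)
Lemma riesz_product_ge c r w :
  (forall j, j \in r -> `|complex.Re (c j * W (B j) w)| <= 1) ->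
  \sum_(j <- r) complex.Re (c j * W (B j) w) ^+ 2 <= 1 ->
  expR (2^-1 * phase c r w - 1) <= riesz_product c r w.
Proof.
move=> h1 h2.
apply: (@le_trans _ _ (\prod_(j <- r) expR (2^-1 * complex.Re (c j * W (B j) w)
    - complex.Re (c j * W (B j) w) ^+ 2))).
  rewrite -expR_sum ler_expR sumrB -mulr_sumr /phase.
  by move: h2; set a := \sum_(_ <- _) _ ^+ 2; lra.
rewrite /riesz_product big_seq [leRHS]big_seq; apply: ler_prod => j jr.
by rewrite expR_ge0 expR_le_one_add_sin// h1.
Qed.

End riesz_products.

(** * Maximal inequality for kernels that are constant on common cells *)

Section discrete_maximal_inequality.
Context {R : realType} {d : nat} {disp : measure_display}
  {Omega : measurableType disp}.
Variables (P : probability Omega R) (alpha : R)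
  (W : set 'cV[R]_d -> Omega -> R[i]).
Hypothesis alpha_gt0 : 0 < alpha.
Hypothesis W_stable : isotropic_stable_measure P alpha W.
Context {I : finType}.
Variable B : I -> set 'cV[R]_d.
Hypothesis fB : forall j, finite_volume (B j).
Hypothesis tB : trivIset setT B.
Local Notation mu := (lebesgue_cv R d).
Local Notation S c w := (complex.Re (\sum_j c j * W (B j) w)).

Let measurable_S c : measurable_fun setT (fun w => S c w).
Proof.
have mW : cmeasurable (fun w => \sum_j c j * W (B j) w).
  apply: cmeasurable_sum => j _; apply: cmeasurableM; first exact: cmeasurable_cst.
  exact: (stable_measurable W_stable).
by case: mW.
Qed.

Lemma measurable_max_event N (c : 'I_N -> I -> R[i]) (lam : R) :
  measurable [set w | exists k, lam < `|S (c k) w|].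
Proof.
rewrite (_ : [set w | _] = \bigcup_(k in [set: 'I_N]) [set w | lam < `|S (c k) w|]).
  apply: fin_bigcup_measurable => [|k _]; first exact: finite_finset.
  rewrite -[X in measurable X]setTI; apply: measurable_fun_ltr => //.
  exact: measurableT_comp.
by apply/seteqP; split => w /= [k]; [move=> h; exists k|move=> _ h; exists k].
Qed.

(* [a j] and [b j] are the truncated squares of the real and imaginary parts of
   [g j * W (B j)]: where their sum is below [1] no truncation takes place and
   the Riesz products of [c k] and [- c k] bound [`|S (c k)|]. *)
Lemma discrete_maximal_inequality N (c : 'I_N -> I -> R[i]) (g : I -> R) (lam : R) :
  (forall k j, cmod (c k j) <= g j) ->
  (P [set w | exists k, (lam < `|S (c k) w|)%R] <=
   (2 * tail_constant alpha)%:E * (\sum_j (g j `^ alpha)%:E * mu (B j)) +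
   (2 * N%:R * expR (1 - 2^-1 * lam))%:E)%E.
Proof.
have tc0 : 0 <= tail_constant alpha by exact: tail_constant_ge0.
(* That [g] is nonnegative is only known through some [c k]; for [N = 0] the event is empty. *)
have [k0|] := pselect (N = 0%N).
  move=> _; rewrite (_ : [set w | _] = set0) ?measure0; last first.
    by apply/seteqP; split => w //= -[k _]; have := ltn_ord k; rewrite [X in (_ < X)%N]k0.
  have -> : N%:R = 0 :> R by rewrite k0.
  rewrite mulr0 mul0r adde0; apply: mule_ge0; first by rewrite lee_fin mulr_ge0.
  by apply: sume_ge0 => j _; rewrite mule_ge0 ?lee_fin ?powR_ge0.
move=> N0 cg; have g0 j : 0 <= g j.
  have kN : (0 < N)%N by rewrite lt0n; apply/eqP.
  by apply: le_trans (cg (Ordinal kN) j); exact: cmod_ge0.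
pose r := index_enum I.
have ur : uniq r by exact: index_enum_uniq.
pose a j w := Num.min (complex.Re (simple_integral W [:: ((g j)%:C%C, B j)] w) ^+ 2) 1.
(* Multiplication by [- i] turns the imaginary part of [W (B j)] into a real part, so
   [truncated_second_moment] applies to it as well. *)
pose b j w := Num.min (complex.Re (simple_integral W [:: ((0 +i* - g j)%C, B j)] w) ^+ 2) 1.
have fa j (z : R[i]) : simple_finite [:: (z, B j)].
  by move=> p; rewrite inE => /eqP ->; exact: fB.
have msq j z : measurable_fun setT
    (fun w => Num.min (complex.Re (simple_integral W [:: (z, B j)] w) ^+ 2) 1).
  apply: measurable_minr => //; apply: measurable_funX.
  exact: (measurable_Re_simple_integral _ _ _ W_stable).
have Ia j : (\int[P]_w (a j w)%:E <= (tail_constant alpha)%:E * ((g j `^ alpha)%:E * mu (B j)))%E.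
  have := truncated_second_moment _ _ _ alpha_gt0 W_stable _ (fa j (g j)%:C%C).
  move/le_trans; apply.
  rewrite (_ : simple_fun _ = fun x => (g j)%:C%C * \1_(B j) x); last first.
    by apply/funext => x; rewrite /simple_fun big_seq1.
  rewrite modulus_integral_indic//; last by have [] := fB j.
  by rewrite cmod_real ger0_norm.
have Ib j : (\int[P]_w (b j w)%:E <= (tail_constant alpha)%:E * ((g j `^ alpha)%:E * mu (B j)))%E.
  have := truncated_second_moment _ _ _ alpha_gt0 W_stable _ (fa j (0 +i* - g j)%C).
  move/le_trans; apply.
  rewrite (_ : simple_fun _ = fun x => (0 +i* - g j)%C * \1_(B j) x); last first.
    by apply/funext => x; rewrite /simple_fun big_seq1.
  rewrite modulus_integral_indic//; last by have [] := fB j.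
  by rewrite cmodE /= expr0n add0r sqrrN sqrtr_sqr ger0_norm.
have a0 j w : 0 <= a j w by rewrite le_min sqr_ge0 ler01.
have b0 j w : 0 <= b j w by rewrite le_min sqr_ge0 ler01.
pose rp k w := riesz_product W B (c k) r w.
pose rn k w := riesz_product W B (fun j => - c k j) r w.
have rp0 k w : 0 <= rp k w by exact: riesz_product_ge0.
have rn0 k w : 0 <= rn k w by exact: riesz_product_ge0.
have brp k : bounded_rv (rp k) by exact: (bounded_riesz_product _ _ _ W_stable).
have brn k : bounded_rv (rn k) by exact: (bounded_riesz_product _ _ _ W_stable).
(* Normalised so that [K * expR (S / 2 - 1) >= 1] as soon as [S >= lam]. Then [F] dominates the
   indicator of the event: either the truncated squares sum to at least [1], or one of the two Riesz
   products of the offending [k] is large. *)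
pose K := expR (1 - 2^-1 * lam).
pose F w := ((\sum_j (a j w)%:E + \sum_j (b j w)%:E) +
  (K%:E * \sum_k (rp k w)%:E + K%:E * \sum_k (rn k w)%:E))%E.
have mEa j : measurable_fun setT (fun w => (a j w)%:E) by apply/measurable_EFinP; exact: msq.
have mEb j : measurable_fun setT (fun w => (b j w)%:E) by apply/measurable_EFinP; exact: msq.
have mErp k : measurable_fun setT (fun w => (rp k w)%:E) by apply/measurable_EFinP; case: (brp k).
have mErn k : measurable_fun setT (fun w => (rn k w)%:E) by apply/measurable_EFinP; case: (brn k).
have sE (J : finType) (f : J -> Omega -> R) :
    (forall j, measurable_fun setT (fun w => (f j w)%:E)) ->
    measurable_fun setT (fun w => \sum_j (f j w)%:E)%E.
  by move=> mf; exact: emeasurable_sum.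
have s0 (J : finType) (f : J -> Omega -> R) : (forall j w, 0 <= f j w) ->
    forall w, (0 <= \sum_j (f j w)%:E)%E.
  by move=> f0 w; apply: sume_ge0 => j _; rewrite lee_fin.
have K0 : (0 <= K%:E)%E by rewrite lee_fin expR_ge0.
apply: (@le_trans _ _ (\int[P]_w F w)%E).
  apply: probability_le_integral.
  - exact: measurable_max_event.
  - by do 2 ?apply: emeasurable_funD; do ?[exact: sE]; apply: measurable_funeM; exact: sE.
  - by move=> w; rewrite !adde_ge0 ?mule_ge0// ?s0.
  move=> w [k lamk]; rewrite /F.
  rewrite !sumEFin -!EFinM -!EFinD lee_fin.
  have a1 : 0 <= \sum_j a j w by exact: sumr_ge0.
  have b1 : 0 <= \sum_j b j w by exact: sumr_ge0.
  have rp1 : 0 <= \sum_k rp k w by exact: sumr_ge0.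
  have rn1 : 0 <= \sum_k rn k w by exact: sumr_ge0.
  have [big|small] := leP 1 (\sum_j a j w + \sum_j b j w).
    by rewrite -[leLHS]addr0 lerD// addr_ge0 ?mulr_ge0 ?expR_ge0.
  have abj j : a j w + b j w < 1.
    apply: le_lt_trans small; rewrite -big_split /= (bigD1 j)//= lerDl.
    by apply: sumr_ge0 => i _; rewrite addr_ge0.
  have aE j : a j w = (g j * complex.Re (W (B j) w)) ^+ 2.
    have := abj j; have := b0 j w; rewrite /a /simple_integral big_seq1 /= cReM /= mul0r subr0.
    by rewrite minEle; case: ifP => // _; lra.
  have bE j : b j w = (g j * complex.Im (W (B j) w)) ^+ 2.
    have := abj j; have := a0 j w; rewrite /b /simple_integral big_seq1 /= cReM /= mul0r sub0r mulNr opprK.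
    by rewrite minEle; case: ifP => // _; lra.
  (* The square is at most [cmod (z j) ^+ 2 * cmod (W (B j) w) ^+ 2], hence at most [a j w + b j w]:
     smallness of the latter sum serves all coefficients below [g] at once. *)
  have sq (z : I -> R[i]) j : cmod (z j) <= g j ->
      complex.Re (z j * W (B j) w) ^+ 2 <= a j w + b j w.
    move=> zg; rewrite aE bE !exprMn -mulrDr -cmod_sqr -exprMn.
    rewrite -[leLHS]ger0_norm ?sqr_ge0// normrX ler_sqr ?nnegrE ?normr_ge0 ?mulr_ge0 ?cmod_ge0//.
    by rewrite (le_trans (normr_Re_le _ _))// cmodM ler_wpM2r ?cmod_ge0.
  have rge (z : I -> R[i]) : (forall j, cmod (z j) <= g j) ->
      expR (2^-1 * S z w - 1) <= riesz_product W B z r w.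
    move=> zg; rewrite cRe_sum; apply: riesz_product_ge => [j _|].
      have := sq z j (zg j); have := abj j.
      move=> h1 h2; rewrite -(@expr_le1 _ 2)// -normrX ger0_norm ?sqr_ge0//.
      exact: le_trans h2 (ltW h1).
    apply: le_trans (ltW small); rewrite -big_split /=.
    by apply: ler_sum => j _; exact: sq.
  have H : 1 <= K * rp k w + K * rn k w.
    have [Spos|Sneg] := leP 0 (S (c k) w).
      move: lamk; rewrite ger0_norm// => lamk.
      apply: (@le_trans _ _ (K * rp k w)); last by rewrite lerDl mulr_ge0 ?expR_ge0.
      apply: (@le_trans _ _ (K * expR (2^-1 * S (c k) w - 1))).
        rewrite -expRD -[leLHS]expR0 ler_expR; move: lamk; set u := complex.Re _; lra.
      by rewrite ler_wpM2l ?expR_ge0// rge.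
    move: lamk; rewrite ltr0_norm// => lamk.
    apply: (@le_trans _ _ (K * rn k w)); last by rewrite lerDr mulr_ge0 ?expR_ge0.
    apply: (@le_trans _ _ (K * expR (2^-1 * S (fun j => - c k j) w - 1))).
      rewrite (_ : S (fun j => - c k j) w = - S (c k) w); last first.
        by rewrite -cReN; congr complex.Re; rewrite -sumrN; apply: eq_bigr => j _; rewrite mulNr.
      rewrite -expRD -[leLHS]expR0 ler_expR; move: lamk; set u := complex.Re _; lra.
    by rewrite ler_wpM2l ?expR_ge0// rge// => j; rewrite cmodN.
  apply: (le_trans H); rewrite -[leLHS]add0r lerD ?addr_ge0//.
  rewrite lerD// ler_wpM2l ?expR_ge0// (bigD1 k)//= lerDl sumr_ge0//.
rewrite ge0_integralD//; last 4 first.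
- by move=> w _; rewrite adde_ge0 ?s0.
- by apply: emeasurable_funD; exact: sE.
- by move=> w _; rewrite adde_ge0 ?mule_ge0 ?s0.
- by apply: emeasurable_funD; apply: measurable_funeM; exact: sE.
apply: leeD.
  rewrite ge0_integralD//; do ?[by move=> w _; exact: s0 | exact: sE].
  rewrite !ge0_integral_sum//; do ?[by move=> j w _; rewrite lee_fin].
  rewrite mulr2n mulrDl mul1r EFinD ge0_muleDl ?lee_fin//.
  rewrite !ge0_sume_distrr; do ?by move=> j _; rewrite mule_ge0 ?lee_fin ?powR_ge0.
  by apply: leeD; apply: lee_sum => j _.
rewrite ge0_integralD//; do ?[by move=> w _; rewrite mule_ge0 ?s0 | by apply: measurable_funeM; exact: sE].
rewrite !ge0_integralZl//; do ?[by move=> w _; exact: s0 | exact: sE].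
rewrite !ge0_integral_sum//; do ?[by move=> j w _; rewrite lee_fin].
under eq_bigr do rewrite EFin_Rintegral_bounded// (expectation_riesz_product _ _ _ alpha_gt0 W_stable)//.
under [X in (_ + _ * X)%E]eq_bigr do rewrite EFin_Rintegral_bounded// (expectation_riesz_product _ _ _ alpha_gt0 W_stable)//.
rewrite !sumEFin -EFinM -EFinD lee_fin sumr_const card_ord /K.
by rewrite -[1 *+ N]/(N%:R); lra.
Qed.

End discrete_maximal_inequality.

Section events.
Context {R : realType} {disp : measure_display} {T : measurableType disp}.

Lemma measurable_set_ler (f g : T -> R) :
  measurable_fun setT f -> measurable_fun setT g -> measurable [set w | f w <= g w].
Proof.
move=> mf mg; rewrite -[X in measurable X]setTI.
exact: measurable_fun_ler.
Qed.

Lemma measurable_set_ltr (f g : T -> R) :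
  measurable_fun setT f -> measurable_fun setT g -> measurable [set w | f w < g w].
Proof.
move=> mf mg; rewrite -[X in measurable X]setTI.
exact: measurable_fun_ltr.
Qed.

Lemma measurable_exists_ord N (A : 'I_N -> set T) :
  (forall k, measurable (A k)) -> measurable [set w | exists k, A k w].
Proof.
move=> mA; rewrite (_ : [set w | _] = \bigcup_(k in [set: 'I_N]) A k).
  by apply: fin_bigcup_measurable => [|k _]; [exact: finite_finset|exact: mA].
by apply/seteqP; split => w /= [k]; [move=> h; exists k|move=> _ h; exists k].
Qed.

Variable P : probability T R.

Lemma probability_union_bound (A A1 : set T) N (C : 'I_N -> set T) :
  measurable A -> measurable A1 -> (forall k, measurable (C k)) ->
  (forall w, A w -> A1 w \/ exists k, C k w) ->
  (P A <= P A1 + \sum_k P (C k))%E.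
Proof.
move=> mA mA1 mC sub.
have mi (B : set T) : measurable B -> measurable_fun setT (fun w => (\1_B w : R)%:E).
  by move=> mB; apply/measurable_EFinP; exact: measurable_indic.
have i0 (B : set T) (w : T) : (0 <= (\1_B w : R)%:E)%E by rewrite lee_fin.
have s0 (w : T) : (0 <= \sum_k (\1_(C k) w : R)%:E)%E by exact: sume_ge0.
have ms : measurable_fun setT (fun w => \sum_k (\1_(C k) w : R)%:E)%E.
  by apply: emeasurable_sum => k; exact: mi.
have PE (B : set T) : measurable B -> P B = (\int[P]_w (\1_B w)%:E)%E.
  by move=> mB; rewrite integral_indic// setIT.
apply: (@le_trans _ _ (\int[P]_w ((\1_A1 w : R)%:E + \sum_k (\1_(C k) w : R)%:E))%E).
  apply: probability_le_integral => //.
  - by apply: emeasurable_funD => //; exact: mi.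
  - by move=> w; rewrite adde_ge0.
  move=> w /sub [A1w|[k Ckw]].
    by rewrite indicE mem_set// leeDl.
  rewrite -[leLHS]add0e; apply: leeD => //.
  rewrite (bigD1 k)//= indicE mem_set//= leeDl// sume_ge0//.
rewrite ge0_integralD//; last exact: mi.
rewrite ge0_integral_sum//; last by move=> k; exact: mi.
by rewrite PE//; apply: leeD => //; apply: lee_sum => k _; rewrite PE.
Qed.

End events.

(** * Common disjoint cells for finitely many simple functions *)

Section common_refinement.
Context {R : realType} {d : nat}.

(** The cells are the atoms of the finite algebra generated by all the sets involved, indexed by the
    set [J] of those that contain the atom. The points outside all of them may have infinite volume;
    the clause [J != finset.set0] discards that atom, where all the functions vanish. *)
Lemma common_refinement N (s : 'I_N -> seq (R[i] * set 'cV[R]_d)) :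
  (forall k, simple_finite (s k)) ->
  exists (I : finType) (B : I -> set 'cV[R]_d) (c : 'I_N -> I -> R[i]),
    [/\ forall j, finite_volume (B j), trivIset setT B &
        forall k x, simple_fun (s k) x = \sum_j c k j * \1_(B j) x].
Proof.
move=> fs.
pose L := flatten [seq s k | k <- enum 'I_N].
have fL p : p \in L -> finite_volume p.2.
  by move=> /flattenP[_ /mapP[k _ ->]]; exact: fs.
have sL k p : p \in s k -> p \in L.
  move=> ps; apply/flattenP; exists (s k) => //; apply: map_f.
  by rewrite mem_enum.
pose m := size L; pose p0 : R[i] * set 'cV[R]_d := (0, set0).
pose A (i : 'I_m) := (nth p0 L i).2.
have fA i : finite_volume (A i) by apply: fL; exact: mem_nth.
pose B (J : {set 'I_m}) : set 'cV[R]_d :=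
  [set x | J != finset.set0 /\ forall i, (x \in A i) = (i \in J)].
have mB J : measurable (B J).
  have [->|J0] := eqVneq J finset.set0.
    rewrite (_ : B _ = set0) //; apply/seteqP; split => x //= [].
    by rewrite eqxx.
  rewrite (_ : B J = \bigcap_(i in [set: 'I_m]) (if i \in J then A i else ~` A i)).
    apply: fin_bigcap_measurable => [|i _]; first exact: finite_finset.
    by have [mA _] := fA i; case: ifP => // _; exact: measurableC.
  apply/seteqP; split => x /=.
    move=> [_ xJ] i _; have := xJ i; case: ifP => _; first by move/set_mem.
    by move=> /negbT; rewrite notin_setE.
  move=> xJ; split => // i; have := xJ i I; case: ifP => _ h; first exact: mem_set.
  by apply/negbTE; rewrite notin_setE.
have fB J : finite_volume (B J).
  split => //; have [J0|] := eqVneq J finset.set0.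
    rewrite (_ : B _ = set0) ?measure0 ?ltry//; apply/seteqP; split => x //= [].
    by rewrite J0 eqxx.
  move=> /finset.set0Pn[i iJ]; apply: le_lt_trans (fA i).2.
  apply: le_measure; rewrite ?inE//; first by have [] := fA i.
  by move=> x [_ /(_ i)]; rewrite iJ => /set_mem.
(* A nonempty atom lies inside or outside each set, so inclusion decides the coefficient. On an
   empty atom the coefficient is multiplied by a zero indicator. *)
exists {set 'I_m}, B, (fun k J => \sum_(p <- s k) p.1 * (`[< B J `<=` p.2 >])%:R).
split => //.
  move=> J J' _ _ [x [[_ xJ] [_ xJ']]].
  by apply/finset.setP => i; rewrite -xJ -xJ'.
move=> k x; pose J0 := [set i | x \in A i]%SET.
have pA p : p \in s k -> exists i, p.2 = A i.
  move=> /sL /(nthP p0) [i im <-]; by exists (Ordinal im).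
have [J00|J0n] := eqVneq J0 finset.set0.
  rewrite [RHS]big1 ?/simple_fun ?big_seq ?big1//.
    move=> p /pA [i pE]; rewrite indicE pE; have := finset.in_set0 i.
    by rewrite -J00 inE => ->; rewrite mulr0.
  move=> J _; rewrite indicE memNset ?mulr0// => -[/finset.set0Pn[i iJ] /(_ i)].
  by rewrite iJ => xA; have := finset.in_set0 i; rewrite -J00 inE xA.
have BJ0 : B J0 x by split => // i; rewrite inE.
rewrite (bigD1 J0)//= [X in _ + X]big1 ?addr0; last first.
  move=> J JJ; rewrite indicE memNset ?mulr0// => -[_ xJ].
  by move/eqP: JJ; apply; apply/finset.setP => i; rewrite inE -xJ.
rewrite indicE mem_set// mulr1 /simple_fun big_seq [RHS]big_seq.
apply: eq_bigr => p /pA[i pE]; congr (_ * _); rewrite indicE pE.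
congr (nat_of_bool _)%:R; apply/idP/asboolP => [xA y [_ yJ]|BA].
  by have := yJ i; rewrite inE xA => /set_mem.
exact/mem_set/BA.
Qed.

End common_refinement.

(** * From simple functions to stochastic integrals *)

Section stochastic_integrals.
Context {R : realType} {d : nat} {disp : measure_display}
  {Omega : measurableType disp}.
Variables (P : probability Omega R) (alpha : R)
  (W : set 'cV[R]_d -> Omega -> R[i]).
Hypothesis alpha_gt0 : 0 < alpha.
Hypothesis W_stable : isotropic_stable_measure P alpha W.
Local Notation mu := (lebesgue_cv R d).
Local Notation power := (modulus_integral alpha).
Local Notation stoch := (is_stochastic_integral P alpha W).

Lemma measurable_deviation (Y Z : Omega -> R[i]) (e : R) :
  cmeasurable Y -> cmeasurable Z -> measurable [set w | e <= cmod (Y w - Z w)].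
Proof.
move=> mY mZ; apply: measurable_set_ler => //.
by apply: measurable_cmod; exact: cmeasurableB.
Qed.

Lemma stochastic_integralZ (a : R[i]) f Y : a != 0 -> cmeasurable f ->
  stoch f Y -> stoch (fun x => a * f x) (fun w => a * Y w).
Proof.
move=> a0 mf [mY [s [fs sf sY]]]; split.
  by apply: cmeasurableM => //; exact: cmeasurable_cst.
exists (fun n => simple_scale a (s n)); split.
- by move=> n; exact/simple_finite_scale/fs.
- rewrite (_ : (fun _ => _) = fun n => ((cmod a `^ alpha)%:E *
      power (fun xi => simple_fun (s n) xi - f xi)%R)%E).
    by rewrite -[X in _ --> X](mule0 (cmod a `^ alpha)%:E); exact: cvgeZl.
  apply/funext => n.
  have mD := cmeasurableB _ _ (cmeasurable_simple_fun _ (fs n)) mf.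
  rewrite -(modulus_integralZ alpha a _ mD).
  by apply: eq_integral => x _; rewrite simple_fun_scale mulrBr.
- move=> e e0; have ca : 0 < cmod a.
    by rewrite lt0r cmod_ge0 andbT; apply: contra a0 => /eqP/ComplexField.Normc.eq0_normc ->.
  have := sY (e / cmod a) (divr_gt0 e0 ca).
  rewrite (_ : (fun n => _) = (fun n =>
    P [set w | e <= cmod (simple_integral W (simple_scale a (s n)) w - a * Y w)])) //.
  apply/funext => n; congr (P _); apply/funext => w /=.
  by rewrite simple_integral_scale -mulrBr cmodM ler_pdivrMr// mulrC.
Qed.

Lemma stochastic_integralB f Y g Z : cmeasurable f -> cmeasurable g ->
  stoch f Y -> stoch g Z -> stoch (fun x => f x - g x) (fun w => Y w - Z w).
Proof.
move=> mf mg [mY [s [fs sf sY]]] [mZ [t [ft tg tZ]]].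
split; first exact: cmeasurableB.
exists (fun n => s n ++ simple_scale (-1) (t n)).
have ms n := cmeasurable_simple_fun _ (fs n).
have mt n := cmeasurable_simple_fun _ (ft n).
have sfE n x : simple_fun (s n ++ simple_scale (-1) (t n)) x =
    simple_fun (s n) x - simple_fun (t n) x.
  by rewrite simple_fun_cat simple_fun_scale mulN1r.
have siE n w : simple_integral W (s n ++ simple_scale (-1) (t n)) w =
    simple_integral W (s n) w - simple_integral W (t n) w.
  by rewrite simple_integral_cat simple_integral_scale mulN1r.
split.
- by move=> n; apply: simple_finite_cat; [exact: fs|exact/simple_finite_scale/ft].
- pose U n := ((2 `^ alpha)%:E * (power (fun xi => simple_fun (s n) xi - f xi)%R +
      power (fun xi => simple_fun (t n) xi - g xi)%R))%E.
  apply: (@squeeze_cvge _ _ _ _ (cst 0%E) _ U).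
  + apply: nearW => n; rewrite /U modulus_integral_ge0 /=.
    have -> : power (fun xi => simple_fun (t n) xi - g xi) =
        power (fun xi => - (simple_fun (t n) xi - g xi)).
      by apply: eq_integral => x _; rewrite cmodN.
    rewrite (_ : (\int[mu]_xi _)%E = power (fun xi => (simple_fun (s n) xi - f xi)
        + - (simple_fun (t n) xi - g xi))).
      by apply: modulus_integralD => //; [|apply: cmeasurableN]; exact: cmeasurableB.
    by apply: eq_integral => x _; rewrite sfE; congr (_ `^ _)%:E; congr cmod; ring.
  + exact: cvg_cst.
  + rewrite /U -(mule0 (2 `^ alpha)%:E); apply: cvgeZl => //.
    have h := cvgeD (isT : (0 +? (0 : \bar R))%E) sf tg.
    by rewrite adde0 in h; exact: h.
- move=> e e0; have e2 : 0 < e / 2 by rewrite divr_gt0.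
  pose U n := (P [set w | (e / 2 <= cmod (simple_integral W (s n) w - Y w))%R] +
    P [set w | (e / 2 <= cmod (simple_integral W (t n) w - Z w))%R])%E.
  have mS n := cmeasurable_simple_integral _ _ _ W_stable _ (fs n).
  have mT n := cmeasurable_simple_integral _ _ _ W_stable _ (ft n).
  apply: (@squeeze_cvge _ _ _ _ (cst 0%E) _ U); last 2 first.
  + exact: cvg_cst.
  + have h := cvgeD (isT : (0 +? (0 : \bar R))%E) (sY _ e2) (tZ _ e2).
    by rewrite adde0 in h; exact: h.
  apply: nearW => n; rewrite measure_ge0 /=.
  have := probability_union_bound P
    [set w | e <= cmod (simple_integral W (s n ++ simple_scale (-1) (t n)) w - (Y w - Z w))]
    [set w | e / 2 <= cmod (simple_integral W (s n) w - Y w)] 1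
    (fun=> [set w | e / 2 <= cmod (simple_integral W (t n) w - Z w)]).
  rewrite big_ord1; apply.
  + apply: measurable_deviation; last exact: cmeasurableB.
    apply: (cmeasurable_simple_integral _ _ _ W_stable).
    by apply: simple_finite_cat; [exact: fs|exact/simple_finite_scale/ft].
  + exact: measurable_deviation.
  + by move=> _; exact: measurable_deviation.
  move=> w /=; rewrite siE => eS.
  have [h|h] := leP (e / 2) (cmod (simple_integral W (s n) w - Y w)); [by left|right].
  exists ord0; rewrite leNgt; apply/negP => h'.
  move: eS; rewrite leNgt => /negP; apply.
  rewrite [X in cmod X](_ : _ = (simple_integral W (s n) w - Y w) +
    - (simple_integral W (t n) w - Z w)); last by ring.
  apply: le_lt_trans (cmodD _ _ _) _; rewrite cmodN; lra.
Qed.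

(** The truncated second moment vanishes, and it is at least [1 / 4] on the event. Applied to the
    difference of two representations of one simple function, this says that their integrals almost
    surely differ by less than [1 / 2] in real part. *)
Lemma simple_integral_zero s : simple_finite s -> (forall x, simple_fun s x = 0) ->
  P [set w | 2^-1 <= `|complex.Re (simple_integral W s w)|] = 0%E.
Proof.
move=> fs s0; apply/eqP; rewrite eq_le measure_ge0 andbT.
have mR := measurable_Re_simple_integral _ _ _ W_stable _ fs.
have h0 := truncated_second_moment _ _ _ alpha_gt0 W_stable _ fs.
rewrite (_ : simple_fun s = fun=> 0) in h0; last by apply/funext.
rewrite modulus_integral0// mule0 in h0.
have mm : measurable_fun setT
    (fun w => (Num.min (complex.Re (simple_integral W s w) ^+ 2) 1)%:E).
  by apply/measurable_EFinP/measurable_minr => //; exact: measurable_funX.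
have m0 w : 0 <= Num.min (complex.Re (simple_integral W s w) ^+ 2) 1.
  by rewrite le_min sqr_ge0 ler01.
apply: (@le_trans _ _ (\int[P]_w (4%:E *
    (Num.min (complex.Re (simple_integral W s w) ^+ 2) 1)%:E))%E).
  apply: probability_le_integral.
  - by apply: measurable_set_ler => //; exact: measurableT_comp.
  - exact: measurable_funeM.
  - by move=> w; rewrite mule_ge0 ?lee_fin.
  move=> w /= h; rewrite -EFinM lee_fin minEle; case: ifP => _; last by lra.
  have : 2^-1 ^+ 2 <= `|complex.Re (simple_integral W s w)| ^+ 2 :> R.
    by rewrite lerXn2r ?nnegrE ?invr_ge0.
  by rewrite real_normK ?num_real// expr2; lra.
rewrite ge0_integralZl//; last by move=> w _; rewrite lee_fin.
by rewrite mule_ge0_le0 ?lee_fin.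
Qed.

(** The discrete inequality is applied to the [n]-th approximations on their common cells, and [n]
    tends to infinity: [U n] collects the errors in [L^alpha], [V n] the probabilities of deviation.
    The level is raised by [1] to absorb two errors of size [1 / 2], one for the change of
    representation and one for the approximation. The factor [2 ^ alpha] comes from
    [powR_add_le]. *)
Lemma stochastic_maximal_inequality N (f : 'I_N -> 'cV[R]_d -> R[i])
    (Y : 'I_N -> Omega -> R[i]) (g : 'cV[R]_d -> R) (J lam : R) :
  (forall k, cmeasurable (f k)) -> (forall k, stoch (f k) (Y k)) ->
  measurable_fun setT g -> (forall x, 0 <= g x) ->
  (forall k x, cmod (f k x) <= g x) ->
  (\int[mu]_x (g x `^ alpha)%:E <= J%:E)%E ->
  (P [set w | exists k, (lam + 1 < `|complex.Re (Y k w)|)%R] <=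
   (2 * tail_constant alpha * 2 `^ alpha * J + 2 * N%:R * expR (1 - 2^-1 * lam))%:E)%E.
Proof.
move=> mf sY mg g0 fg gJ.
have mY k : cmeasurable (Y k) by have [] := sY k.
have /choice[s sP] k : exists s : nat -> seq (R[i] * set 'cV[R]_d),
    [/\ forall n, simple_finite (s n),
        power (fun xi => simple_fun (s n) xi - f k xi) @[n --> \oo] --> 0%E
      & cvg_in_probability P (fun n => simple_integral W (s n)) (Y k)].
  by have [_ [s sP]] := sY k; exists s.
have fs k n : simple_finite (s k n) by have [h _ _] := sP k; exact: h.
have ms k n := cmeasurable_simple_fun _ (fs k n).
have mS k n := cmeasurable_simple_integral _ _ _ W_stable _ (fs k n).
pose U n := (\sum_k power (fun xi => simple_fun (s k n) xi - f k xi)%R)%E.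
pose V n := (\sum_k P [set w | (2^-1 <= cmod (simple_integral W (s k n) w - Y k w))%R])%E.
have U0 : U n @[n --> \oo] --> 0%E.
  rewrite [X in _ --> X](_ : _ = \sum_(k < N) 0%E); last by rewrite big1.
  apply: cvg_nnesum => k _; first by apply: nearW => n; exact: modulus_integral_ge0.
  by have [] := sP k.
have V0 : V n @[n --> \oo] --> 0%E.
  rewrite [X in _ --> X](_ : _ = \sum_(k < N) 0%E); last by rewrite big1.
  apply: cvg_nnesum => k _; first by apply: nearW => n.
  by have [_ _ h] := sP k; apply: h; rewrite invr_gt0.
pose K := 2 * tail_constant alpha.
have K0 : 0 <= K by rewrite mulr_ge0// tail_constant_ge0.
pose E := 2 * N%:R * expR (1 - 2^-1 * lam).
have step n : (P [set w | exists k, (lam + 1 < `|complex.Re (Y k w)|)%R] <=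
    (K * 2 `^ alpha * J + E)%:E + ((K * 2 `^ alpha)%:E * U n + V n))%E.
  have [I [B [c [fB tB cE]]]] := common_refinement N (fun k => s k n) (fun k => fs k n).
  (* The least envelope on the cells: [G j] is the maximum of the moduli over [k], or [0] if
     [N = 0]. As it is attained by some [k], on the cell it is at most [g] plus the approximation
     error of that [k], which gives [GJ]. *)
  have /choice[G GP] j : exists G : R, [/\ 0 <= G, forall k, cmod (c k j) <= G &
      G = 0 \/ exists k, G = cmod (c k j)].
    have [N0|] := pselect (N = 0%N).
      exists 0; split => //; last by left.
      by move=> k; have := ltn_ord k; rewrite [X in (_ < X)%N]N0.
    move/eqP; rewrite -lt0n => N0.
    have [k _ kmax] := @arg_maxP _ _ _ (Ordinal N0) xpredT (fun k => cmod (c k j)) isT.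
    exists (cmod (c k j)); split; first exact: cmod_ge0.
      by move=> k'; exact: kmax.
    by right; exists k.
  have G0 j : 0 <= G j by have [] := GP j.
  have mU : measurable_fun setT
      (fun x => \sum_k (cmod (simple_fun (s k n) x - f k x) `^ alpha)%:E)%E.
    apply: emeasurable_sum => k; apply/measurable_EFinP.
    by apply: measurable_cmod_powR; exact: cmeasurableB.
  have mga : measurable_fun setT (fun x => (g x `^ alpha)%:E).
    by apply/measurable_EFinP; apply: (measurableT_comp (measurable_powR alpha)).
  have GJ : (\sum_j (G j `^ alpha)%:E * mu (B j) <= (2 `^ alpha)%:E * (J%:E + U n))%E.
    have := modulus_integral_disjoint alpha alpha_gt0 I B (fun j => (G j)%:C%C)
      (index_enum I) (index_enum_uniq I) tB (fun j => (fB j).1).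
    under [X in _ = X]eq_bigr do rewrite cmod_real ger0_norm//.
    move=> <-; rewrite /modulus_integral.
    apply: (@le_trans _ _ (\int[mu]_x ((2 `^ alpha)%:E * ((g x `^ alpha)%:E +
        \sum_k (cmod (simple_fun (s k n) x - f k x) `^ alpha)%:E)))%E).
      have sm0 x : 0 <= \sum_k cmod (simple_fun (s k n) x - f k x) `^ alpha.
        by apply: sumr_ge0 => k _; exact: powR_ge0.
      apply: ge0_le_integral => //.
      - by move=> x _; rewrite lee_fin powR_ge0.
      - apply/measurable_EFinP; apply: measurable_cmod_powR.
        by apply: cmeasurable_simple_fun => p /mapP[j _ ->]; exact: fB.
      - by apply: measurable_funeM; exact: emeasurable_funD.
      move=> x _; rewrite sumEFin -EFinD -EFinM lee_fin.
      have RHS0 : 0 <= 2 `^ alpha * (g x `^ alpha +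
          \sum_k cmod (simple_fun (s k n) x - f k x) `^ alpha).
        by rewrite mulr_ge0 ?powR_ge0// addr_ge0 ?powR_ge0.
      have [[j Bj]|nB] := pselect (exists j, B j x); last first.
        rewrite /simple_fun big_map big1 ?cmod0 ?powR0 ?gt_eqF//= => j _.
        by rewrite indicE memNset ?mulr0// => Bj; apply: nB; exists j.
      have val (e : I -> R[i]) : \sum_j e j * \1_(B j) x = e j.
        rewrite (bigD1 j)//= big1 ?addr0 ?indicE ?mem_set ?mulr1// => i ij.
        rewrite indicE memNset ?mulr0// => Bi.
        by move/eqP: ij; apply; apply: (tB i j) => //; exists x.
      rewrite /simple_fun big_map val cmod_real ger0_norm//.
      have [_ _ [->|[k ->]]] := GP j; first by rewrite powR0 ?gt_eqF.
      apply: (@le_trans _ _ ((g x + cmod (simple_fun (s k n) x - f k x)) `^ alpha)).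
        rewrite ge0_ler_powR ?nnegrE ?addr_ge0 ?cmod_ge0 ?(ltW alpha_gt0)//.
        have -> : c k j = f k x + (simple_fun (s k n) x - f k x).
          by rewrite cE val; ring.
        by rewrite (le_trans (cmodD _ _ _))// lerD2r.
      apply: (le_trans (powR_add_le _ _ _ _ (ltW alpha_gt0) (g0 x) (cmod_ge0 _ _))).
      rewrite ler_wpM2l ?powR_ge0// lerD2l (bigD1 k)//= lerDl.
      by apply: sumr_ge0 => i _; exact: powR_ge0.
    have sumE0 x : (0 <= \sum_k (cmod (simple_fun (s k n) x - f k x) `^ alpha)%:E)%E.
      by apply: sume_ge0 => k _; rewrite lee_fin powR_ge0.
    rewrite ge0_integralZl//; do ?[exact: emeasurable_funD | by rewrite lee_fin powR_ge0
      | by move=> x _; rewrite adde_ge0 ?lee_fin ?powR_ge0].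
    rewrite lee_wpmul2l ?lee_fin ?powR_ge0//.
    rewrite ge0_integralD//; do ?by move=> x _; rewrite lee_fin powR_ge0.
    rewrite leeD// /U ge0_integral_sum//; last by move=> k x _; rewrite lee_fin powR_ge0.
    by move=> k; apply/measurable_EFinP; apply: measurable_cmod_powR; exact: cmeasurableB.
  pose t k := [seq (c k j, B j) | j <- index_enum I].
  have ft k : simple_finite (t k) by move=> p /mapP[j _ ->]; exact: fB.
  (* A representation of the zero function, comparing [s k n] with its rewriting [t k] on the
     cells. *)
  pose u k := s k n ++ simple_scale (-1) (t k).
  have fu k : simple_finite (u k).
    by apply: simple_finite_cat => //; exact: simple_finite_scale.
  have u0 k x : simple_fun (u k) x = 0.
    by rewrite simple_fun_cat simple_fun_scale mulN1r {2}/simple_fun big_map -cE subrr.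
  have uE k w : simple_integral W (u k) w =
      simple_integral W (s k n) w - \sum_j c k j * W (B j) w.
    by rewrite simple_integral_cat simple_integral_scale mulN1r {2}/simple_integral big_map.
  pose Bad := [set w | (exists k, lam < `|complex.Re (\sum_j c k j * W (B j) w)|) \/
    exists k, 2^-1 <= cmod (simple_integral W (s k n) w - Y k w)].
  pose A1 := [set w | exists k, lam < `|complex.Re (\sum_j c k j * W (B j) w)|].
  have mA1 : measurable A1 by exact: (measurable_max_event _ _ _ W_stable).
  have mC k : measurable [set w | 2^-1 <= cmod (simple_integral W (s k n) w - Y k w)].
    exact: measurable_deviation.
  have mBad : measurable Bad.
    apply: (measurableU A1) => //.
    exact: (measurable_exists_ord N (fun k => [set w | 2^-1 <= cmod (simple_integral W (s k n) w - Y k w)])).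
  apply: (@le_trans _ _ (P Bad + \sum_k P [set w | (2^-1 <= `|complex.Re (simple_integral W (u k) w)|)%R])%E).
    apply: probability_union_bound => //.
    - apply: measurable_exists_ord => k; apply: measurable_set_ltr => //.
      by apply: measurableT_comp => //; have [] := mY k.
    - move=> k; apply: measurable_set_ler => //.
      apply: measurableT_comp => //; exact: (measurable_Re_simple_integral _ _ _ W_stable).
    move=> w [k hk].
    have [h1|h1] := leP 2^-1 `|complex.Re (simple_integral W (u k) w)|; first by right; exists k.
    have [h2|h2] := leP 2^-1 (cmod (simple_integral W (s k n) w - Y k w)).
      by left; right; exists k.
    left; left; exists k; rewrite ltNge; apply/negP => h3; move: hk; rewrite ltNge => /negP; apply.
    rewrite [X in complex.Re X](_ : _ = \sum_j c k j * W (B j) w +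
      simple_integral W (u k) w + - (simple_integral W (s k n) w - Y k w)); last first.
      by rewrite uE; ring.
    have h4 := le_trans (normr_Re_le _ (simple_integral W (s k n) w - Y k w)) (ltW h2).
    rewrite !cReD cReN.
    apply: (le_trans (ler_normD _ _)); rewrite normrN.
    by have := ler_normD (complex.Re (\sum_j c k j * W (B j) w))
      (complex.Re (simple_integral W (u k) w)); lra.
  rewrite [X in (_ + X <= _)%E]big1 ?adde0; last by move=> k _; exact: simple_integral_zero.
  have Bad_le := probability_union_bound P Bad A1 N
    (fun k => [set w | 2^-1 <= cmod (simple_integral W (s k n) w - Y k w)]) mBad mA1 mC (fun w h => h).
  apply: (le_trans Bad_le); rewrite -/(V n) addeA leeD2r//.
  have cG k j : cmod (c k j) <= G j by have [] := GP j.
  have := discrete_maximal_inequality _ _ _ alpha_gt0 W_stable _ fB tB N c G lam cG.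
  move/le_trans; apply; rewrite -/K -/E EFinD [leRHS]addeAC leeD2r//.
  have J0 : (0 <= J%:E)%E.
    by apply: le_trans gJ; apply: integral_ge0 => x _; rewrite lee_fin powR_ge0.
  have U0n : (0 <= U n)%E by apply: sume_ge0 => k _; exact: modulus_integral_ge0.
  apply: (le_trans (lee_wpmul2l _ GJ)); first by rewrite lee_fin.
  by rewrite muleA -EFinM ge0_muleDr// -EFinM.
have cv : ((K * 2 `^ alpha * J + E)%:E + ((K * 2 `^ alpha)%:E * U n + V n))%E @[n --> \oo]
    --> (K * 2 `^ alpha * J + E)%:E.
  rewrite -[X in _ --> X]adde0; apply: cvgeD => //; first exact: cvg_cst.
  rewrite -[X in _ --> X](adde0 0%E); apply: cvgeD => //.
  by rewrite -(mule0 (K * 2 `^ alpha)%:E); apply: cvgeZl.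
rewrite -(cvg_lim _ cv)//.
apply: lime_ge; first by apply/cvg_ex; eexists; exact: cv.
exact: nearW.
Qed.

End stochastic_integrals.

(** * Linear change of variables *)

Section lebesgue_line.
Variable R : realType.
Local Notation leb := (@lebesgue_measure R).

Lemma measurable_shift (a : R) :
  @measurable_fun _ _ (measurableTypeR R) (measurableTypeR R) setT (fun x : R => x + a).
Proof. exact: measurable_funD. Qed.

Lemma lebesgue_measure_shift (a : R) (A : set R) : measurable A ->
  leb ((fun x => x + a) @^-1` A) = leb A.
Proof.
move=> mA.
have := @lebesgue_measure_unique R
  (measure_function_pushforward__canonical__measure_function_Measure
    leb (measurable_shift a)).
move=> /(_ _ A mA) -> // _ [[x y] _ <-] /=.
rewrite /pushforward (_ : _ @^-1` _ = `]x - a, y - a]%classic); last first.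
  by apply/seteqP; split => z /=; rewrite !in_itv /= ltrBlDr lerBrDr.
rewrite !lebesgue_measure_itv /= !lte_fin ltrD2r; case: ifP => // _.
by rewrite -!EFinB; congr _%:E; ring.
Qed.

Lemma measurable_dilation (u : R) :
  @measurable_fun _ _ (measurableTypeR R) (measurableTypeR R) setT (fun x : R => u * x).
Proof. exact: measurable_funM. Qed.

Lemma lebesgue_measure_dilation (u : R) (A : set R) : u != 0 -> measurable A ->
  (leb ((fun x => u * x)%R @^-1` A) * `|u|%:E)%E = leb A.
Proof.
move=> u0 mA; have nu : 0 <= `|u| by [].
have := (@lebesgue_measure_unique R
  (mscale (NngNum nu) (measure_function_pushforward__canonical__measure_function_Measure
    leb (measurable_dilation u)))).
move=> /(_ _ A mA) ->; first by rewrite /mscale /= muleC.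
move=> _ [[x y] _ <-]; rewrite -[RHS]/(`|u|%:E *
  leb ((fun z : R => (u * z)%R) @^-1` `]x, y]%classic))%E.
have [up|un] := ltP 0 u.
  rewrite (_ : _ @^-1` _ = `]x / u, y / u]%classic); last first.
    apply/seteqP; split => z /=; rewrite !in_itv /=.
      by rewrite ltr_pdivrMr// ler_pdivlMr// mulrC.
    by rewrite ltr_pdivrMr// ler_pdivlMr// mulrC.
  rewrite !lebesgue_measure_itv /= !lte_fin ltr_pM2r ?invr_gt0//.
  case: ifP => _; last by rewrite mule0.
  by rewrite -!EFinB -EFinM gtr0_norm//; congr _%:E; field.
have {}un : u < 0 by rewrite lt_neqAle u0 un.
rewrite (_ : _ @^-1` _ = `[y / u, x / u[%classic); last first.
  apply/seteqP; split => z /=; rewrite !in_itv /=.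
    by rewrite ltr_ndivlMr// ler_ndivrMr// mulrC andbC.
  by rewrite ltr_ndivlMr// ler_ndivrMr// mulrC andbC.
rewrite !lebesgue_measure_itv /= !lte_fin ltr_nM2r ?invr_lt0//.
case: ifP => _; last by rewrite mule0.
by rewrite -!EFinB -EFinM ltr0_norm//; congr _%:E; field.
Qed.

End lebesgue_line.

Section lebesgue_space.
Variable R : realType.
Local Notation leb := (@lebesgue_measure R).
Local Notation mu := (lebesgue_cv R).

Definition box n (A : 'I_n -> set R) : set 'cV[R]_n :=
  [set v | forall i, A i (v i ord0)].

(** Boxes form a pi-system generating the sigma-algebra of the coordinates, and the cubes [[- k, k]]
    exhaust the space with finite volume. *)
Lemma lebesgue_cv_unique n (m : {measure set 'cV[R]_n -> \bar R}) :
  (forall A, (forall i, measurable (A i)) -> m (box n A) = mu n (box n A)) ->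
  forall A, measurable A -> m A = mu n A.
Proof.
move=> mbox.
pose G : set (set 'cV[R]_n) :=
  [set B | exists2 A, (forall i, measurable (A i)) & B = box n A].
apply: (@measure_unique _ _ _ G (fun k => box n (fun=> `[- k%:R, k%:R]%classic))).
- apply/seteqP; split.
    apply: smallest_sub; first exact: smallest_sigma_algebra.
    rewrite -bigcup_seq; apply: bigcup_sub => i _ B [C mC <-].
    apply: sub_sigma_algebra; exists (fun j => if j == i then C else setT).
      by move=> j; case: ifP.
    rewrite setTI; apply/seteqP; split => v /=.
      by move=> Cv j; case: eqP => // ->.
    by move=> /(_ i); rewrite eqxx.
  apply: smallest_sub; first exact: sigma_algebra_measurable.
  by move=> _ [A mA ->]; exact: measurable_box.
- move=> _ _ [A mA ->] [B mB ->]; exists (fun i => A i `&` B i).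
    by move=> i; exact: measurableI.
  apply/seteqP; split => v /=; first by move=> [Av Bv] i; split.
  by move=> h; split => i; have [] := h i.
- by move=> k; exists (fun=> `[- k%:R, k%:R]%classic).
- apply/seteqP; split => // v _.
  have [k kv] : exists k : nat, forall i, `|v i ord0| <= k%:R.
    exists (\max_i Num.bound `|v i ord0|) => i.
    apply: (le_trans (ltW (archi_boundP (normr_ge0 _)))).
    by rewrite ler_nat; exact: leq_bigmax.
  by exists k => // i /=; rewrite in_itv /= -ler_norml.
- by move=> _ [A mA ->]; exact: mbox.
- move=> k; rewrite mbox//.
  rewrite lebesgue_cv_box// ltey_eq; apply/orP; left.
  apply: (big_ind (fun x => x \is a fin_num)) => // [x y|i _]; first exact: fin_numM.
  by rewrite lebesgue_measure_itv; case: ifP.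
Qed.

(** One form for permutation matrices, diagonal matrices and translations; the preimage of a box is
    again a box. *)
Definition coordinatewise n (s : 'S_n) (f : 'I_n -> R -> R) (v : 'cV[R]_n) : 'cV[R]_n :=
  \col_i f i (v (s i) ord0).

Lemma measurable_coordinatewise n (s : 'S_n) (f : 'I_n -> R -> R) :
  (forall i, measurable_fun setT (f i)) ->
  measurable_fun setT (coordinatewise n s f).
Proof.
move=> mf; apply: measurable_fun_cvec => i.
under eq_fun do rewrite /coordinatewise mxE.
by apply: (measurableT_comp (mf i)); exact: measurable_coord.
Qed.

Lemma lebesgue_cv_coordinatewise n (s : 'S_n) (f : 'I_n -> R -> R) (c : 'I_n -> R) A :
  (forall i, measurable_fun setT (f i)) -> (forall i, 0 <= c i) ->
  (forall i B, measurable B -> (leb (f i @^-1` B) * (c i)%:E)%E = leb B) ->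
  measurable A ->
  (mu n (coordinatewise n s f @^-1` A) * (\prod_i c i)%:E)%E = mu n A.
Proof.
move=> mf c0 fc mA.
have pc0 : 0 <= \prod_i c i by exact: prodr_ge0.
pose m := mscale (NngNum pc0)
  (measure_function_pushforward__canonical__measure_function_Measure
    (mu n) (measurable_coordinatewise n s f mf)).
rewrite muleC -[LHS]/(m A); apply: lebesgue_cv_unique => // B mB.
rewrite -[LHS]/((\prod_i c i)%:E *
  mu n (coordinatewise n s f @^-1` box n B))%E muleC.
rewrite (_ : _ @^-1` _ = box n (fun j => f ((s^-1)%g j) @^-1` B ((s^-1)%g j))); last first.
  apply/seteqP; split => v /= h i.
    by have := h ((s^-1)%g i); rewrite mxE permKV.
  by rewrite mxE; have := h (s i); rewrite permK.
rewrite lebesgue_cv_box; last first.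
  by move=> i; rewrite -[X in measurable X]setTI; exact (mf _ measurableT _ (mB _)).
rewrite lebesgue_cv_box// (reindex_inj (@perm_inj _ s)) /=.
under eq_bigr do rewrite permK.
rewrite (big_morph EFin (@EFinM R) erefl) -big_split /=.
by apply: eq_bigr => i _; rewrite fc.
Qed.

(** Phrased with a preimage and a product, the property involves no inverse and is stable under
    products of matrices, so that it can be checked on the factors of a decomposition. *)
Definition scales_volume n (M : 'M[R]_n) : Prop := forall A, measurable A ->
  (mu n ((mulmx M) @^-1` A) * `|\det M|%:E)%E = mu n A.

Lemma measurable_mulmx n (M : 'M[R]_n) :
  measurable_fun setT (mulmx M : 'cV[R]_n -> 'cV[R]_n).
Proof.
apply: measurable_fun_cvec => i.
under eq_fun do rewrite mxE.
apply: measurable_sum => j.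
by apply: measurable_funM => //; exact: measurable_coord.
Qed.

Lemma measurable_preimage_mulmx n (M : 'M[R]_n) (A : set 'cV[R]_n) :
  measurable A -> measurable ((mulmx M : 'cV[R]_n -> 'cV[R]_n) @^-1` A).
Proof. by move=> mA; rewrite -[X in measurable X]setTI; exact: measurable_mulmx. Qed.

Lemma scales_volumeM n (M N : 'M[R]_n) :
  scales_volume n M -> scales_volume n N -> scales_volume n (M *m N).
Proof.
move=> sM sN A mA; rewrite -[RHS](sM A mA) -(sN _ (measurable_preimage_mulmx _ M _ mA)).
rewrite det_mulmx normrM EFinM [X in (_ * X)%E]muleC muleA.
by congr (mu n _ * _ * _)%E; apply/seteqP; split => v /=; rewrite mulmxA.
Qed.

Lemma scales_volume_perm n (s : 'S_n) : scales_volume n (perm_mx s).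
Proof.
move=> A mA; rewrite det_perm normrX normrN1 expr1n.
rewrite -[RHS](lebesgue_cv_coordinatewise n s (fun=> id) (fun=> 1))//; last first.
  by move=> _ B mB; rewrite mule1.
rewrite big1// (_ : mulmx _ = coordinatewise n s (fun=> id))//.
by apply/funext => v; rewrite -row_permE; apply/matrixP => i j; rewrite !mxE ord1.
Qed.

Lemma scales_volume_diag n (D : 'rV[R]_n) : (forall i, D ord0 i != 0) ->
  scales_volume n (diag_mx D).
Proof.
move=> D0 A mA; rewrite det_diag normr_prod.
rewrite -[RHS](lebesgue_cv_coordinatewise n 1%g (fun i x => D ord0 i * x)
  (fun i => `|D ord0 i|))//.
- rewrite (_ : mulmx _ = coordinatewise n 1%g (fun i x => D ord0 i * x))//.
  by apply/funext => v; rewrite mul_diag_mx; apply/matrixP => i j; rewrite !mxE perm1 ord1.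
- by move=> i; exact: measurable_dilation.
- by move=> i B; exact: lebesgue_measure_dilation.
Qed.

Lemma measurable_cv_shift n (a : 'cV[R]_n) :
  measurable_fun setT (fun v : 'cV[R]_n => v + a).
Proof.
apply: measurable_fun_cvec => i; under eq_fun do rewrite mxE.
by apply: measurable_funD => //; exact: measurable_coord.
Qed.

Lemma lebesgue_cv_shift n (a : 'cV[R]_n) A : measurable A ->
  mu n ((fun v => v + a) @^-1` A) = mu n A.
Proof.
move=> mA; rewrite -[RHS](lebesgue_cv_coordinatewise n 1%g
  (fun i x => x + a i ord0) (fun=> 1))//.
- rewrite big1// mule1 (_ : (fun v => v + a) =
    coordinatewise n 1%g (fun i x => x + a i ord0))//.
  by apply/funext => v; apply/matrixP => i j; rewrite !mxE perm1 ord1.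
- by move=> i; exact: measurable_shift.
- by move=> i B mB; rewrite mule1 lebesgue_measure_shift.
Qed.

(* Fubini: the first coordinate is fixed by [L], which acts on the others by
   the smaller unitriangular block followed by a translation. *)
Lemma scales_volume_unitriangular n (L : 'M[R]_n) :
  (forall i j : 'I_n, (i <= j)%N -> L i j = (i == j)%:R) -> scales_volume n L.
Proof.
move=> L1; suff h A : measurable A -> mu n (mulmx L @^-1` A) = mu n A.
  move=> A mA; rewrite (det_trig (A := L)); last first.
    by apply/is_trig_mxP => i j ij; rewrite L1 1?ltnW// -val_eqE /= ltn_eqF.
  by rewrite big1 ?normr1 ?mule1 ?h// => i _; rewrite L1// eqxx.
elim: n L L1 A => [|n IH] L L1 A mA.
  by congr (mu 0 _); apply/seteqP; split => v /=; rewrite [_ *m v]flatmx0 [v]flatmx0.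
pose L' : 'M[R]_n := \matrix_(i, j) L (lift ord0 i) (lift ord0 j).
pose a : 'cV[R]_n := \col_i L (lift ord0 i) ord0.
have L'1 (i j : 'I_n) : (i <= j)%N -> L' i j = (i == j)%:R.
  by move=> ij; rewrite mxE L1 ?(inj_eq lift_inj)//= /bump /= !add1n ltnS.
rewrite /= /lebesgue_step /pushforward.
pose A' := (@cv_cons R n) @^-1` A.
have mA' : measurable A'.
  by rewrite -[X in measurable X]setTI; exact: measurable_cv_cons.
have LE x (w : 'cV[R]_n) : L *m cv_cons (x, w) = cv_cons (x, L' *m w + x *: a).
  apply/matrixP => i j; rewrite ord1 !mxE big_ord_recl /= !mxE unlift_none.
  case: unliftP => [k ->|->] /=.
    rewrite !mxE addrC [x * _]mulrC; congr (_ + _); apply: eq_bigr => l _.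
    by rewrite !mxE liftK.
  rewrite L1// eqxx mul1r big1 ?addr0// => k _.
  by rewrite L1// mul0r.
apply: eq_integral => x _ /=.
transitivity (mu n (mulmx L' @^-1` ((fun v => v + x *: a) @^-1` xsection A' x))).
  congr (mu n _); apply/seteqP; split => w /=.
    by rewrite /xsection /= !inE /= LE /A' /= .
  by rewrite /xsection /= !inE /= LE /A' /= .
have ms : measurable (xsection A' x) by exact: measurable_xsection.
rewrite IH// ?lebesgue_cv_shift//.
rewrite -[X in measurable X]setTI.
exact: (measurable_cv_shift _ _ measurableT).
Qed.

(** Dividing each column by its diagonal entry leaves a unitriangular factor times a diagonal
    one. *)
Lemma scales_volume_trig n (T : 'M[R]_n) :
  is_trig_mx T -> T \in unitmx -> scales_volume n T.
Proof.
move=> trT uT; have T0 i : T i i != 0.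
  move: uT; rewrite unitmxE det_trig// unitfE; apply: contra => /eqP Ti.
  by rewrite (bigD1 i)//= Ti mul0r.
pose D : 'rV[R]_n := \row_i T i i.
pose L : 'M[R]_n := \matrix_(i, j) (T i j / T j j).
have -> : T = L *m diag_mx D.
  by rewrite mul_mx_diag; apply/matrixP => i j; rewrite !mxE divfK.
apply: scales_volumeM; last by apply: scales_volume_diag => i; rewrite mxE.
apply: scales_volume_unitriangular => i j; rewrite mxE leq_eqVlt => /orP[/eqP/val_inj ->|ij].
  by rewrite divff// eqxx.
by move/is_trig_mxP: trT => -> //; rewrite mul0r -val_eqE /= ltn_eqF.
Qed.

(** LUP decomposition. The upper triangular factor becomes lower triangular when conjugated by the
    permutation [r] that reverses the order of the coordinates, so lower triangular matrices
    suffice. *)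
Lemma scales_volume_unitmx n (M : 'M[R]_n) : M \in unitmx -> scales_volume n M.
Proof.
case: n M => [|n] M uM.
  rewrite (_ : M = perm_mx 1%g); last by rewrite [M]flatmx0 [RHS]flatmx0.
  exact: scales_volume_perm.
have := cormen_lup_correct M; have := cormen_lup_perm M.
have := @cormen_lup_lower _ _ M; have := @cormen_lup_upper _ _ M.
have := cormen_lup_detL M.
case: cormen_lup => [[Q L] U] /= detL Uup Llow /is_perm_mxP[s ->] PM.
have -> : M = perm_mx (s^-1)%g *m (L *m U).
  by rewrite -mulmxE in PM; rewrite -PM mulmxA -perm_mxM mulVg perm_mx1 mul1mx.
have uU : U \in unitmx.
  have : perm_mx s *m M \in unitmx by rewrite unitmx_mul unitmx_perm.
  by rewrite (PM : perm_mx s *m M = L *m U) unitmx_mul => /andP[].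
apply: scales_volumeM; first exact: scales_volume_perm.
apply: scales_volumeM; first exact: scales_volume_unitriangular.
pose r : 'S_n.+1 := perm (@rev_ord_inj n.+1).
pose V := perm_mx r *m U *m perm_mx r.
have rr1 : (r * r)%g = 1%g by apply/permP => i; rewrite permM !permE rev_ordK.
have rr : perm_mx r *m perm_mx r = 1%:M :> 'M[R]_n.+1.
  by rewrite -perm_mxM rr1 perm_mx1.
have -> : U = perm_mx r *m (V *m perm_mx r).
  by rewrite /V !mulmxA rr mul1mx -mulmxA rr mulmx1.
apply: scales_volumeM; first exact: scales_volume_perm.
apply: scales_volumeM; last exact: scales_volume_perm.
apply: scales_volume_trig; last by rewrite /V !unitmx_mul !unitmx_perm uU.
have rV : (r^-1)%g = r by apply: (mulgI r); rewrite mulgV.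
apply/is_trig_mxP => i j ij; rewrite /V -row_permE -{2}rV -col_permE !mxE !permE.
by apply: Uup => /=; rewrite ltn_sub2l// ltnS (leq_trans ij) // -ltnS.
Qed.

End lebesgue_space.

(** * Matrix exponentials and adapted norms *)

Section truncated_exponential.
Variable F : numFieldType.
Implicit Types (z w : F) (n k : nat).

Definition texp n z : F := \sum_(k < n) z ^+ k / k`!%:R.

Let coefs n z : {poly F} := \poly_(k < n) (z ^+ k / k`!%:R).

Let coefs1 n z : (coefs n z).[1] = texp n z.
Proof.
by rewrite /coefs horner_poly; apply: eq_bigr => k _; rewrite expr1n mulr1.
Qed.

(** The part of degree at least [n] in the Cauchy product of the two truncated series, read as
    polynomials in an auxiliary variable evaluated at [1]. Below degree [n] the binomial formula
    makes the product exact. *)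
Definition texp_remainder n z w : F :=
  \sum_(m < n.*2 | (n <= m)%N) (coefs n z * coefs n w)`_m.

Lemma texpM n z w : texp n z * texp n w = texp n (z + w) + texp_remainder n z w.
Proof.
rewrite -!coefs1 -hornerM.
have sz : (size (coefs n z * coefs n w)%R <= n.*2)%N.
  apply: (leq_trans (size_polyMleq _ _)).
  by rewrite (leq_trans (leq_pred _))// -addnn leq_add ?size_poly.
rewrite (horner_coef_wide _ sz) (bigID (fun m : 'I_(n.*2) => (m < n)%N)) /=.
congr (_ + _); last first.
  rewrite /texp_remainder; apply: eq_big => [m|m _]; first by rewrite -leqNgt.
  by rewrite expr1n mulr1.
under eq_bigr do rewrite expr1n mulr1.
rewrite coefs1 /texp.
have le_n : (n <= n.*2)%N by rewrite -addnn leq_addr.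
rewrite (big_ord_widen_cond n.*2 xpredT (fun k => (z + w) ^+ k / k`!%:R))//=.
apply: eq_bigr => m mn.
rewrite coefM (addrC z w) exprDn mulr_suml; apply: eq_bigr => k _.
have km : (k <= m)%N by rewrite -ltnS.
rewrite !coef_poly (leq_ltn_trans km mn) (leq_ltn_trans (leq_subr _ _) mn).
have f0 j : (j`!%:R : F) != 0 by rewrite pnatr_eq0 -lt0n fact_gt0.
have C0 : ('C(m, k)%:R : F) != 0 by rewrite pnatr_eq0 -lt0n bin_gt0.
have <- : ('C(m, k)%:R * (k`!%:R * (m - k)`!%:R) = m`!%:R :> F).
  by rewrite -!natrM bin_fact.
rewrite -mulr_natr; set u := z ^+ k; set v := w ^+ _.
by field; rewrite C0 !f0.
Qed.

End truncated_exponential.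

Section complex_exponential.
Variable R : realType.
Implicit Types z w : R[i].

Lemma cmod_sum (I : Type) (s : seq I) (Q : pred I) (f : I -> R[i]) :
  cmod (\sum_(i <- s | Q i) f i) <= \sum_(i <- s | Q i) cmod (f i).
Proof.
elim/big_rec2: _ => [|i x y _ h]; first by rewrite cmod0.
by apply: le_trans (cmodD _ _ _) _; rewrite lerD2l.
Qed.

Lemma cmodX z k : cmod (z ^+ k) = cmod z ^+ k.
Proof.
elim: k => [|k IH]; first by rewrite !expr0; exact: ComplexField.Normc.normc1.
by rewrite !exprS cmodM IH.
Qed.

Lemma cmod_nat n : cmod (n%:R : R[i]) = n%:R.
Proof.
have -> : (n%:R : R[i]) = (n%:R : R)%:C%C by rewrite (rmorph_nat (real_complex R)).
by rewrite cmod_real ger0_norm.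
Qed.

Lemma cmodV z : cmod z^-1 = (cmod z)^-1.
Proof. exact: ComplexField.Normc.normcV. Qed.

Lemma cmod_exp_coeff z k : cmod (z ^+ k / k`!%:R) = cmod z ^+ k / k`!%:R.
Proof.
by rewrite cmodM cmodX cmodV cmod_nat.
Qed.

(** As a polynomial in [z] and [w] the remainder has nonnegative coefficients, so it is dominated by
    its value at the moduli. *)
Lemma cmod_texp_remainder n z w :
  cmod (texp_remainder R[i] n z w) <= texp_remainder R n (cmod z) (cmod w).
Proof.
apply: (le_trans (cmod_sum _ _ _ _)); apply: ler_sum => m _.
rewrite !coefM; apply: (le_trans (cmod_sum _ _ _ _)); apply: ler_sum => k _.
rewrite cmodM !coef_poly; case: ifP => _; last by rewrite cmod0 !mul0r.
rewrite cmod_exp_coeff; case: ifP => _; last by rewrite cmod0 !mulr0.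
by rewrite cmod_exp_coeff.
Qed.

Lemma cvg_texp (x : R) : texp R n x @[n --> \oo] --> expR x.
Proof.
rewrite (_ : (fun n => _) = series (exp_coeff x)); first exact: is_cvg_series_exp_coeff.
by apply/funext => n; rewrite /series /= big_mkord.
Qed.

(** The remainder is the defect in the functional equation of the truncated series, and the real
    exponential satisfies that equation in the limit. *)
Lemma cvg_texp_remainder (x y : R) : texp_remainder R n x y @[n --> \oo] --> (0 : R).
Proof.
rewrite (_ : (fun n => _) = fun n => texp R n x * texp R n y - texp R n (x + y)).
  rewrite -[X in _ --> X](subrr (expR (x + y))) {1}expRD.
  by apply: cvgB; [apply: cvgM|]; exact: cvg_texp.
by apply/funext => n; rewrite texpM addrAC subrr add0r.
Qed.

Lemma texp_real n (x : R) : texp R[i] n x%:C%C = (texp R n x)%:C%C.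
Proof.
rewrite /texp (rmorph_sum (real_complex R)); apply: eq_bigr => k _ /=.
by rewrite rmorphM rmorphXn fmorphV rmorph_nat.
Qed.

Lemma texp_conj n z : texp R[i] n z^*%C = (texp R[i] n z)^*%C.
Proof.
rewrite /texp (rmorph_sum (@conjc R)); apply: eq_bigr => k _ /=.
by rewrite rmorphM rmorphXn fmorphV rmorph_nat.
Qed.

(* Avoids a complex exponential: [cmod z ^+ 2 = z * z^*] turns the product of the
   two truncated series into the real exponential of [2 * Re z]. *)
Lemma cvg_cmod_texp z : cmod (texp R[i] n z) @[n --> \oo] --> expR (complex.Re z).
Proof.
have sq n : `|cmod (texp R[i] n z) ^+ 2 - texp R n (2 * complex.Re z)| <=
    texp_remainder R n (cmod z) (cmod z).
  have zz : z + z^*%C = (2 * complex.Re z)%:C%C.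
    by case: z => x y; apply/eqP; rewrite eq_complex /= subrr eqxx andbT; apply/eqP; ring.
  have := texpM R[i] n z z^*%C; rewrite texp_conj zz texp_real => E.
  have cc : texp R[i] n z * (texp R[i] n z)^*%C = (cmod (texp R[i] n z) ^+ 2)%:C%C.
    rewrite cmod_sqr; case: (texp _ _ _) => x y; apply/eqP; rewrite eq_complex /=.
    by apply/andP; split; apply/eqP; ring.
  have := cmod_texp_remainder n z z^*%C.
  have -> : cmod z^*%C = cmod z by case: z {zz E cc} => x y; rewrite !cmodE /= sqrrN.
  apply: le_trans; rewrite -cmod_real le_eqVlt; apply/orP; left; apply/eqP; congr cmod.
  by rewrite rmorphB /= -cc E addrAC subrr add0r.
have lim2 : cmod (texp R[i] n z) ^+ 2 @[n --> \oo] --> expR (2 * complex.Re z).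
  rewrite (_ : (fun n => _) = (fun n => texp R n (2 * complex.Re z) +
      (cmod (texp R[i] n z) ^+ 2 - texp R n (2 * complex.Re z)))); last first.
    by apply/funext => n; rewrite addrC subrK.
  rewrite -[X in _ --> X]addr0; apply: cvgD; first exact: cvg_texp.
  apply: norm_cvg0.
  apply: (@squeeze_cvgr _ _ _ _ (cst 0) (fun n => texp_remainder R n (cmod z) (cmod z))).
  - by apply: nearW => n; rewrite normr_ge0 sq.
  - exact: cvg_cst.
  - exact: cvg_texp_remainder.
rewrite (_ : (fun n => _) = (fun n => Num.sqrt (cmod (texp R[i] n z) ^+ 2))); last first.
  by apply/funext => n; rewrite sqrtr_sqr ger0_norm// cmod_ge0.
have -> : expR (complex.Re z) = Num.sqrt (expR (2 * complex.Re z)).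
  by rewrite mulrC expRM_natr sqrtr_sqr ger0_norm ?expR_ge0.
exact: (cvg_comp _ _ lim2 (@sqrt_continuous R _)).
Qed.

End complex_exponential.

Section matrix_exponential.
Variables (R : realType) (d : nat).
Implicit Types A : 'M[R]_d.

Definition mx_texp A n : 'M[R]_d := \sum_(k < n) (k`!%:R)^-1 *: A ^+ k.

Lemma mx_entry_exp_bound A (c : R) k i j : (forall i j, `|A i j| <= c) ->
  `|(A ^+ k) i j| <= (d%:R * c) ^+ k.
Proof.
move=> Ac; elim: k i j => [|k IH] i j.
  by rewrite !expr0 mxE; case: eqP; rewrite ?normr1 ?normr0.
have c0 : 0 <= c := le_trans (normr_ge0 _) (Ac i j).
rewrite exprS mxE (le_trans (ler_norm_sum _ _ _))//.
apply: (@le_trans _ _ (\sum_(l < d) c * (d%:R * c) ^+ k)).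
  by apply: ler_sum => l _; rewrite normrM ler_pM.
by rewrite sumr_const card_ord -[leLHS]mulr_natl mulrA -exprS.
Qed.

(** [expmx] is a [limn], which means something only once the series converges; entry by entry it is
    dominated by the exponential series of [d * c], with [c] a bound on the entries of [A]. *)
Lemma cvg_mx_texp A i j : mx_texp A n i j @[n --> \oo] --> expmx A i j.
Proof.
have entry n i' j' : mx_texp A n i' j' = series (fun k => (k`!%:R)^-1 * (A ^+ k) i' j') n.
  by rewrite /mx_texp summxE /series /= big_mkord; apply: eq_bigr => k _; rewrite !mxE.
have [c Ac] : exists c : R, forall i' j', `|A i' j'| <= c.
  exists (`|A|) => i' j'.
  by rewrite /Num.norm /= mx_normrE; exact: (le_bigmax _ (fun ij => `|A ij.1 ij.2|) (i', j')).
have cv i' j' : cvgn (series (fun k => (k`!%:R)^-1 * (A ^+ k) i' j')).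
  apply: normed_cvg.
  apply: (@series_le_cvg _ _ (exp_coeff (d%:R * c))); last exact: is_cvg_series_exp_coeff.
  - by move=> k /=.
  - move=> k; rewrite /exp_coeff /= divr_ge0// exprn_ge0// mulr_ge0//.
    exact: le_trans (normr_ge0 _) (Ac i' j').
  - move=> k /=; rewrite normrM ger0_norm ?invr_ge0// /exp_coeff /= mulrC ler_wpM2r ?invr_ge0//.
    exact: mx_entry_exp_bound.
pose L : 'M[R]_d := \matrix_(i', j') limn (series (fun k => (k`!%:R)^-1 * (A ^+ k) i' j')).
suff -> : expmx A = L.
  by rewrite mxE; under eq_fun do rewrite entry; exact: cv.
apply: cvg_lim => //.
apply/cvg_ballP => e e0; near=> n.
split=> // i' j'; rewrite [L _ _]mxE.
rewrite [X in ball _ _ X](_ : _ = series (fun k => (k`!%:R)^-1 * (A ^+ k) i' j') n); last first.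
  by rewrite -entry /series /= /mx_texp big_mkord.
move: i' j'; near: n.
apply: filter_forall => i'; apply: filter_forall => j'.
have /cvg_ballP := cv i' j'.
exact.
Unshelve. all: by end_near. Qed.

End matrix_exponential.

Section triangular_matrices.
Variables (F : fieldType) (d : nat).
Implicit Types A B : 'M[F]_d.

Lemma trig_mulmx A B : is_trig_mx A -> is_trig_mx B ->
  is_trig_mx (A *m B) /\ forall i, (A *m B) i i = A i i * B i i.
Proof.
move=> /is_trig_mxP tA /is_trig_mxP tB; split.
  apply/is_trig_mxP => i j ij; rewrite mxE big1// => k _.
  have [ik|ki] := ltnP i k; first by rewrite tA// mul0r.
  by rewrite tB ?mulr0// (leq_ltn_trans ki).
move=> i; rewrite mxE (bigD1 i)//= big1 ?addr0// => k ki.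
have [ik|ik] := ltnP i k; first by rewrite tA// mul0r.
by rewrite tB ?mulr0// ltn_neqAle ik andbT.
Qed.

Lemma trig_mx_exp A k : is_trig_mx A ->
  is_trig_mx (A ^+ k) /\ forall i, (A ^+ k) i i = A i i ^+ k.
Proof.
move=> tA; elim: k => [|k [tk ek]].
  split; last by move=> i; rewrite !expr0 mxE eqxx.
  by apply/is_trig_mxP => i j ij; rewrite expr0 mxE -val_eqE /= ltn_eqF.
have [h1 h2] := trig_mulmx _ _ tA tk; rewrite exprS; split => // i.
by rewrite exprS -ek; exact: h2.
Qed.

End triangular_matrices.

Lemma cvg_sumr (R : realType) (I : Type) (r : seq I) (f : I -> nat -> R) (l : I -> R) :
  (forall i, f i n @[n --> \oo] --> l i) ->
  \sum_(i <- r) f i n @[n --> \oo] --> \sum_(i <- r) l i.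
Proof.
move=> fl; elim: r => [|i r IH].
  by rewrite big_nil; under eq_fun do rewrite big_nil; exact: cvg_cst.
by rewrite big_cons; under eq_fun do rewrite big_cons; exact: cvgD.
Qed.

(** * The exponential of a matrix in a triangularizing basis *)

Section adapted_norm.
Variables (R : realType) (d : nat) (E : 'M[R]_d).
Hypothesis d_gt0 : (0 < d)%N.
Local Notation toC := (map_mx (real_complex R)).

Lemma complex_triangularization : exists P T : 'M[R[i]]_d,
  [/\ P \in unitmx, is_trig_mx T & P *m toC E^T = T *m P].
Proof.
have [P uP tP] := Schur (toC E^T) d_gt0.
have PU := unitarymx_unit uP.
exists P, (conjmx P (toC E^T)); split => //.
by rewrite conjumx// mulmxKV.
Qed.

Variables P T : 'M[R[i]]_d.
Hypothesis uP : P \in unitmx.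
Hypothesis trT : is_trig_mx T.
Hypothesis PT : P *m toC E^T = T *m P.

Lemma trig_eigenvalue l : cplx_eigenvalue E l <-> exists i, T i i = l.
Proof.
have e1 : cplx_eigenvalue E l <-> toC E - l%:M \notin unitmx.
  by rewrite /cplx_eigenvalue /eigenvalue /eigenspace kermx_eq0 row_free_unit.
have e2 : (toC E - l%:M \in unitmx) = (T - l%:M \in unitmx).
  rewrite -unitmx_tr; have -> : (toC E - l%:M)^T = toC E^T - l%:M.
    by rewrite raddfB /= tr_scalar_mx map_trmx.
  have -> : (T - l%:M) = P *m (toC E^T - l%:M) *m invmx P.
    by rewrite mulmxBr PT mulmxBl mulmxK// mul_mx_scalar -scalemxAl mulmxV// scalemx1.
  by rewrite !unitmx_mul uP unitmx_inv uP andbT.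
have tTl : is_trig_mx (T - l%:M).
  apply/is_trig_mxP => i j ij; rewrite !mxE (is_trig_mxP trT)//.
  by rewrite -val_eqE /= ltn_eqF// mulr0n subrr.
rewrite e1 e2 unitmxE det_trig// unitfE negbK.
split => [/prodf_eq0 [i _]|[i Ti]].
  by rewrite !mxE eqxx mulr1n subr_eq0 => /eqP ?; exists i.
by apply/prodf_eq0; exists i => //; rewrite !mxE eqxx mulr1n Ti subrr.
Qed.

Variable c : R.
Local Notation M := (expmx (c *: E^T)).
Local Notation Q := (P *m toC M *m invmx P).

Definition trig_texp n : 'M[R[i]]_d :=
  \sum_(k < n) (k`!%:R)^-1 *: (c%:C%C *: T) ^+ k.

Lemma trig_texpP n : P *m toC (mx_texp R d (c *: E^T) n) = trig_texp n *m P.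
Proof.
have toCM (A B : 'M[R]_d) : toC (A *m B) = toC A *m toC B by exact: map_mxM.
have toCZ a (A : 'M[R]_d) : toC (a *: A) = a%:C%C *: toC A by exact: map_mxZ.
have toCD (A B : 'M[R]_d) : toC (A + B) = toC A + toC B by exact: map_mxD.
have X1 : P *m toC (c *: E^T) = c%:C%C *: T *m P by rewrite toCZ -scalemxAr PT scalemxAl.
have X k : P *m toC ((c *: E^T) ^+ k) = (c%:C%C *: T) ^+ k *m P.
  elim: k => [|k IH]; first by rewrite !expr0 map_mx1 mulmx1 mul1mx.
  by rewrite !exprS -!mulmxE toCM mulmxA X1 -!mulmxA IH.
rewrite /mx_texp /trig_texp; elim: n => [|n IH].
  by rewrite !big_ord0 map_mx0 mulmx0 mul0mx.
rewrite !big_ord_recr /= toCD mulmxDr mulmxDl IH toCZ -scalemxAr X -scalemxAl.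
by rewrite (fmorphV (real_complex R)) (rmorph_nat (real_complex R)).
Qed.

Lemma trig_texp_trig n : is_trig_mx (trig_texp n).
Proof.
apply/is_trig_mxP => i j ij; rewrite summxE big1// => k _; rewrite mxE.
have tcT : is_trig_mx (c%:C%C *: T).
  by apply/is_trig_mxP => i' j' ij'; rewrite mxE (is_trig_mxP trT)// mulr0.
by have [/is_trig_mxP -> // _] := trig_mx_exp _ _ _ k tcT; rewrite mulr0.
Qed.

Lemma trig_texp_diag n i : trig_texp n i i = texp R[i] n (c%:C%C * T i i).
Proof.
rewrite summxE; apply: eq_bigr => k _; rewrite mxE.
have tcT : is_trig_mx (c%:C%C *: T).
  by apply/is_trig_mxP => i' j' ij'; rewrite mxE (is_trig_mxP trT)// mulr0.
by have [_ ->] := trig_mx_exp _ _ _ k tcT; rewrite mxE mulrC.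
Qed.

Lemma cvg_trig_texp i j : cmod (trig_texp n i j - Q i j) @[n --> \oo] --> (0 : R).
Proof.
pose S n := mx_texp R d (c *: E^T) n.
have DE n : trig_texp n - Q = P *m toC (S n - M) *m invmx P.
  by rewrite map_mxB mulmxBr mulmxBl trig_texpP mulmxK.
pose U n := \sum_(b < d) (\sum_(a < d) cmod (P i a) * `|S n a b - M a b|) *
  cmod (invmx P b j).
apply: (@squeeze_cvgr _ _ _ _ (cst 0) U).
- apply: nearW => n; rewrite cmod_ge0 /=.
  have -> : trig_texp n i j - Q i j = (P *m toC (S n - M) *m invmx P) i j.
    by rewrite -DE !mxE.
  rewrite mxE (le_trans (cmod_sum _ _ _ _ _))//; apply: ler_sum => b _.
  rewrite cmodM ler_wpM2r ?cmod_ge0// mxE (le_trans (cmod_sum _ _ _ _ _))//.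
  by apply: ler_sum => a _; rewrite cmodM !mxE cmod_real.
- exact: cvg_cst.
- have -> : 0 = \sum_(b < d) (\sum_(a < d) cmod (P i a) * 0) * cmod (invmx P b j) :> R.
    by rewrite big1// => b _; rewrite big1 ?mul0r// => a _; rewrite mulr0.
  apply: cvg_sumr => b; apply: cvgMr_tmp; apply: cvg_sumr => a; apply: cvgMl_tmp.
  rewrite -[X in _ --> X](normr0 R); apply: cvg_norm.
  rewrite -[X in _ --> X](subrr (M a b)); apply: cvgB; last exact: cvg_cst.
  exact: cvg_mx_texp.
Qed.

Lemma exp_trig : is_trig_mx Q.
Proof.
apply/is_trig_mxP => i j ij; apply: ComplexField.Normc.eq0_normc.
rewrite -/(cmod _) -cmodN -[- _]add0r.
have := cvg_trig_texp i j.
under eq_fun do rewrite (is_trig_mxP (trig_texp_trig _))//.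
by move=> /(cvg_unique _ (cvg_cst _)); exact.
Qed.

(** The moduli of the diagonal entries are what governs the determinant and the growth of lengths;
    the diagonal of a truncated exponential of [T] is the truncated exponential of the
    eigenvalues. *)
Lemma cmod_exp_diag i : cmod (Q i i) = expR (c * complex.Re (T i i)).
Proof.
have h := cvg_cmod_texp R (c%:C%C * T i i).
have ReE : complex.Re (c%:C%C * T i i) = c * complex.Re (T i i).
  by rewrite cReM /= mul0r subr0.
rewrite ReE in h.
apply: (cvg_unique _ _ h) => //.
rewrite (_ : (fun n => _) = (fun n => cmod (trig_texp n i i))); last first.
  by apply/funext => n; rewrite trig_texp_diag.
have /cvgrPdist_le cQ := cvg_trig_texp i i.
apply/cvgrPdist_le => e e0; near=> n.
apply: (@le_trans _ _ (cmod (trig_texp n i i - Q i i))).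
  have h1 := cmodD R (trig_texp n i i - Q i i) (Q i i); rewrite subrK in h1.
  have h2 := cmodD R (Q i i - trig_texp n i i) (trig_texp n i i); rewrite subrK in h2.
  have h3 : cmod (Q i i - trig_texp n i i) = cmod (trig_texp n i i - Q i i).
    by rewrite -cmodN opprB.
  by rewrite ler_norml; apply/andP; split; lra.
near: n; apply: filterS (cQ e e0) => n.
by rewrite sub0r normrN ger0_norm// cmod_ge0.
Unshelve. all: by end_near. Qed.

End adapted_norm.

Lemma powR2E (R : realType) (x : R) : 2 `^ x = expR (ln 2 * x).
Proof. by rewrite /powR gt_eqF// mulrC. Qed.

(** In triangular form the moduli of the diagonal entries multiply, and the real parts of the
    eigenvalues add up to the trace. *)
Lemma det_powmx (R : realType) d (E : 'M[R]_d) : (0 < d)%N ->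
  `|\det (powmx 2 E^T)| = 2 `^ \tr E.
Proof.
move=> d0; have [P [T [uP trT PT]]] := complex_triangularization R d E d0.
have tQ := exp_trig R d E P T uP trT PT (ln 2).
have dQ := cmod_exp_diag R d E P T uP trT PT (ln 2).
rewrite -[LHS]cmod_real /powmx.
set M := expmx _ in tQ dQ *.
have -> : (\det M)%:C%C = \det (P *m map_mx (real_complex R) M *m invmx P).
  rewrite !det_mulmx det_inv mulrAC divff ?mul1r; last by rewrite -unitfE -unitmxE.
  by rewrite (det_map_mx (real_complex R)).
rewrite det_trig// (big_morph (@cmod R) (@cmodM R) (ComplexField.Normc.normc1 R)).
under eq_bigr do rewrite dQ.
rewrite -expR_sum powR2E; congr expR; rewrite -mulr_sumr; congr (_ * _).
rewrite -cRe_sum -/(\tr T).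
have -> : T = P *m map_mx (real_complex R) E^T *m invmx P by rewrite PT mulmxK.
rewrite mxtrace_mulC mulmxA mulVmx// mul1mx.
by rewrite -map_trmx mxtrace_tr trace_map_mx.
Qed.

Lemma norm_entry_le (R : realType) m n (x : 'M[R]_(m, n)) i j : `|x i j| <= `|x|.
Proof.
rewrite [leRHS]mx_normrE.
exact: (le_bigmax _ (fun ij => `|x ij.1 ij.2|) (i, j)).
Qed.

Lemma mx_norm_le (R : realType) m n (x : 'M[R]_(m, n)) (b : R) : 0 <= b ->
  (forall i j, `|x i j| <= b) -> `|x| <= b.
Proof.
by move=> b0 xb; rewrite [leLHS]mx_normrE; apply: bigmax_le => // -[i j] _; exact: xb.
Qed.

Lemma finite_gap (R : realType) d (f g : 'I_d -> R) :
  (forall i, f i < g i) -> exists2 e, 0 < e & forall i, f i + e <= g i.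
Proof.
move=> fg; exists (\big[Num.min/1]_i (g i - f i)).
  by apply: lt_bigmin => // i _; rewrite subr_gt0.
move=> i; rewrite addrC -lerBrDr.
exact: (bigmin_le _ _ (fun i => g i - f i)).
Qed.

(* A weighted l1 norm in a triangularizing basis; weights decaying fast enough
   make the contribution of the off-diagonal entries negligible. *)
Lemma adapted_norm (R : realType) d (E : 'M[R]_d) (lo hi : R) : (0 < d)%N ->
  (forall l, cplx_eigenvalue E l -> lo < complex.Re l < hi) ->
  exists N : 'cV[R]_d -> R,
    [/\ measurable_fun setT N,
        exists2 c, 0 < c & forall x, c * `|x| <= N x,
        exists2 c, 0 < c & forall x, N x <= c * `|x| &
        forall x, 2 `^ lo * N x <= N (powmx 2 E^T *m x) <= 2 `^ hi * N x].
Proof.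
move=> d0 spec; have [P [T [uP trT PT]]] := complex_triangularization R d E d0.
have tQ := exp_trig R d E P T uP trT PT (ln 2).
have dQ := cmod_exp_diag R d E P T uP trT PT (ln 2).
rewrite /powmx; set M := expmx _ in tQ dQ *.
pose toC m n := map_mx (real_complex R) : 'M[R]_(m, n) -> 'M[R[i]]_(m, n).
set Q := P *m map_mx (real_complex R) M *m invmx P in tQ dQ.
have diag i : 2 `^ lo < cmod (Q i i) < 2 `^ hi.
  have /andP[h1 h2] := spec _ ((trig_eigenvalue R d E P T uP trT PT _).2 (ex_intro _ i erefl)).
  have l2 : 0 < ln 2 :> R by rewrite ln_gt0// ltr1n.
  by rewrite dQ !powR2E !ltr_expR !ltr_pM2l// h1 h2.
have [e1 e10 e1P] := finite_gap R d (fun=> 2 `^ lo) (fun i => cmod (Q i i))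
  (fun i => (andP (diag i)).1).
have [e2 e20 e2P] := finite_gap R d (fun i => cmod (Q i i)) (fun=> 2 `^ hi)
  (fun i => (andP (diag i)).2).
pose K := \sum_i \sum_j cmod (Q i j).
have K0 : 0 <= K by apply: sumr_ge0 => i _; apply: sumr_ge0 => j _; exact: cmod_ge0.
have QK i j : cmod (Q i j) <= K.
  rewrite /K (bigD1 i)//= (bigD1 j)//= -addrA lerDl addr_ge0//.
    by apply: sumr_ge0 => *; exact: cmod_ge0.
  by apply: sumr_ge0 => *; apply: sumr_ge0 => *; exact: cmod_ge0.
(* The weights are the powers of [dl], chosen with [dl * (d * K) <= e], where [e] is the room left
   on both sides of the diagonal moduli; the [+ 1] keeps the denominator positive. *)
pose D : R := d%:R * K + 1.
have D0 : 0 < D by rewrite ltr_wpDl// mulr_ge0.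
pose e := Num.min e1 e2.
have e0 : 0 < e by rewrite lt_min e10 e20.
pose dl := Num.min 1 (e / D).
have dl0 : 0 < dl by rewrite lt_min ltr01 divr_gt0.
have dl1 : dl <= 1 by rewrite ge_min lexx.
have dlK : dl * (d%:R * K) <= e.
  apply: (@le_trans _ _ (e / D * D)); last by rewrite divfK ?gt_eqF.
  by apply: ler_pM; rewrite ?(ltW dl0) ?mulr_ge0 ?ge_min ?lexx ?orbT// /D lerDl.
pose y (x : 'cV[R]_d) := P *m map_mx (real_complex R) x.
pose N (x : 'cV[R]_d) := \sum_(i < d) dl ^+ i * cmod (y x i ord0).
have yM x : y (M *m x) = Q *m y x.
  by rewrite /y /Q map_mxM -!mulmxA mulKmx.
pose off (x : 'cV[R]_d) (i : 'I_d) := \sum_(j < d | (j < i)%N) Q i j * y x j ord0.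
have yi x i : y (M *m x) i ord0 = Q i i * y x i ord0 + off x i.
  rewrite yM mxE (bigID (fun j : 'I_d => (j < i)%N)) /= addrC; congr (_ + _).
  rewrite (bigD1 i) ?ltnn//= big1 ?addr0// => j /andP[].
  rewrite -leqNgt leq_eqVlt => /orP[/eqP/val_inj ->|ij _]; first by rewrite eqxx.
  by rewrite (is_trig_mxP tQ)// mul0r.
have dlX i : 0 <= dl ^+ i by rewrite exprn_ge0 ?(ltW dl0).
(* Off the diagonal only [j < i] occurs, so [dl ^+ i <= dl * dl ^+ j]: each such term gains a factor
   [dl]. *)
have offN x : \sum_(i < d) dl ^+ i * cmod (off x i) <= e * N x.
  apply: (@le_trans _ _ (\sum_(i < d) \sum_(j < d) dl * K * (dl ^+ j * cmod (y x j ord0)))).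
    apply: ler_sum => i _.
    apply: (@le_trans _ _ (dl ^+ i * \sum_(j < d | (j < i)%N) K * cmod (y x j ord0))).
      rewrite ler_wpM2l// (le_trans (cmod_sum _ _ _ _ _))//.
      by apply: ler_sum => j _; rewrite cmodM ler_wpM2r ?cmod_ge0.
    rewrite mulr_sumr big_mkcond; apply: ler_sum => j _.
    case: ifP => ji; last by rewrite !mulr_ge0 ?cmod_ge0 ?(ltW dl0).
    have -> : dl * K * (dl ^+ j * cmod (y x j ord0)) = dl ^+ j.+1 * (K * cmod (y x j ord0)).
      by rewrite exprS; ring.
    by rewrite ler_wpM2r ?mulr_ge0 ?cmod_ge0// ler_wiXn2l ?(ltW dl0).
  rewrite sumr_const card_ord -mulr_sumr -/(N x) -[leLHS]mulr_natl mulrA ler_wpM2r//.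
    by apply: sumr_ge0 => i _; rewrite mulr_ge0 ?cmod_ge0.
  by rewrite mulrCA.
have NMe x : N (M *m x) = \sum_(i < d) dl ^+ i * cmod (Q i i * y x i ord0 + off x i).
  by apply: eq_bigr => i _; rewrite yi.
have eN x : e * N x = \sum_(i < d) dl ^+ i * (e * cmod (y x i ord0)).
  by rewrite /N mulr_sumr; apply: eq_bigr => i _; rewrite mulrCA.
exists N; split.
- apply: measurable_sum => i; apply: measurable_funM => //; apply: measurable_cmod.
  under eq_fun do rewrite /y mxE.
  apply: cmeasurable_sum => j _; apply: cmeasurableM; first exact: cmeasurable_cst.
  under eq_fun do rewrite mxE.
  by split => /=; [exact: measurable_coord|exact: measurable_cst].
- pose B := \sum_(i < d) \sum_(j < d) cmod (invmx P i j) / dl ^+ j + 1.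
  have B0 : 0 < B.
    rewrite ltr_wpDl//; apply: sumr_ge0 => i _; apply: sumr_ge0 => j _.
    by rewrite divr_ge0 ?cmod_ge0.
  exists B^-1; first by rewrite invr_gt0.
  move=> x; rewrite mulrC ler_pdivrMr// mulrC.
  have N0 : 0 <= N x by apply: sumr_ge0 => i _; rewrite mulr_ge0 ?cmod_ge0.
  apply: mx_norm_le; first by rewrite mulr_ge0 ?(ltW B0).
  move=> i j; rewrite ord1.
  have xE : map_mx (real_complex R) x = invmx P *m y x by rewrite mulKmx.
  have -> : `|x i ord0| = cmod (map_mx (real_complex R) x i ord0) by rewrite mxE cmod_real.
  rewrite xE mxE (le_trans (cmod_sum _ _ _ _ _))//.
  apply: (@le_trans _ _ ((\sum_j0 cmod (invmx P i j0) / dl ^+ j0) * N x)).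
    rewrite mulr_suml; apply: ler_sum => k _; rewrite cmodM -mulrA ler_wpM2l ?cmod_ge0//.
    rewrite mulrC ler_pdivlMr ?exprn_gt0// mulrC.
    rewrite /N (bigD1 k)//= lerDl; apply: sumr_ge0 => *; by rewrite mulr_ge0 ?cmod_ge0.
  rewrite ler_wpM2r// /B [X in _ <= X + _](bigD1 i)//= -addrA lerDl addr_ge0//.
  by apply: sumr_ge0 => *; apply: sumr_ge0 => *; rewrite divr_ge0 ?cmod_ge0.
- pose B := \sum_(i < d) \sum_(j < d) dl ^+ i * cmod (P i j) + 1.
  exists B.
    rewrite ltr_wpDl//; apply: sumr_ge0 => i _; apply: sumr_ge0 => j _.
    by rewrite mulr_ge0 ?cmod_ge0.
  move=> x; rewrite /B mulrDl mul1r ler_wpDr// mulr_suml; apply: ler_sum => i _.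
  rewrite mulr_suml /y mxE; apply: (@le_trans _ _ (dl ^+ i * \sum_j cmod (P i j) * `|x|)).
    rewrite ler_wpM2l// (le_trans (cmod_sum _ _ _ _ _))//; apply: ler_sum => j _.
    by rewrite cmodM ler_wpM2l ?cmod_ge0// mxE cmod_real norm_entry_le.
  by rewrite mulr_sumr; apply: ler_sum => j _; rewrite mulrA.
- move=> x; apply/andP; split.
  (* The lower bound is a reverse triangle inequality: adding [e * N x] on both sides, the gap [e]
     above [2 ^ lo] compensates the off-diagonal part. *)
  + rewrite -(lerD2r (e * N x)); apply: le_trans (lerD (lexx _) (offN x)).
    rewrite -mulrDl NMe /N mulr_sumr -big_split /=; apply: ler_sum => i _.
    rewrite mulrCA -mulrDr ler_wpM2l//.
    have := cmodD _ (Q i i * y x i ord0 + off x i) (- off x i); rewrite addrK cmodN cmodM.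
    apply: le_trans; rewrite ler_wpM2r ?cmod_ge0//.
    apply: le_trans (e1P i); rewrite lerD2l ge_min lexx //.
  + rewrite NMe; apply: (@le_trans _ _ (\sum_(i < d) dl ^+ i * (cmod (Q i i) * cmod (y x i ord0)) +
        \sum_(i < d) dl ^+ i * cmod (off x i))).
      rewrite -big_split /=; apply: ler_sum => i _.
      by rewrite -mulrDr ler_wpM2l// -cmodM cmodD.
    apply: le_trans (lerD (lexx _) (offN x)) _.
    rewrite eN -big_split /= [leRHS]mulr_sumr; apply: ler_sum => i _.
    rewrite -mulrDr -mulrDl mulrCA ler_wpM2r ?mulr_ge0 ?cmod_ge0//.
    by apply: le_trans (e2P i); rewrite lerD2l ge_min lexx orbT.
Qed.

Section continuous_functions.
Variables (R : realType) (d : nat).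

(** Balls of the sup norm are boxes, and an open set is the countable union of the balls with
    rational centre and radius [1 / (k + 1)] that it contains. *)
Lemma open_measurable_cv (U : set 'cV[R]_d) : open U -> measurable U.
Proof.
move=> oU.
pose q (p : 'cV[rat]_d) : 'cV[R]_d := \col_i ratr (p i ord0).
pose F (p : 'cV[rat]_d * nat) : set 'cV[R]_d :=
  if `[< ball (q p.1) p.2.+1%:R^-1 `<=` U >] then
    [set v | forall i, `|q p.1 i ord0 - v i ord0| < p.2.+1%:R^-1] else set0.
rewrite (_ : U = \bigcup_p F p).
  apply: countable_bigcupT_measurable; first exact: countableP.
  move=> p; rewrite /F; case: ifP => _; last exact: measurable0.
  apply: (@measurable_box _ R d (fun i => [set x : R | `|q p.1 i ord0 - x| < p.2.+1%:R^-1])) => i.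
  rewrite -[X in measurable X]setTI; apply: measurable_fun_ltr => //.
  by apply: measurableT_comp => //; exact: measurable_funB.
apply/seteqP; split => [x Ux|x [p _]]; last first.
  rewrite /F; case: asboolP => // sub px; apply: sub.
  by split=> // i j; rewrite !ord1; exact: px.
have /nbhs_ballP[e /= e0 xe] : nbhs x U by move: oU; rewrite openE; exact.
have [k kP] : exists k : nat, k.+1%:R^-1 * 2 < e.
  have [k k2] : exists k : nat, 2 / e < k%:R.
    by exists (Num.bound (2 / e)); apply: archi_boundP; rewrite divr_ge0// ltW.
  exists k; rewrite mulrC ltr_pdivrMr ?ltr0n// mulrC -ltr_pdivrMr//.
  by rewrite (lt_trans k2)// ltr_nat.
have k0 : 0 < k.+1%:R^-1 :> R by rewrite invr_gt0 ltr0n.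
have /choice[r rP] i : exists r : rat, `|ratr r - x i ord0| < k.+1%:R^-1.
  have [|r] := @rat_in_itvoo R (x i ord0 - k.+1%:R^-1) (x i ord0 + k.+1%:R^-1).
    by rewrite ltrD2l gtrN.
  by rewrite in_itv /= -ltr_distlC distrC => h; exists r.
exists ((\col_i r i)%R, k) => //; rewrite /F /=.
have qE i : q (\col_i r i) i ord0 = ratr (r i) by rewrite !mxE.
case: asboolP => [_ i|]; first by rewrite qE; exact: rP.
case=> v [_ qv]; apply: xe; split=> // i j; rewrite ord1.
have := qv i ord0; rewrite /ball /= qE => h.
have := rP i; rewrite distrC => h'.
rewrite -[X in `|X|](_ : x i ord0 - ratr (r i) + (ratr (r i) - v i ord0) = _); last by ring.
apply: (le_lt_trans (ler_normD _ _)); apply: lt_trans kP.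
by rewrite mulr_natr mulr2n; exact: ltrD.
Qed.

Lemma continuous_measurable_cv (f : 'cV[R]_d -> R) :
  continuous f -> measurable_fun setT f.
Proof.
move=> cf; apply: (measurability _ (RGenOInfty.measurableE R)).
move=> _ [_ [x ->] <-]; rewrite setTI; apply: open_measurable_cv.
by apply: open_comp => [v _|]; [exact: cf|rewrite set_itvE; exact: open_gt].
Qed.

(** Extreme values on a compact shell, which avoids the origin since [a > 0]; if it is empty, any
    bounds do. Compactness is taken on row vectors, transposition being an isometry for the sup
    norm. *)
Lemma shell_bounds (f : 'cV[R]_d -> R) (a b : R) : 0 < a -> continuous f ->
  (forall x, x != 0 -> 0 < f x) ->
  exists l u, 0 < l /\ forall x, a <= `|x| <= b -> l <= f x <= u.
Proof.
move=> a0 cf f0.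
pose S := [set r : 'rV[R]_d | a <= `|r| <= b].
have normT m n (x : 'M[R]_(m, n)) : `|x^T| = `|x|.
  apply/eqP; rewrite eq_le; apply/andP; split.
    by apply: mx_norm_le => // i j; rewrite mxE norm_entry_le.
  by apply: mx_norm_le => // i j; have := norm_entry_le R _ _ x^T j i; rewrite mxE.
have [S0|] := pselect (S !=set0); last first.
  move=> nS; exists 1, 1; split => // x xab; exfalso; apply: nS.
  by exists x^T; rewrite /S /= normT.
have cS : compact S.
  apply: bounded_closed_compact.
    by exists b; split; [exact: num_real|move=> M bM r /andP[_ /le_trans]; apply; exact: ltW].
  rewrite (_ : S = [set r | a <= `|r|] `&` [set r | `|r| <= b]); last first.
    by apply/seteqP; split => r /=; [move/andP|move=> h; apply/andP].
  by apply: closedI; [apply: (closed_comp _ (@closed_ge _ a))|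
    apply: (closed_comp _ (@closed_le _ b))] => r _; exact: norm_continuous.
have cfT : continuous (fun r : 'rV[R]_d => f r^T).
  move=> r; apply: (@continuous_comp _ _ _ (fun r : 'rV[R]_d => r^T) f); last exact: cf.
  apply: (proj2 (@cvg_ballP _ _ _ (nbhs r) (nbhs_filter r) _ _)) => e e0.
  apply: filterS (nbhsx_ballx r e e0) => y; rewrite !mx_norm_ball /ball_ /=.
  by rewrite -linearB /= normT.
have [c cin cmin] := compact_EVT_min S0 cS (continuous_subspaceT cfT).
have [c' _ cmax] := compact_EVT_max S0 cS (continuous_subspaceT cfT).
exists (f c^T), (f c'^T); split.
  apply: f0; move: cin; rewrite inE /S /= -normT => /andP[ac _].
  by rewrite -normr_gt0; exact: lt_le_trans ac.
move=> x xab; have xS : x^T \in S by rewrite inE /S /= normT.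
have := cmin _ xS; have := cmax _ xS; rewrite !trmxK => h1 h2.
by apply/andP; split.
Qed.

End continuous_functions.

(** A [sup] is informative only for a nonempty set that is bounded above; the diagonal of the
    triangular form provides both. *)
Lemma max_re_eigenvalue_ge (R : realType) d (E : 'M[R]_d) : (0 < d)%N ->
  (forall l : R[i], cplx_eigenvalue E l -> 1 < complex.Re l) ->
  1 < max_re_eigenvalue E /\
  forall l, cplx_eigenvalue E l -> complex.Re l <= max_re_eigenvalue E.
Proof.
move=> d0 E1; have [P [T [uP trT PT]]] := complex_triangularization R d E d0.
have TE := trig_eigenvalue R d E P T uP trT PT.
pose S := [set complex.Re l | l in cplx_eigenvalue E].
have ubS : has_ubound S.
  exists (\sum_i `|complex.Re (T i i)|) => _ [l /TE[i <-] <-].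
  rewrite (bigD1 i)//= (le_trans (ler_norm _))// lerDl.
  by apply: sumr_ge0.
have leS l : cplx_eigenvalue E l -> complex.Re l <= max_re_eigenvalue E.
  by move=> El; apply: ub_le_sup => //; exists l.
split=> //.
have El : cplx_eigenvalue E (T (Ordinal d0) (Ordinal d0)) by apply/TE; eexists.
exact: lt_le_trans (E1 _ El) (leS _ El).
Qed.

Lemma Hmax_bounds (R : realType) d (E : 'M[R]_d) : (0 < d)%N ->
  (forall l : R[i], cplx_eigenvalue E l -> 1 < complex.Re l) -> 0 < Hmax E < 1.
Proof.
move=> d0 E1; have [a1 _] := max_re_eigenvalue_ge R d E d0 E1.
by rewrite /Hmax invr_gt0 invf_lt1 ?a1 ?(lt_trans ltr01 a1).
Qed.

(** There are finitely many eigenvalues, hence a uniform gap above [1], of which [lo] takes one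
    half; [hi] is the midpoint of [a_m] and [H^-1], which are distinct because [H < H_m]. *)
Lemma spectral_gap (R : realType) d (E : 'M[R]_d) (H : R) : (0 < d)%N ->
  (forall l : R[i], cplx_eigenvalue E l -> 1 < complex.Re l) ->
  0 < H -> H < Hmax E ->
  exists lo hi : R, [/\ 1 < lo, H * hi < 1 &
    forall l, cplx_eigenvalue E l -> lo < complex.Re l < hi].
Proof.
move=> d0 E1 H0 HH; have [P [T [uP trT PT]]] := complex_triangularization R d E d0.
have TE := trig_eigenvalue R d E P T uP trT PT.
have [e e0 eP] := finite_gap R d (fun=> 1) (fun i => complex.Re (T i i))
  (fun i => E1 _ ((TE _).2 (ex_intro _ i erefl))).
have [a1 leS] := max_re_eigenvalue_ge R d E d0 E1.
have a0 : 0 < max_re_eigenvalue E by exact: lt_trans a1.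
have Ha : H * max_re_eigenvalue E < 1 by move: HH; rewrite /Hmax -ltr_pdivlMr// mul1r.
exists (1 + e / 2), ((max_re_eigenvalue E + H^-1) / 2); split.
- by rewrite ltrDl divr_gt0.
- by rewrite mulrA mulrDr divff ?gt_eqF//; lra.
move=> l El; apply/andP; split.
  by have [i Ti] := (TE l).1 El; have := eP i; rewrite Ti; lra.
apply: le_lt_trans (leS _ El) _.
have : max_re_eigenvalue E < H^-1 by rewrite -[ltRHS]mul1r ltr_pdivlMr// mulrC.
lra.
Qed.

Section dilations.
Variables (R : realType) (d : nat).
Local Notation mu := (lebesgue_cv R d).
Implicit Types L : 'M[R]_d.

Lemma scales_volumeX L j : L \in unitmx ->
  scales_volume R d (L ^+ j) /\ \det (L ^+ j) = \det L ^+ j.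
Proof.
move=> uL; elim: j => [|j [IH1 IH2]].
  split; last by rewrite !expr0 det1.
  by rewrite expr0 -[1]/(1%:M) -perm_mx1; exact: scales_volume_perm.
rewrite !exprS -mulmxE; split; last by rewrite det_mulmx IH2.
by apply: scales_volumeM => //; exact: scales_volume_unitmx.
Qed.

Lemma volume_preimage_exp L j D (v : R) : L \in unitmx -> measurable D ->
  mu D = v%:E ->
  mu ((mulmx (L ^+ j)) @^-1` D) = (v * `|\det L|^-1 ^+ j)%:E.
Proof.
move=> uL mD Dv; have [sv dt] := scales_volumeX _ j uL.
have := sv D mD; rewrite Dv dt normrX.
have d0 : `|\det L| ^+ j != 0.
  by rewrite expf_neq0// normr_eq0 -unitfE -unitmxE.
case: (mu _) => [r| |]; last 2 first.
- by rewrite gt0_mulye// lte_fin lt0r d0 exprn_ge0.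
- by rewrite gt0_mulNye// lte_fin lt0r d0 exprn_ge0.
by rewrite -EFinM => -[<-]; rewrite exprVn mulfK.
Qed.

End dilations.

(** * Increments of the field *)

Lemma geometric_partial_sum_le (R : realType) (r : R) n : 0 <= r -> r < 1 ->
  \sum_(0 <= k < n) r ^+ k <= (1 - r)^-1.
Proof.
move=> r0 r1; have h : 0 < 1 - r by rewrite subr_gt0.
rewrite big_mkord -[leRHS]mul1r ler_pdivlMr// mulrC.
have -> : (1 - r) * \sum_(i < n) r ^+ i = 1 - r ^+ n.
  by rewrite -opprB mulNr -subrX1 opprB.
by rewrite gerBl exprn_ge0.
Qed.

Lemma powR_exprn (R : realType) (x s : R) j : 0 <= x -> (x ^+ j) `^ s = (x `^ s) ^+ j.
Proof.
move=> x0; elim: j => [|j IH]; first by rewrite !expr0 powR1.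
by rewrite !exprS powRM ?exprn_ge0// IH.
Qed.

(** The sum covers the increasing and the decreasing case, whatever the sign of the exponent. *)
Lemma powR_le_bounds (R : realType) (l u y s : R) : 0 < l -> l <= y <= u ->
  y `^ s <= l `^ s + u `^ s.
Proof.
move=> l0 /andP[ly yu]; have y0 : 0 < y := lt_le_trans l0 ly.
have [s0|s0] := leP 0 s.
  apply: (@le_trans _ _ (u `^ s)); last by rewrite lerDr powR_ge0.
  by rewrite ge0_ler_powR ?nnegrE ?(ltW y0)// (le_trans (ltW y0)).
apply: (@le_trans _ _ (l `^ s)); last by rewrite lerDl powR_ge0.
have [t t0 ->] : exists2 t, 0 <= t & s = - t.
  by exists (- s); rewrite ?oppr_ge0 ?opprK ?(ltW s0).
rewrite !powRN lef_pV2 ?posrE ?powR_gt0//.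
by rewrite ge0_ler_powR ?nnegrE ?(ltW y0) ?(ltW l0).
Qed.

Lemma volume_bounded_set (R : realType) d (D : set 'cV[R]_d) (b : R) :
  measurable D -> (forall x, D x -> `|x| <= b) ->
  exists2 v : R, 0 <= v & lebesgue_cv R d D = v%:E.
Proof.
move=> mD Db.
have : (lebesgue_cv R d D < +oo)%E.
  apply: (@le_lt_trans _ _ (lebesgue_cv R d
    [set v | forall i : 'I_d, `[- b, b]%classic (v i ord0)])).
    apply: le_measure; rewrite ?inE//.
      exact: (@measurable_box _ R d (fun=> `[- b, b]%classic)).
    by move=> x /Db xb i /=; rewrite in_itv /= -ler_norml (le_trans (norm_entry_le _ _ _ _ _ _)).
  rewrite (@lebesgue_cv_box R d (fun=> `[- b, b]%classic))// ltey_eq; apply/orP; left.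
  apply: (big_ind (fun x => x \is a fin_num)) => // [x y|i _]; first exact: fin_numM.
  by rewrite lebesgue_measure_itv; case: ifP.
move=> Doo; have D0 : (0 <= lebesgue_cv R d D)%E by exact: measure_ge0.
exists (fine (lebesgue_cv R d D)); first exact: fine_ge0.
by rewrite fineK// ge0_fin_numE.
Qed.

(** * Integrability of the envelope of the increments *)

Section spectral_integral.
Variables (R : realType) (d : nat) (E : 'M[R]_d) (psi : 'cV[R]_d -> R).
Hypothesis d_gt0 : (0 < d)%N.
Hypothesis E_eig : forall l : R[i], cplx_eigenvalue E l -> 1 < complex.Re l.
Hypothesis psi_ge0 : forall x, 0 <= psi x.
Hypothesis psi_cont : continuous psi.
Hypothesis psi_homog : forall (c : R) (x : 'cV[R]_d), 0 < c ->
  psi (powmx c E^T *m x) = c * psi x.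
Hypothesis psi_neq0 : forall x, x != 0 -> psi x != 0.
Variables (alpha H : R).
Hypothesis alpha_gt0 : 0 < alpha.
Hypothesis H_gt0 : 0 < H.
Hypothesis H_lt : H < Hmax E.
Local Notation mu := (lebesgue_cv R d).
Local Notation q := (\tr E).

Definition spectral_density (x : 'cV[R]_d) : R := psi x `^ (- 1 - q / alpha).

(** For [H <= 1] the minimum is [|x|] in the unit ball and [|x| ^ H] outside: the linear bound
    serves the singularity of the density at the origin, the power its decay at infinity. *)
Definition increment_envelope (x : 'cV[R]_d) : R :=
  Num.min (`|x| `^ H) `|x| * spectral_density x.

Lemma measurable_spectral_density : measurable_fun setT spectral_density.
Proof.
apply: (measurableT_comp (measurable_powR (- 1 - q / alpha))).
exact: continuous_measurable_cv.
Qed.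

Lemma increment_envelope_ge0 x : 0 <= increment_envelope x.
Proof. by rewrite mulr_ge0 ?powR_ge0// le_min powR_ge0 normr_ge0. Qed.

Lemma measurable_increment_envelope : measurable_fun setT increment_envelope.
Proof.
have mn : measurable_fun setT (fun x : 'cV[R]_d => `|x|).
  by apply: continuous_measurable_cv => x; exact: norm_continuous.
apply: measurable_funM; last exact: measurable_spectral_density.
by apply: measurable_minr => //; exact: (measurableT_comp (measurable_powR H)).
Qed.

(* Space minus the origin is covered by the images [M ^ j D], [j] an integer, of
   the shell [D], whose contributions decay geometrically in the modulus of [j]. *)
Lemma spectral_integral_finite : exists J : R,
  (\int[mu]_x (increment_envelope x `^ alpha)%:E <= J%:E)%E.
Proof.
have [lo [hi [lo1 Hhi spec]]] := spectral_gap R d E H d_gt0 E_eig H_gt0 H_lt.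
have [N [mN [c1 c10 c1N] [c2 c20 c2N] NM]] := adapted_norm R d E lo hi d_gt0 spec.
set M := powmx 2 E^T in NM.
have detM : `|\det M| = 2 `^ q by exact: det_powmx.
have uM : M \in unitmx.
  by rewrite unitmxE unitfE -normr_eq0 detM gt_eqF// powR_gt0.
pose L := invmx M.
have uL : L \in unitmx by rewrite unitmx_inv.
have detL : `|\det L|^-1 = 2 `^ q by rewrite det_inv normrV ?unitfE -?unitfE -?unitmxE// invrK.
have ML j (x : 'cV[R]_d) : M ^+ j *m (L ^+ j *m x) = x.
  elim: j x => [|j IH] x; first by rewrite !expr0 !mul1mx.
  by rewrite exprS exprSr -!mulmxE -!mulmxA IH mulKVmx.
have psiM j x : psi (M ^+ j *m x) = 2 ^+ j * psi x.
  elim: j => [|j IH]; first by rewrite !expr0 mul1r mul1mx.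
  by rewrite !exprS -mulmxE -mulmxA psi_homog// IH mulrA.
pose a := 2 `^ hi : R; pose b := 2 `^ lo : R.
have a0 : 0 < a by rewrite powR_gt0.
have b0 : 0 < b by rewrite powR_gt0.
have b1 : 1 < b by rewrite /b powR2E -[ltLHS]expR0 ltr_expR mulr_gt0 ?(lt_trans ltr01 lo1) ?ln_gt0 ?ltr1n.
have NMj_le j x : N (M ^+ j *m x) <= a ^+ j * N x.
  elim: j => [|j IH]; first by rewrite !expr0 mul1r mul1mx.
  rewrite !exprS -mulmxE -mulmxA; have /andP[_ h] := NM (M ^+ j *m x).
  by apply: (le_trans h); rewrite -mulrA ler_wpM2l// ltW.
have NMj_ge j x : b ^+ j * N x <= N (M ^+ j *m x).
  elim: j => [|j IH]; first by rewrite !expr0 mul1r mul1mx.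
  rewrite !exprS -mulmxE -mulmxA; have /andP[h _] := NM (M ^+ j *m x).
  by apply: le_trans h; rewrite -mulrA ler_wpM2l// ltW.
pose D := [set x | 1 <= N x < a].
have mD : measurable D.
  rewrite (_ : D = [set x | 1 <= N x] `&` [set x | N x < a]); last first.
    by apply/seteqP; split => x /=; [move/andP|move=> h; apply/andP].
  apply: measurableI; rewrite -[X in measurable X]setTI.
    exact: measurable_fun_ler.
  exact: measurable_fun_ltr.
have [v v0 Dv] : exists2 v : R, 0 <= v & mu D = v%:E.
  apply: (volume_bounded_set _ _ _ (a / c1)) => // x /andP[_ Na].
  by rewrite ler_pdivlMr// mulrC (le_trans (c1N x))// ltW.
have psi0 x : x != 0 -> 0 < psi x by move=> x0; rewrite lt0r psi_neq0//=.
have [l [u [l0 luP]]] := shell_bounds R d psi c2^-1 (a / c1) (ltac:(by rewrite invr_gt0)) psi_cont psi0.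
pose s := - 1 - q / alpha.
pose B := l `^ s + u `^ s.
have B0 : 0 <= B by rewrite addr_ge0 ?powR_ge0.
have DB x : D x -> psi x `^ s <= B.
  move=> /andP[N1 Na]; apply: powR_le_bounds => //; apply: luP; apply/andP; split.
    by rewrite -[leLHS]mul1r ler_pdivrMr// mulrC (le_trans N1).
  by rewrite ler_pdivlMr// mulrC (le_trans (c1N x))// ltW.
(* [Cp j] is the image of the shell under [M ^+ j], and [Cn j] its image under the inverse of
   [M ^+ j]; writing both as preimages gives measurability and volume. *)
pose Cp j := (mulmx (L ^+ j) : 'cV[R]_d -> 'cV[R]_d) @^-1` D.
pose Cn j := (mulmx (M ^+ j) : 'cV[R]_d -> 'cV[R]_d) @^-1` D.
have mCp j : measurable (Cp j) by exact: measurable_preimage_mulmx.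
have mCn j : measurable (Cn j) by exact: measurable_preimage_mulmx.
have vCp j : mu (Cp j) = (v * (2 `^ q) ^+ j)%:E.
  by rewrite (volume_preimage_exp _ _ _ _ _ _ uL mD Dv) detL.
have vCn j : mu (Cn j) = (v * (2 `^ q)^-1 ^+ j)%:E.
  by rewrite (volume_preimage_exp _ _ _ _ _ _ uM mD Dv) detM.
(* One application of [M] multiplies [N] by at most [a], so an orbit cannot jump over the shell: the
   first iterate with [1 <= N] still has [N < a]. Backwards, the first one with [N < a] still has
   [1 <= N]. *)
have cover x : x != 0 -> exists j, Cp j x \/ Cn j x.
  move=> x0; have Nx : 0 < N x.
    by apply: lt_le_trans (c1N x); rewrite mulr_gt0// normr_gt0.
  have big (y : R) : exists j : nat, y < b ^+ j.
    have [j jP] : exists j : nat, `|y| / (b - 1) < j%:R.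
      exists (Num.bound (`|y| / (b - 1))); apply: archi_boundP.
      by rewrite divr_ge0// subr_ge0 ltW.
    exists j; move: jP; rewrite ltr_pdivrMr ?subr_gt0// => jP.
    apply: le_lt_trans (ler_norm y) _; apply: (lt_le_trans jP).
    elim: j {jP} => [|j IH]; first by rewrite mul0r expr0.
    rewrite -natr1 mulrDl mul1r exprS.
    have : 1 <= b ^+ j by rewrite exprn_ege1// ltW.
    by move: IH; set y1 := b ^+ j; set y2 := _ * (b - 1); nra.
  have [N1|N1] := leP 1 (N x).
    have ex : exists j, N (L ^+ j *m x) < a.
      have [j jP] := big (N x / a); exists j.
      have := NMj_ge j (L ^+ j *m x); rewrite ML => h.
      rewrite ltNge; apply/negP => h'; move: jP; rewrite ltr_pdivrMr// => jP.
      have : b ^+ j * a <= b ^+ j * N (L ^+ j *m x) by rewrite ler_wpM2l// exprn_ge0 ?ltW.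
      by move=> h2; have := le_lt_trans (le_trans h2 h) jP; rewrite ltxx.
    have [j jP jmin] := ex_minnP ex; exists j; left; rewrite /Cp /D /= jP andbT.
    case: j jP jmin => [|j] jP jmin; first by rewrite expr0 mul1mx.
    rewrite leNgt; apply/negP => hN.
    have Lj : N (L ^+ j *m x) < a.
      have <- : M *m (L ^+ j.+1 *m x) = L ^+ j *m x.
        by rewrite exprS -mulmxE -mulmxA mulKVmx.
      have /andP[_ h] := NM (L ^+ j.+1 *m x); apply: (le_lt_trans h).
      by rewrite -[ltRHS]mulr1 ltr_pM2l.
    by have := jmin j Lj; rewrite ltnn.
  have ex : exists j, 1 <= N (M ^+ j *m x).
    have [j jP] := big (N x)^-1; exists j; apply: le_trans (NMj_ge j x).
    by rewrite -ler_pdivrMr// mul1r ltW.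
  have [j jP jmin] := ex_minnP ex; exists j; right; rewrite /Cn /D /= jP /=.
  case: j jP jmin => [|j] jP jmin.
    by move: jP; rewrite expr0 mul1mx leNgt N1.
  have Mj : N (M ^+ j *m x) < 1.
    by rewrite ltNge; apply/negP => /jmin; rewrite ltnn.
  rewrite exprS -mulmxE -mulmxA; have /andP[_ h] := NM (M ^+ j *m x).
  by apply: (le_lt_trans h); rewrite -[ltRHS]mulr1 ltr_pM2l.
pose k := a / c1.
have k0 : 0 <= k by rewrite divr_ge0 ?ltW.
have norm_le x z : N x <= z -> `|x| <= z / c1.
  by move=> xz; rewrite ler_pdivlMr// mulrC (le_trans (c1N x)).
have Gp j x : Cp j x ->
    increment_envelope x `^ alpha <= (k `^ H * B) `^ alpha * ((a `^ H * 2 `^ s) `^ alpha) ^+ j.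
  move=> Dj; have Nx : N x <= a ^+ j * a.
    rewrite -{1}(ML j x) (le_trans (NMj_le _ _))// ler_wpM2l ?exprn_ge0 ?(ltW a0)//.
    by move: Dj => /andP[_ /ltW].
  have nx := norm_le _ _ Nx.
  have sx : spectral_density x <= (2 `^ s) ^+ j * B.
    rewrite /spectral_density -{1}(ML j x) psiM powRM ?exprn_ge0// -/s.
    rewrite powR_exprn//.
    by rewrite ler_wpM2l ?exprn_ge0 ?powR_ge0// DB.
  have nH : `|x| `^ H <= k `^ H * (a `^ H) ^+ j.
    have -> : k `^ H * (a `^ H) ^+ j = (a ^+ j * a / c1) `^ H.
      by rewrite -mulrA powRM ?exprn_ge0 ?(ltW a0)// powR_exprn ?(ltW a0)// mulrC.
    by rewrite ge0_ler_powR ?nnegrE ?(ltW H_gt0)// (le_trans _ nx).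
  have -> : (k `^ H * B) `^ alpha * ((a `^ H * 2 `^ s) `^ alpha) ^+ j =
      (k `^ H * (a `^ H) ^+ j * ((2 `^ s) ^+ j * B)) `^ alpha.
    rewrite -powR_exprn ?mulr_ge0 ?powR_ge0// -powRM ?exprn_ge0 ?mulr_ge0 ?powR_ge0//; congr (_ `^ _).
    by rewrite exprMn; ring.
  rewrite ge0_ler_powR ?nnegrE ?increment_envelope_ge0 ?(ltW alpha_gt0)//.
    by rewrite !mulr_ge0 ?exprn_ge0 ?powR_ge0.
  apply: ler_pM => //; rewrite ?le_min ?powR_ge0 ?normr_ge0//.
  by rewrite ge_min nH.
have Gn j x : Cn j x ->
    increment_envelope x `^ alpha <= (k * B) `^ alpha * ((b^-1 * (2 `^ s)^-1) `^ alpha) ^+ j.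
  move=> Dj; have Nx : N x <= b^-1 ^+ j * a.
    rewrite exprVn mulrC ler_pdivlMr ?exprn_gt0// mulrC.
    by rewrite (le_trans (NMj_ge _ _))//; move: Dj => /andP[_ /ltW].
  have nx := norm_le _ _ Nx.
  have sx : spectral_density x <= (2 `^ s)^-1 ^+ j * B.
    have := DB _ Dj; rewrite psiM powRM ?exprn_ge0//.
    rewrite powR_exprn//.
    by move=> h; rewrite exprVn [leRHS]mulrC ler_pdivlMr ?exprn_gt0 ?powR_gt0// mulrC.
  have -> : (k * B) `^ alpha * ((b^-1 * (2 `^ s)^-1) `^ alpha) ^+ j =
      (b^-1 ^+ j * a / c1 * ((2 `^ s)^-1 ^+ j * B)) `^ alpha.
    rewrite -powR_exprn ?mulr_ge0 ?invr_ge0 ?powR_ge0 ?(ltW b0)// -powRM ?exprn_ge0 ?mulr_ge0 ?invr_ge0 ?powR_ge0 ?(ltW b0) ?(ltW c10)//; congr (_ `^ _).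
    by rewrite exprMn /k; ring.
  rewrite ge0_ler_powR ?nnegrE ?increment_envelope_ge0 ?(ltW alpha_gt0)//.
    by rewrite !mulr_ge0 ?exprn_ge0 ?invr_ge0 ?powR_ge0 ?(ltW c10) ?(ltW a0) ?(ltW b0).
  apply: ler_pM => //; rewrite ?le_min ?powR_ge0 ?normr_ge0//.
  by rewrite ge_min nx orbT.
(* Ratios of successive contributions, value times volume. Since [s * alpha + q = - alpha], they are
   [2 ^ (- (1 - H * hi) * alpha)] and [2 ^ (- (lo - 1) * alpha)], both below [1]. *)
pose r1 := (a `^ H * 2 `^ s) `^ alpha * 2 `^ q.
pose r2 := (b^-1 * (2 `^ s)^-1) `^ alpha * (2 `^ q)^-1.
have two0 (x y : R) : 2 `^ (x + y) = 2 `^ x * 2 `^ y by rewrite powRD// pnatr_eq0 implybT.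
have sq : s * alpha + q = - alpha.
  by rewrite /s; field; rewrite gt_eqF.
have r11 : r1 < 1.
  rewrite /r1 /a -powRrM -two0 -powRrM -two0 powR2E -[ltRHS]expR0 ltr_expR pmulr_rlt0 ?ln_gt0 ?ltr1n//.
  rewrite mulrDl -addrA sq -[X in _ - X]mul1r -mulrBl nmulr_rlt0// subr_lt0 mulrC//.
have r21 : r2 < 1.
  rewrite /r2 /b -!powRN -two0 -powRrM -two0 powR2E -[ltRHS]expR0 ltr_expR pmulr_rlt0 ?ln_gt0 ?ltr1n//.
  have -> : (- lo - s) * alpha - q = - ((lo - 1) * alpha).
    have -> : q = - alpha - s * alpha by rewrite -sq; ring.
    ring.
  rewrite oppr_lt0.
  by rewrite mulr_gt0// subr_gt0.
have r10 : 0 <= r1 by rewrite mulr_ge0 ?powR_ge0.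
have r20 : 0 <= r2 by rewrite mulr_ge0 ?invr_ge0 ?powR_ge0.
pose A1 := (k `^ H * B) `^ alpha; pose A2 := (k * B) `^ alpha.
have A10 : 0 <= A1 by exact: powR_ge0.
have A20 : 0 <= A2 by exact: powR_ge0.
(* Pieces may overlap; a sum of indicators still dominates the integrand. *)
pose F j (x : 'cV[R]_d) : \bar R :=
  ((A1 * ((a `^ H * 2 `^ s) `^ alpha) ^+ j)%:E * (\1_(Cp j) x)%:E +
   (A2 * ((b^-1 * (2 `^ s)^-1) `^ alpha) ^+ j)%:E * (\1_(Cn j) x)%:E)%E.
have mi (S : set 'cV[R]_d) : measurable S -> measurable_fun setT (fun x => (\1_S x : R)%:E).
  by move=> mS; apply/measurable_EFinP; exact: measurable_indic.
have F10 j x : (0 <= (A1 * ((a `^ H * 2 `^ s) `^ alpha) ^+ j)%:E * (\1_(Cp j) x)%:E)%E.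
  by rewrite mule_ge0 ?lee_fin// mulr_ge0// exprn_ge0 ?powR_ge0.
have F20 j x : (0 <= (A2 * ((b^-1 * (2 `^ s)^-1) `^ alpha) ^+ j)%:E * (\1_(Cn j) x)%:E)%E.
  by rewrite mule_ge0 ?lee_fin// mulr_ge0// exprn_ge0 ?powR_ge0.
have F0 j x : (0 <= F j x)%E by rewrite adde_ge0.
have mF j : measurable_fun setT (F j).
  by apply: emeasurable_funD; apply: measurable_funeM; exact: mi.
exists (A1 * v * (1 - r1)^-1 + A2 * v * (1 - r2)^-1).
apply: (@le_trans _ _ (\int[mu]_x (\sum_(0 <= j <oo) F j x))%E).
  apply: ge0_le_integral => //.
  - by move=> x _; rewrite lee_fin powR_ge0.
  - apply/measurable_EFinP; apply: (measurableT_comp (measurable_powR alpha)).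
    exact: measurable_increment_envelope.
  - by apply: ge0_emeasurable_sum => // j x _ _; exact: F0.
  (* No piece contains the origin, but there the envelope vanishes since [H > 0], whatever the value
     of the density. *)
  move=> x _; have [->|x0] := eqVneq x 0.
    rewrite /increment_envelope normr0 powR0 ?gt_eqF// minxx mul0r powR0 ?gt_eqF//.
    by apply: nneseries_ge0 => j _ _; exact: F0.
  have [j Cj] := cover x x0.
  apply: (@le_trans _ _ (F j x)); last first.
    apply: (@le_trans _ _ (\sum_(0 <= i < j.+1) F i x)%E).
      by rewrite big_nat_recr//= leeDr// sume_ge0.
    by apply: nneseries_lim_ge => i _ _; exact: F0.
  case: Cj => Cj; rewrite /F.
    rewrite -[leLHS]adde0 leeD// indicE mem_set// mule1 lee_fin; exact: Gp.
  rewrite -[leLHS]add0e leeD// indicE mem_set// mule1 lee_fin; exact: Gn.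
rewrite integral_nneseries//.
apply: lime_le; first by apply: is_cvg_nneseries => j _ _; apply: integral_ge0 => x _; exact: F0.
apply: nearW => n.
have IF j : (\int[mu]_x F j x = (A1 * v * r1 ^+ j + A2 * v * r2 ^+ j)%:E)%E.
  rewrite ge0_integralD//; do ?[by apply: measurable_funeM; exact: mi].
  rewrite !ge0_integralZl//; do ?[exact: mi | by rewrite lee_fin mulr_ge0// exprn_ge0 ?powR_ge0].
  rewrite !integral_indic// !setIT.
  transitivity ((A1 * ((a `^ H * 2 `^ s) `^ alpha) ^+ j)%:E * (v * (2 `^ q) ^+ j)%:E +
    (A2 * ((b^-1 * (2 `^ s)^-1) `^ alpha) ^+ j)%:E * (v * (2 `^ q)^-1 ^+ j)%:E)%E.
    by congr (_ * _ + _ * _)%E; [exact: vCp|exact: vCn].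
  rewrite -!EFinM -EFinD; congr _%:E.
  by rewrite /r1 /r2 !exprMn; ring.
under eq_bigr do rewrite IF.
rewrite sumEFin lee_fin big_split /= -!mulr_sumr.
by apply: lerD; rewrite ler_wpM2l ?mulr_ge0// geometric_partial_sum_le.
Qed.

End spectral_integral.

Section characters.
Variables (R : realType) (d : nat).

Lemma cmod_expi (t : R) : cmod (expi t) = 1.
Proof. by rewrite cmodE /= cos2Dsin2 sqrtr1. Qed.

Lemma cmod_expiB_le2 (s t : R) : cmod (expi s - expi t) <= 2.
Proof. by apply: le_trans (cmodD _ _ _) _; rewrite cmodN !cmod_expi; lra. Qed.

Lemma cmod_expiB (s t : R) : cmod (expi s - expi t) <= `|s - t|.
Proof.
rewrite -(@ler_pXn2r _ 2) ?nnegrE ?cmod_ge0// cmod_sqr real_normK ?num_real//=.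
have -> : (cos s - cos t) ^+ 2 + (sin s - sin t) ^+ 2 = 2 * (1 - cos (s - t)).
  rewrite cosB; have := cos2Dsin2 s; have := cos2Dsin2 t; rewrite !expr2; lra.
have := cos_ge_quadratic R (s - t); lra.
Qed.

Lemma dotvBl (x y xi : 'cV[R]_d) : dotv x xi - dotv y xi = dotv (x - y) xi.
Proof.
by rewrite /dotv -sumrB; apply: eq_bigr => i _; rewrite !mxE mulrBl.
Qed.

Lemma normr_dotv_le (x xi : 'cV[R]_d) : `|dotv x xi| <= d%:R * (`|x| * `|xi|).
Proof.
rewrite (le_trans (ler_norm_sum _ _ _))//.
apply: (@le_trans _ _ (\sum_(i < d) `|x| * `|xi|)).
  by apply: ler_sum => i _; rewrite normrM ler_pM ?norm_entry_le.
by rewrite sumr_const card_ord -[leLHS]mulr_natl.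
Qed.

Lemma measurable_dotv (x : 'cV[R]_d) : measurable_fun setT (dotv x).
Proof.
by apply: measurable_sum => i; apply: measurable_funM => //; exact: measurable_coord.
Qed.

(* [min 2 t <= 2 t `^ H] for [t >= 0] and [0 <= H <= 1]. *)
Lemma cmod_expiB_interpolation (x y xi : 'cV[R]_d) (H rho : R) :
  (0 < d)%N -> 0 < H -> H <= 1 -> 0 < rho -> rho <= 1 -> `|x - y| <= rho ->
  cmod (expi (dotv x xi) - expi (dotv y xi)) <=
  2 * d%:R * rho `^ H * Num.min (`|xi| `^ H) `|xi|.
Proof.
move=> d0 H0 H1 r0 r1 xy; set z := _ - _.
have d1 : 1 <= d%:R :> R by rewrite ler1n.
have rH : rho <= rho `^ H by apply: ger1_powR => //; rewrite r0.
pose t := d%:R * (rho * `|xi|).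
have t0 : 0 <= t by rewrite !mulr_ge0 ?(ltW r0).
have zt : cmod z <= t.
  apply: (le_trans (cmod_expiB _ _)); rewrite dotvBl (le_trans (normr_dotv_le _ _))//.
  by rewrite ler_wpM2l// ler_wpM2r.
have z2 : cmod z <= 2 by exact: cmod_expiB_le2.
have K0 : 0 <= 2 * d%:R * rho `^ H by rewrite !mulr_ge0 ?powR_ge0.
rewrite minr_pMr// le_min; apply/andP; split; last first.
  apply: (le_trans zt); rewrite /t mulrA; apply: ler_wpM2r => //.
  have h1 : d%:R * rho <= d%:R * rho `^ H by rewrite ler_wpM2l.
  have h2 : 0 <= d%:R * rho `^ H by rewrite mulr_ge0 ?powR_ge0.
  lra.
apply: (@le_trans _ _ (2 * t `^ H)).
  have [t1|t1] := leP t 1.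
    have [t00|tp] := leP t 0.
      have -> : cmod z = 0 by apply/eqP; rewrite eq_le cmod_ge0 andbT (le_trans zt).
      by rewrite mulr_ge0 ?powR_ge0.
    have : t <= t `^ H by apply: ger1_powR => //; rewrite tp.
    by have := powR_ge0 t H; lra.
  have : 1 <= t `^ H by rewrite -(powRr0 t) ler_powR ?(ltW t1) ?(ltW H0).
  lra.
rewrite /t powRM ?mulr_ge0 ?(ltW r0)// powRM ?(ltW r0)// !mulrA.
rewrite ler_wpM2r ?powR_ge0// ler_wpM2r ?powR_ge0// ler_wpM2l//.
exact: ler1_powR.
Qed.

End characters.

(** Turns the exponential tail into an arbitrary power of the mesh, to be weighed against the number
    of grid points. *)
Lemma expRN_le_exprn (R : realType) (t : R) m : 0 < t ->
  expR (- t) <= m`!%:R * t^-1 ^+ m.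
Proof.
move=> t0; rewrite expRN exprVn -[leRHS]invrK lef_pV2 ?posrE ?expR_gt0//; last first.
  by rewrite invr_gt0 divr_gt0 ?exprn_gt0// ltr0n fact_gt0.
rewrite invfM invrK.
case: m => [|m]; first by rewrite expr0 fact0 invr1 mulr1; have := expR_ge1Dx t; lra.
by apply: le_trans (expR_ge1Dxn m (ltW t0)); rewrite mulrC lerDr.
Qed.

(** * Probability of a large increment among finitely many *)

Section increments.
Variables (R : realType) (d : nat) (E : 'M[R]_d) (psi : 'cV[R]_d -> R).
Hypothesis d_gt0 : (0 < d)%N.
Hypothesis E_eig : forall l : R[i], cplx_eigenvalue E l -> 1 < complex.Re l.
Hypothesis psi_ge0 : forall x, 0 <= psi x.
Hypothesis psi_cont : continuous psi.
Hypothesis psi_homog : forall (c : R) (x : 'cV[R]_d), 0 < c ->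
  psi (powmx c E^T *m x) = c * psi x.
Hypothesis psi_neq0 : forall x, x != 0 -> psi x != 0.
Variable alpha : R.
Hypothesis alpha_gt0 : 0 < alpha.
Variables (disp : measure_display) (Omega : measurableType disp)
  (P : probability Omega R) (W : set 'cV[R]_d -> Omega -> R[i]).
Hypothesis W_stable : isotropic_stable_measure P alpha W.
Variable X : 'cV[R]_d -> Omega -> R.
Hypothesis X_harm : harmonizable_field P alpha E psi W X.
Local Notation mu := (lebesgue_cv R d).
Local Notation dens := (spectral_density R d E psi alpha).
Local Notation envelope := (increment_envelope R d E psi alpha).

Lemma measurable_field x : measurable_fun setT (X x).
Proof.
have [Y [[mY _] _] XY] := X_harm x.
by rewrite (_ : X x = fun w => complex.Re (Y w)) //; apply/funext.
Qed.

Lemma cmeasurable_kernel x : cmeasurable (harmonizable_kernel alpha E psi x).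
Proof.
have m1 : cmeasurable (fun xi : 'cV[R]_d => expi (dotv x xi)).
  split => /=.
    exact: (measurableT_comp (continuous_measurable_fun (@continuous_cos R)) (measurable_dotv R d x)).
  exact: (measurableT_comp (continuous_measurable_fun (@continuous_sin R)) (measurable_dotv R d x)).
apply: cmeasurableM; first by apply: cmeasurableB => //; exact: cmeasurable_cst.
by split => /=; [exact: measurable_spectral_density|exact: measurable_cst].
Qed.

(** Increments are divided by [e = rho ^ (H + dl)], where [H' = H + 2 * dl] is still below [H_m].
    The envelope for [H'] then keeps a factor [rho ^ dl], so the heavy tail costs
    [rho ^ (dl * alpha)], while the level becomes [rho ^ (- dl)], with an exponentially small tail.
    The exponent [k] is free, to beat any polynomial number [N] of pairs. *)
Lemma increment_probability (H : R) (k : nat) : 0 < H < Hmax E ->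
  exists C eps : R, [/\ 0 <= C, 0 < eps &
    forall N (x y : 'I_N -> 'cV[R]_d) (rho : R), 0 < rho -> rho <= 1 ->
      (forall i, `|x i - y i| <= rho) ->
      (P [set w | exists i, (rho `^ H < `|X (x i) w - X (y i) w|)%R] <=
       (C * (rho `^ eps + N%:R * rho ^+ k))%:E)%E].
Proof.
move=> /andP[H0 HH].
pose H' := (H + Hmax E) / 2.
have H'H : H < H' by rewrite /H'; lra.
have H'm : H' < Hmax E by rewrite /H'; lra.
have H'0 : 0 < H' by exact: lt_trans H'H.
have H'1 : H' <= 1.
  by have /andP[_ h] := Hmax_bounds R d E d_gt0 E_eig; rewrite ltW// (lt_trans H'm).
pose dl := (H' - H) / 2.
have dl0 : 0 < dl by rewrite divr_gt0// subr_gt0.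
have [J JP] := spectral_integral_finite R d E psi d_gt0 E_eig psi_ge0 psi_cont
  psi_homog psi_neq0 alpha H' alpha_gt0 H'0 H'm.
have J0 : 0 <= J.
  rewrite -lee_fin; apply: le_trans JP; apply: integral_ge0 => x _.
  by rewrite lee_fin powR_ge0.
(* The order to which the exponential is expanded: [(rho ^ dl) ^+ m <= rho ^+ k]. *)
have [m mk] : exists m : nat, k%:R <= dl * m%:R.
  have [m mP] : exists m : nat, k%:R / dl < m%:R.
    by exists (Num.bound (k%:R / dl)); apply: archi_boundP; rewrite divr_ge0// ltW.
  by exists m; rewrite mulrC -ler_pdivrMr// ltW.
pose C1 := 2 * tail_constant alpha * 2 `^ alpha * ((2 * d%:R) `^ alpha * J).
(* The [3 / 2] comes from [1 - lam / 2] with [lam = rho ^ (- dl) - 1]; the rest is [expRN_le_exprn]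
   at [t = rho ^ (- dl) / 2]. *)
pose C2 := 2 * expR (3 / 2) * (m`!%:R * 2 ^+ m) : R.
have tc0 : 0 <= tail_constant alpha :> R by exact: tail_constant_ge0.
have C10 : 0 <= C1.
  apply: mulr_ge0; first by apply: mulr_ge0 => //; exact: mulr_ge0.
  by rewrite mulr_ge0 ?powR_ge0.
have C20 : 0 <= C2.
  by rewrite /C2 mulr_ge0// ?mulr_ge0 ?expR_ge0 ?exprn_ge0.
exists (C1 + C2), (dl * alpha); split; [exact: addr_ge0|exact: mulr_gt0|].
move=> N x y rho r0 r1 xy.
pose e := rho `^ (H + dl).
have e0 : 0 < e by rewrite powR_gt0.
have /choice[Yx YxP] z : exists Y, is_stochastic_integral P alpha W
    (harmonizable_kernel alpha E psi z) Y /\ forall w, X z w = complex.Re (Y w).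
  by have [Y h1 h2] := X_harm z; exists Y.
pose f i xi := (e^-1)%:C%C * (harmonizable_kernel alpha E psi (x i) xi
  - harmonizable_kernel alpha E psi (y i) xi).
pose Y i w := (e^-1)%:C%C * (Yx (x i) w - Yx (y i) w).
pose g xi := 2 * d%:R * rho `^ dl * envelope H' xi.
have mB i : cmeasurable (fun xi => harmonizable_kernel alpha E psi (x i) xi
    - harmonizable_kernel alpha E psi (y i) xi).
  by apply: cmeasurableB; exact: cmeasurable_kernel.
have mf i : cmeasurable (f i).
  by apply: cmeasurableM => //; exact: cmeasurable_cst.
have sY i : is_stochastic_integral P alpha W (f i) (Y i).
  apply: (stochastic_integralZ P alpha W) => //.
    by rewrite eq_complex /= eqxx andbT invr_eq0 gt_eqF.
  apply: (stochastic_integralB P alpha W alpha_gt0 W_stable); do ?exact: cmeasurable_kernel.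
    by have [] := YxP (x i).
  by have [] := YxP (y i).
have c0 : 0 <= 2 * d%:R * rho `^ dl by rewrite !mulr_ge0 ?powR_ge0.
have mg : measurable_fun setT g.
  by apply: measurable_funM => //; exact: measurable_increment_envelope.
have g0 xi : 0 <= g xi by rewrite mulr_ge0// increment_envelope_ge0.
have fg i xi : cmod (f i xi) <= g xi.
  rewrite /f /harmonizable_kernel -mulrBl opprB addrA subrK !cmodM !cmod_real.
  rewrite (ger0_norm (powR_ge0 _ _)) ger0_norm ?invr_ge0 ?(ltW e0)//.
  rewrite mulrA /g /increment_envelope mulrA -/(dens xi) ler_wpM2r ?powR_ge0//.
  rewrite mulrC ler_pdivrMr//.
  apply: (le_trans (cmod_expiB_interpolation _ _ _ _ _ _ _ d_gt0 H'0 H'1 r0 r1 (xy i))).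
  have -> : rho `^ H' = rho `^ dl * e.
    by rewrite /e -powRD ?(gt_eqF r0) ?implybT//; congr (_ `^ _); rewrite /dl; lra.
  by rewrite le_eqVlt; apply/orP; left; apply/eqP; ring.
have gJ : (\int[mu]_xi (g xi `^ alpha)%:E <= ((2 * d%:R * rho `^ dl) `^ alpha * J)%:E)%E.
  under eq_integral do rewrite /g powRM ?increment_envelope_ge0// EFinM.
  rewrite ge0_integralZl//; do ?[by move=> ? _; rewrite lee_fin powR_ge0 | by rewrite lee_fin powR_ge0].
    by rewrite EFinM lee_wpmul2l ?lee_fin ?powR_ge0.
  apply/measurable_EFinP; apply: (measurableT_comp (measurable_powR alpha)).
  exact: measurable_increment_envelope.
pose lam := rho `^ (- dl) - 1.
have := stochastic_maximal_inequality P alpha W alpha_gt0 W_stable N f Y g _ lam mf sY mg g0 fg gJ.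
rewrite (_ : [set w | _] = [set w | exists i, rho `^ H < `|X (x i) w - X (y i) w|]); last first.
  have ev i w : (lam + 1 < `|complex.Re (Y i w)|) = (rho `^ H < `|X (x i) w - X (y i) w|).
    rewrite /lam subrK /Y cReM /= mul0r subr0 normrM cReD cReN.
    have [_ <-] := YxP (x i); have [_ <-] := YxP (y i).
    rewrite ger0_norm ?invr_ge0 ?(ltW e0)// mulrC ltr_pdivlMr//.
    by rewrite /e -powRD ?(gt_eqF r0) ?implybT//; congr (_ `^ _ < _); lra.
  by apply/seteqP; split => w [i hi]; exists i; move: hi; rewrite ev.
move=> bound; apply: (le_trans bound); rewrite lee_fin [leRHS]mulrDr.
have -> : (2 * d%:R * rho `^ dl) `^ alpha = (2 * d%:R) `^ alpha * rho `^ (dl * alpha).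
  by rewrite powRM ?mulr_ge0 ?powR_ge0// -powRrM.
have -> : 2 * tail_constant alpha * 2 `^ alpha * ((2 * d%:R) `^ alpha * rho `^ (dl * alpha) * J) =
    C1 * rho `^ (dl * alpha) by rewrite /C1; ring.
apply: lerD; first by rewrite ler_wpM2r ?powR_ge0// lerDl.
apply: (@le_trans _ _ (C2 * (N%:R * rho ^+ k))); last first.
  by rewrite ler_wpM2r ?mulr_ge0 ?exprn_ge0 ?(ltW r0)// lerDr.
have -> : 1 - 2^-1 * lam = 3 / 2 + - (2^-1 * rho `^ (- dl)) by rewrite /lam; lra.
rewrite expRD.
have t0 : 0 < 2^-1 * rho `^ (- dl) by rewrite mulr_gt0 ?powR_gt0.
have le_exp : expR (- (2^-1 * rho `^ (- dl))) <= m`!%:R * 2 ^+ m * rho ^+ k.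
  apply: (le_trans (expRN_le_exprn _ _ m t0)).
  rewrite invfM invrK -powRN opprK exprMn mulrA ler_wpM2l ?mulr_ge0 ?exprn_ge0//.
  have -> : (rho `^ dl) ^+ m = rho `^ (dl * m%:R) by rewrite powRrM powR_mulrn ?powR_ge0.
  have -> : rho ^+ k = rho `^ k%:R by rewrite powR_mulrn ?(ltW r0).
  by apply: ger_powR => //; rewrite r0.
have -> : C2 * (N%:R * rho ^+ k) = 2 * N%:R * (expR (3 / 2) * (m`!%:R * 2 ^+ m * rho ^+ k)).
  by rewrite /C2; ring.
by rewrite ler_wpM2l// ler_wpM2l ?expR_ge0.
Qed.

End increments.

(** * Dyadic chaining *)

Section dyadic.
Variables (R : realType) (d : nat).
Implicit Types (t : R) (x y : 'cV[R]_d) (n : nat).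

Definition dyadic_floor n t : R := (Num.floor (2 ^+ n * t))%:~R * 2^-1 ^+ n.

Lemma pow2_neq0 n : 2 ^+ n != 0 :> R.
Proof. by rewrite expf_neq0. Qed.

Lemma dyadic_floorE n t : 2 ^+ n * dyadic_floor n t = (Num.floor (2 ^+ n * t))%:~R.
Proof. by rewrite /dyadic_floor mulrCA exprVn divff ?pow2_neq0 ?mulr1. Qed.

Lemma ler_dist_scale n (s t : R) :
  (`|s - t| <= 2^-1 ^+ n) = (`|2 ^+ n * s - 2 ^+ n * t| <= 1).
Proof.
have h2 : 0 < 2 ^+ n :> R by rewrite exprn_gt0.
by rewrite -(ler_pM2l h2) -mulrBr normrM (gtr0_norm h2) exprVn divff ?pow2_neq0.
Qed.

Lemma dyadic_floor_dist n t : `|t - dyadic_floor n t| <= 2^-1 ^+ n.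
Proof.
rewrite ler_dist_scale dyadic_floorE.
have := floor_le (2 ^+ n * t); have := floorD1_gt (2 ^+ n * t).
rewrite intrD => h h'; rewrite ger0_norm; lra.
Qed.

Lemma dyadic_floor_idem n t : dyadic_floor n (dyadic_floor n t) = dyadic_floor n t.
Proof. by rewrite {1}/dyadic_floor dyadic_floorE intrKfloor. Qed.

(** The grids are nested, so two successive approximations of a point both lie on the finer grid and
    can be compared there. *)
Lemma dyadic_floor_refine n t : dyadic_floor n.+1 (dyadic_floor n t) = dyadic_floor n t.
Proof.
rewrite {1}/dyadic_floor exprS -mulrA dyadic_floorE -[2]/(2%:~R) -intrM intrKfloor.
by rewrite intrM -mulrA mulrCA exprS [2%:~R * _]mulrA divff// mul1r.
Qed.

Lemma dyadic_floor_refine_dist n t : `|dyadic_floor n t - dyadic_floor n.+1 t| <= 2^-1 ^+ n.+1.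
Proof.
rewrite ler_dist_scale dyadic_floorE exprS -!mulrA dyadic_floorE.
set s := 2 ^+ n * t; set k := Num.floor s.
have := floor_le s; have := floorD1_gt s; rewrite -/k intrD => h1 h3.
have l1 : 2 * k <= Num.floor (2 * s) by rewrite floor_ge_int intrM; lra.
have l2 : Num.floor (2 * s) < 2 * k + 2 by rewrite floor_lt_int intrD intrM; lra.
have l3 : `|2 * k - Num.floor (2 * s)| <= 1 by lia.
by move: l3; rewrite -(ler_int R) intr_norm intrB intrM.
Qed.

(** Reals at distance at most [1] have integer parts at distance at most [1]. The bound is thus
    preserved without loss, as needed to stay among the tested neighbours. *)
Lemma dyadic_floor_close n (s t : R) : `|s - t| <= 2^-1 ^+ n ->
  `|dyadic_floor n s - dyadic_floor n t| <= 2^-1 ^+ n.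
Proof.
rewrite !ler_dist_scale !dyadic_floorE.
move: (2 ^+ n * s) (2 ^+ n * t) => {s t} s t; rewrite ler_norml => /andP[st ts].
have l1 : Num.floor s <= Num.floor t + 1.
  by rewrite -[1](@intrKfloor R) -floorDrz ?le_floor//; lra.
have l2 : Num.floor t <= Num.floor s + 1.
  by rewrite -[1](@intrKfloor R) -floorDrz ?le_floor//; lra.
have l3 : `|Num.floor s - Num.floor t| <= 1 by lia.
by move: l3; rewrite -(ler_int R) intr_norm intrB.
Qed.

Definition dyadic_part n x : 'cV[R]_d := map_mx (dyadic_floor n) x.

Lemma dyadic_part_dist n x : `|x - dyadic_part n x| <= 2^-1 ^+ n.
Proof.
apply: mx_norm_le => [|i j]; first by rewrite exprn_ge0 ?invr_ge0.
by rewrite !mxE dyadic_floor_dist.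
Qed.

Lemma dyadic_part_idem n x : dyadic_part n (dyadic_part n x) = dyadic_part n x.
Proof. by apply/matrixP => i j; rewrite !mxE dyadic_floor_idem. Qed.

Lemma dyadic_part_refine n x : dyadic_part n.+1 (dyadic_part n x) = dyadic_part n x.
Proof. by apply/matrixP => i j; rewrite !mxE dyadic_floor_refine. Qed.

Lemma dyadic_part_refine_dist n x :
  `|dyadic_part n x - dyadic_part n.+1 x| <= 2^-1 ^+ n.+1.
Proof.
apply: mx_norm_le => [|i j]; first by rewrite exprn_ge0 ?invr_ge0.
by rewrite !mxE dyadic_floor_refine_dist.
Qed.

Lemma dyadic_part_close n x y : `|x - y| <= 2^-1 ^+ n ->
  `|dyadic_part n x - dyadic_part n y| <= 2^-1 ^+ n.
Proof.
move=> xy; apply: mx_norm_le => [|i j]; first by rewrite exprn_ge0 ?invr_ge0.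
rewrite !mxE dyadic_floor_close//; apply: le_trans xy.
by have := norm_entry_le R d 1 (x - y) i j; rewrite !mxE.
Qed.

Lemma dyadic_part_norm n x : `|dyadic_part n x| <= `|x| + 1.
Proof.
rewrite -[dyadic_part n x](subrK x) addrC (le_trans (ler_normD _ _))// lerD2l.
rewrite distrC (le_trans (dyadic_part_dist _ _))// exprn_ile1 ?invr_ge0//.
by rewrite invf_le1// ler1n.
Qed.

End dyadic.

Section chaining.
Variable R : realType.

(** Subtracting the geometric tail [r ^+ n / (1 - r)] turns the sequence into a nondecreasing
    bounded one; the explicit rate is the limit of the telescoped bound [dist']. *)
Lemma geometric_steps_cvg (u : R^nat) (r : R) (n0 : nat) : 0 < r -> r < 1 ->
  (forall n, (n0 <= n)%N -> `|u n - u n.+1| <= r ^+ n.+1) ->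
  cvgn u /\ forall n, (n0 <= n)%N -> `|limn u - u n| <= r ^+ n * (1 - r)^-1.
Proof.
move=> r0 r1 ustep.
have S0 : 0 < (1 - r)^-1 by rewrite invr_gt0 subr_gt0.
have step m : r ^+ m.+1 <= (r ^+ m - r ^+ m.+1) * (1 - r)^-1.
  rewrite exprS -[X in (X - _)]mul1r -mulrBl mulrAC divff ?gt_eqF ?subr_gt0// mul1r.
  by rewrite ler_piMl ?exprn_ge0 ?(ltW r0)// ltW.
have dist n k : (n0 <= n)%N ->
    `|u (k + n)%N - u n| <= (r ^+ n - r ^+ (k + n)%N) * (1 - r)^-1.
  move=> n0n; elim: k => [|k IH]; first by rewrite add0n !subrr normr0 mul0r.
  rewrite addSn -(subrKA (u (k + n)%N)) (le_trans (ler_normD _ _))//.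
  have h := ustep _ (leq_trans n0n (leq_addl k n)).
  rewrite distrC in h.
  apply: le_trans (lerD (le_trans h (step _)) IH) _.
  by rewrite -mulrDl addrC subrKA.
have dist' n k : (n0 <= n)%N -> `|u (k + n)%N - u n| <= r ^+ n * (1 - r)^-1.
  move=> n0n; apply: le_trans (dist n k n0n) _.
  by rewrite ler_wpM2r ?(ltW S0)// gerBl exprn_ge0// ltW.
pose v k := u (k + n0)%N - r ^+ (k + n0) * (1 - r)^-1.
have cr : r ^+ k @[k --> \oo] --> (0 : R).
  by apply: cvg_expr; rewrite ger0_norm// ltW.
have cv : cvgn v.
  apply: nondecreasing_is_cvgn.
    apply/nondecreasing_seqP => k; rewrite /v.
    have := dist (k + n0)%N 1%N (leq_addl _ _); rewrite ler_norml => /andP[h _].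
    by move: h; rewrite add1n mulrBl; lra.
  exists (u n0 + r ^+ n0 * (1 - r)^-1) => _ [k _ <-]; rewrite /v.
  have := dist' n0 k (leqnn _); rewrite ler_norml => /andP[_ h].
  have : 0 <= r ^+ (k + n0) * (1 - r)^-1 by rewrite mulr_ge0 ?exprn_ge0 ?(ltW r0)// ltW.
  lra.
have cu : cvgn u.
  apply/cvg_ex; exists (limn v + 0 * (1 - r)^-1).
  rewrite -(cvg_shiftn n0).
  rewrite (_ : (fun n => _) = (fun k => v k + r ^+ (k + n0) * (1 - r)^-1)); last first.
    by apply/funext => k; rewrite /v subrK.
  apply: cvgD => //; apply: cvgMr_tmp.
  by rewrite (cvg_shiftn n0).
split=> // n n0n.
have cd : `|u k - u n| @[k --> \oo] --> `|limn u - u n|.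
  apply: cvg_norm; apply: cvgB => //; exact: cvg_cst.
rewrite -(cvg_lim _ cd)//; apply: limr_le; first by apply/cvg_ex; exists `|limn u - u n|.
near=> k; have nk : (n <= k)%N by near: k; exact: nbhs_infty_ge.
by rewrite -(subnK nk) dist'.
Unshelve. all: by end_near.
Qed.

Lemma half_power_lt (e : R) : 0 < e -> exists n, 2^-1 ^+ n < e.
Proof.
move=> e0; have : (2^-1 : R) ^+ k @[k --> \oo] --> (0 : R).
  by apply: cvg_expr; rewrite ger0_norm ?invr_ge0// invf_lt1// ltr1n.
by move=> /cvgr_lt /(_ _ e0) [N _ /(_ N (leqnn N))]; exists N.
Qed.

Section dyadic_chaining.
Variables (d : nat) (f : 'cV[R]_d -> R) (H : R) (n0 : nat).
Hypothesis H_gt0 : 0 < H.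

(* Only pairs of neighbouring points of the grid of mesh [2 ^- n] are tested, in a
   ball growing with [n] so that a countable intersection of events suffices. *)
Definition dyadic_holder : Prop := forall n, (n0 <= n)%N -> forall x y : 'cV[R]_d,
  dyadic_part R d n x = x -> dyadic_part R d n y = y ->
  `|x| <= n.+1%:R -> `|y| <= n.+1%:R -> `|x - y| <= 2^-1 ^+ n ->
  `|f x - f y| <= (2^-1 ^+ n) `^ H.

(** The value of the modification: it depends on [f] at dyadic points only, hence on countably many
    variables. *)
Definition dyadic_limit (x : 'cV[R]_d) : R := limn (fun n => f (dyadic_part R d n x)).

Hypothesis f_holder : dyadic_holder.

Let r : R := 2^-1 `^ H.

Let r_gt0 : 0 < r. Proof. by rewrite powR_gt0. Qed.

Let r_lt1 : r < 1. Proof. exact: half_powR_lt1. Qed.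

Let rE n : (2^-1 ^+ n) `^ H = r ^+ n.
Proof. by rewrite powR_exprn. Qed.

(** The approximations have norm at most [M + 1], so from level [maxn n0 M] on they lie in the
    tested balls. *)
Lemma dyadic_limit_cvg (M : nat) (x : 'cV[R]_d) : `|x| <= M%:R ->
  cvgn (fun n => f (dyadic_part R d n x)) /\
  forall n, (maxn n0 M <= n)%N ->
    `|dyadic_limit x - f (dyadic_part R d n x)| <= r ^+ n * (1 - r)^-1.
Proof.
move=> xM; apply: geometric_steps_cvg => // n; rewrite geq_max => /andP[n0n Mn].
rewrite -rE; apply: f_holder.
- exact: leqW.
- exact: dyadic_part_refine.
- exact: dyadic_part_idem.
- rewrite (le_trans (dyadic_part_norm _ _ _ _))//.
  by rewrite -[n.+2%:R]natr1 lerD2r (le_trans xM)// ler_nat leqW.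
- rewrite (le_trans (dyadic_part_norm _ _ _ _))//.
  by rewrite -[n.+2%:R]natr1 lerD2r (le_trans xM)// ler_nat leqW.
- exact: dyadic_part_refine_dist.
Qed.

(** One step on the grid and two geometric tails, over [r] because the mesh is only comparable to
    the distance up to a factor [2]. *)
Let near_const : R := (1 + 2 * (1 - r)^-1) / r.

Let near_const_ge0 : 0 <= near_const.
Proof.
by rewrite divr_ge0 ?(ltW r_gt0)// addr_ge0// mulr_ge0// invr_ge0 subr_ge0 ltW.
Qed.

(** The points are compared at the least admissible level [n] with [2 ^- n.+1 < |x - y|]. By
    minimality, or by hypothesis at the first level, [|x - y| <= 2 ^- n], so their dyadic parts are
    neighbours. *)
Lemma dyadic_limit_near (M : nat) (x y : 'cV[R]_d) :
  `|x| <= M%:R -> `|y| <= M%:R -> `|x - y| <= 2^-1 ^+ maxn n0 M ->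
  `|dyadic_limit x - dyadic_limit y| <= near_const * `|x - y| `^ H.
Proof.
move=> xM yM xy.
have [->|xny] := eqVneq x y.
  by rewrite !subrr normr0 mulr_ge0// powR_ge0.
have xy0 : 0 < `|x - y| by rewrite normr_gt0 subr_eq0.
pose p n := (maxn n0 M <= n)%N && (2^-1 ^+ n.+1 < `|x - y|).
have ex : exists n, p n.
  have [k hk] := half_power_lt _ xy0; exists (maxn (maxn n0 M) k).
  rewrite /p leq_maxl /=; apply: le_lt_trans hk.
  by rewrite ler_wiXn2l ?invr_ge0 ?invf_le1 ?ler1n// leqW// leq_maxr.
case: (ex_minnP ex) => n /andP[n1n hn] nmin.
have xyn : `|x - y| <= 2^-1 ^+ n.
  move: n1n; rewrite leq_eqVlt => /orP[/eqP <-//|]; case: n {hn} nmin => // n nmin n1n.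
  rewrite leNgt; apply/negP => lt.
  by have := nmin n; rewrite /p lt -ltnS n1n ltnn => /(_ isT).
have [_ dx] := dyadic_limit_cvg M x xM; have [_ dy] := dyadic_limit_cvg M y yM.
have dxy : `|f (dyadic_part R d n x) - f (dyadic_part R d n y)| <= r ^+ n.
  rewrite -rE; move: n1n; rewrite geq_max => /andP[n0n Mn].
  apply: f_holder => //; do ?exact: dyadic_part_idem; last exact: dyadic_part_close.
    rewrite (le_trans (dyadic_part_norm _ _ _ _))//.
    by rewrite -[n.+1%:R]natr1 lerD2r (le_trans xM)// ler_nat.
  rewrite (le_trans (dyadic_part_norm _ _ _ _))//.
  by rewrite -[n.+1%:R]natr1 lerD2r (le_trans yM)// ler_nat.
have rn : r ^+ n <= r^-1 * `|x - y| `^ H.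
  rewrite mulrC ler_pdivlMr// -exprSr -rE.
  by rewrite ge0_ler_powR ?nnegrE ?exprn_ge0 ?invr_ge0 ?(ltW H_gt0)// ltW.
apply: (@le_trans _ _ (r ^+ n * (1 + 2 * (1 - r)^-1))); last first.
  rewrite /near_const -mulrA [leRHS]mulrC ler_wpM2r//.
  by rewrite addr_ge0// mulr_ge0// invr_ge0 subr_ge0 ltW.
have := dx n n1n; have := dy n n1n; move: dxy.
set a := dyadic_limit x; set b := dyadic_limit y.
set fa := f _; set fb := f _ => h1 h2 h3.
have -> : a - b = (a - fa) + (fa - fb) - (b - fb) by lra.
apply: le_trans (ler_normB _ _) _; apply: le_trans (lerD (ler_normD _ _) h2) _.
by move: h1 h3; set S := (1 - r)^-1; lra.
Qed.

(* Beyond the range of the local estimate, subdivide the segment from [x] to [y]. *)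
Lemma dyadic_limit_holder : locally_holder H dyadic_limit.
Proof.
move=> K cK.
have [M0 [_ KM0]] := compact_bounded cK.
have [M KM] : exists M : nat, forall x, K x -> `|x| <= M%:R.
  exists (Num.bound `|M0 + 1|) => x Kx.
  apply: le_trans (KM0 (M0 + 1) _ x Kx) _; first by rewrite ltrDl.
  by rewrite ltW// (le_lt_trans (ler_norm _))// archi_boundP.
(* As [|x - y| <= 2 * M], this many equal pieces are each no longer than [2 ^- maxn n0 M]. *)
have [N N1 NB] : exists2 N, (0 < N)%N & (M * 2 * 2 ^ maxn n0 M <= N)%N.
  by exists (M * 2 * 2 ^ maxn n0 M).+1.
have N0 : 0 < N%:R :> R by rewrite ltr0n.
exists (N%:R * near_const) => x y Kx Ky.
have xM := KM x Kx; have yM := KM y Ky.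
pose z (j : nat) := x + (j%:R / N%:R) *: (y - x).
(* The segment may leave [K], but by convexity not the ball of radius [M], where the local estimate
   holds. *)
have zM j : (j <= N)%N -> `|z j| <= M%:R.
  move=> jN; have t0 : 0 <= j%:R / N%:R :> R by rewrite divr_ge0.
  have t1 : j%:R / N%:R <= 1 :> R by rewrite ler_pdivrMr// mul1r ler_nat.
  move: t0 t1; rewrite /z; move: (j%:R / N%:R) => t t0 t1.
  have -> : x + t *: (y - x) = (1 - t) *: x + t *: y.
    by rewrite scalerBr scalerBl scale1r addrCA addrC -addrA [- _ + _]addrC.
  apply: le_trans (ler_normD _ _) _; rewrite !normrZ (ger0_norm t0) ger0_norm ?subr_ge0//.
  have h1 : (1 - t) * `|x| <= (1 - t) * M%:R by rewrite ler_wpM2l ?subr_ge0.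
  have h2 : t * `|y| <= t * M%:R by rewrite ler_wpM2l.
  by apply: le_trans (lerD h1 h2) _; rewrite -mulrDl subrK mul1r.
have zB j : `|z j - z j.+1| = N%:R^-1 * `|x - y|.
  have -> : z j - z j.+1 = N%:R^-1 *: (x - y).
    rewrite /z opprD addrACA subrr add0r -scalerBl -mulrBl -[j.+1%:R]natr1 opprD addNKr.
    by rewrite mulN1r scaleNr -scalerN opprB.
  by rewrite normrZ ger0_norm// invr_ge0 ltW.
have step j : (j < N)%N ->
    `|dyadic_limit (z j) - dyadic_limit (z j.+1)| <= near_const * `|x - y| `^ H.
  move=> jN; apply: le_trans (dyadic_limit_near M _ _ (zM j (ltnW jN)) (zM j.+1 jN) _) _.
    rewrite zB mulrC ler_pdivrMr//.
    apply: le_trans (ler_normB _ _) _; apply: le_trans (lerD xM yM) _.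
    rewrite mulrC exprVn ler_pdivlMr ?exprn_gt0//.
    by rewrite -natrX -natrD -natrM ler_nat addnn -muln2.
  apply: (ler_wpM2l near_const_ge0).
  apply: ge0_ler_powR; rewrite ?nnegrE ?(ltW H_gt0) ?normr_ge0// zB.
  by rewrite ler_piMl// invf_le1// ler1n.
have sum j : (j <= N)%N -> `|dyadic_limit x - dyadic_limit (z j)| <=
    j%:R * (near_const * `|x - y| `^ H).
  elim: j => [|j IH] jN.
    by rewrite /z mul0r scale0r addr0 subrr normr0 mul0r.
  rewrite -(subrKA (dyadic_limit (z j))) -[j.+1%:R]natr1 mulrDl mul1r.
  apply: le_trans (ler_normD _ _) _; apply: lerD; [exact: IH (ltnW jN)|exact: step].
have zN : z N = y by rewrite /z divff ?gt_eqF// scale1r addrC subrK.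
have := sum N (leqnn N); rewrite zN => h; apply: le_trans h _.
rewrite mulrA; apply: ler_wpM2l; first exact: mulr_ge0.
apply: ge0_ler_powR; rewrite ?nnegrE ?(ltW H_gt0) ?sqrtr_ge0 ?normr_ge0//.
apply: mx_norm_le => [|i j]; first exact: sqrtr_ge0.
rewrite -sqrtr_sqr /enorm ler_wsqrtr// ord1 (bigD1 i)//= lerDl sumr_ge0// => k _.
exact: sqr_ge0.
Qed.

End dyadic_chaining.
End chaining.

(** * Almost sure regularity *)

Lemma borel_cantelli_geometric (R : realType) (disp : measure_display)
    (Omega : measurableType disp) (P : {measure set Omega -> \bar R})
    (F : nat -> set Omega) (C r : R) : 0 <= C -> 0 <= r -> r < 1 ->
  (forall n, measurable (F n)) -> (forall n, (P (F n) <= (C * r ^+ n)%:E)%E) ->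
  P (lim_sup_set F) = 0%E.
Proof.
move=> C0 r0 r1 mF PF; apply: lim_sup_set_cvg0 => //.
apply: (@le_lt_trans _ _ (C * (1 - r)^-1)%:E); last exact: ltry.
apply: lime_le; first by apply: is_cvg_nneseries => n _ _; exact: measure_ge0.
apply: nearW => n.
apply: le_trans (lee_sum _ (fun i _ => PF i)) _.
by rewrite sumEFin lee_fin -mulr_sumr ler_wpM2l// geometric_partial_sum_le.
Qed.

Section dyadic_grid.
Variables (R : realType) (d : nat).

(** Points of mesh [2 ^- n] in the ball of radius [n.+1] have coordinates [l / 2 ^ n] with [|l|] at
    most this number; indices are shifted by it to become natural numbers. *)
Definition grid_radius n : nat := (n.+1 * 2 ^ n)%N.

Definition grid_index n : finType := {ffun 'I_d -> 'I_(grid_radius n).*2.+1}.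

Definition grid_point n (z : grid_index n) : 'cV[R]_d :=
  \col_i (((z i)%:R - (grid_radius n)%:R) * 2^-1 ^+ n).

Lemma grid_point_surj n (x : 'cV[R]_d) : dyadic_part R d n x = x ->
  `|x| <= n.+1%:R -> exists z, x = grid_point n z.
Proof.
move=> xn xM; set m := grid_radius n.
have /choice[z zP] (i : 'I_d) : exists k : 'I_m.*2.+1,
    x i ord0 = (k%:R - m%:R) * 2^-1 ^+ n.
  have xi : x i ord0 = (Num.floor (2 ^+ n * x i ord0))%:~R * 2^-1 ^+ n.
    by rewrite -{1}xn mxE.
  set l := Num.floor _ in xi.
  have : `|l| <= m%:Z.
    rewrite -(ler_int R) intr_norm.
    have -> : l%:~R = 2 ^+ n * x i ord0.
      by rewrite xi mulrCA exprVn divff ?mulr1// pow2_neq0.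
    rewrite normrM ger0_norm ?exprn_ge0// /m /grid_radius PoszM mulrC intrM.
    rewrite -!pmulrn natrX ler_pM2r ?exprn_gt0//.
    by apply: le_trans xM; exact: norm_entry_le.
  move=> lm; have lm' : (`|(l + m%:Z)%R| < m.*2.+1)%N by lia.
  exists (Ordinal lm') => /=; rewrite xi; congr (_ * _).
  rewrite natr_absz ger0_norm ?intrD; last by lia.
  by rewrite pmulrn addrK.
exists [ffun i => z i]; apply/matrixP => i j; rewrite !mxE ffunE ord1; exact: zP.
Qed.

Definition grid_pair n : finType := (grid_index n * grid_index n)%type.

(** Uses [n.+1 <= 2 ^ n]. The form of the bound matters: up to a constant it is the mesh to the
    power [- 4 * d]. *)
Lemma card_grid_pair n : (0 < d)%N -> (#|grid_pair n| <= (4 ^ n.+1) ^ d.*2)%N.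
Proof.
move=> d0; rewrite card_prod card_ffun !card_ord -expnD addnn leq_exp2r ?double_gt0//.
have h : (n.+1 <= 2 ^ n)%N by exact: ltn_expl.
have h2 : (0 < 2 ^ n)%N by rewrite expn_gt0.
rewrite /grid_radius expnS -[X in (4 * X ^ _)%N]/(2 * 2)%N expnMn.
move: (2 ^ n)%N h h2 => a; nia.
Qed.

End dyadic_grid.

Lemma notin_lim_sup_set (T : Type) (F : nat -> set T) (w : T) :
  ~ lim_sup_set F w -> exists n0, forall n, (n0 <= n)%N -> ~ F n w.
Proof.
move=> Fw; apply: contrapT => h; apply: Fw => n _; apply: contrapT => h'.
by apply: h; exists n => m nm Fm; apply: h'; exists m.
Qed.

Lemma measurable_lim_sup_set (disp : measure_display) (T : measurableType disp)
    (F : nat -> set T) : (forall n, measurable (F n)) -> measurable (lim_sup_set F).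
Proof.
move=> mF; apply: bigcapT_measurable => n.
exact: bigcup_measurable.
Qed.

Lemma dyadic_holder_le (R : realType) (d : nat) (f : 'cV[R]_d -> R) (H H' : R) n0 :
  H <= H' -> dyadic_holder R d f H' n0 -> dyadic_holder R d f H n0.
Proof.
move=> HH' fH n n0n x y hx hy xn yn xy; apply: le_trans (fH n n0n x y hx hy xn yn xy) _.
apply: ger_powR => //; rewrite exprn_gt0 ?invr_gt0//=.
by rewrite exprn_ile1 ?invr_ge0 ?invf_le1 ?ler1n.
Qed.

Section sample_paths.
Variables (R : realType) (d : nat) (E : 'M[R]_d) (psi : 'cV[R]_d -> R).
Hypothesis d_gt0 : (0 < d)%N.
Hypothesis E_eig : forall l : R[i], cplx_eigenvalue E l -> 1 < complex.Re l.
Hypothesis psi_ge0 : forall x, 0 <= psi x.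
Hypothesis psi_cont : continuous psi.
Hypothesis psi_homog : forall (c : R) (x : 'cV[R]_d), 0 < c ->
  psi (powmx c E^T *m x) = c * psi x.
Hypothesis psi_neq0 : forall x, x != 0 -> psi x != 0.
Variables (alpha : R) (alpha_gt0 : 0 < alpha).
Variables (disp : measure_display) (Omega : measurableType disp).
Variables (P : probability Omega R) (W : set 'cV[R]_d -> Omega -> R[i]).
Hypothesis W_stable : isotropic_stable_measure P alpha W.
Variable X : 'cV[R]_d -> Omega -> R.
Hypothesis X_harm : harmonizable_field P alpha E psi W X.

Let mX x : measurable_fun setT (X x).
Proof. exact: (measurable_field R d E psi alpha disp Omega P W X X_harm). Qed.

(** The families are arbitrary so as to serve twice: for all neighbouring pairs of the grid, and for
    the single pair of a point and its dyadic part. *)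
Definition large_increment (H : R) (N : nat -> nat)
    (x y : forall n, 'I_(N n) -> 'cV[R]_d) (n : nat) : set Omega :=
  [set w | exists i, (2^-1 ^+ n) `^ H < `|X (x n i) w - X (y n i) w|].

Lemma measurable_large_increment H N x y n : measurable (large_increment H N x y n).
Proof.
apply: measurable_exists_ord => i; apply: measurable_set_ltr.
  exact: measurable_cst.
by apply: measurableT_comp; [exact: normr_measurable|exact: measurable_funB].
Qed.

Lemma large_increment_limsup (H : R) (N : nat -> nat)
    (x y : forall n, 'I_(N n) -> 'cV[R]_d) : 0 < H < Hmax E ->
  (forall n, (N n <= (4 ^ n.+1) ^ d.*2)%N) ->
  (forall n i, `|x n i - y n i| <= 2^-1 ^+ n) ->
  P (lim_sup_set (large_increment H N x y)) = 0%E.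
Proof.
move=> HH N4 xy.
(* There are at most [A * rho ^ (- 4 * d)] pairs at mesh [rho], so the exponent [4 * d + 1] leaves
   [A * rho], summable over the levels. *)
have [C [eps [C0 eps0 CP]]] := increment_probability R d E psi d_gt0 E_eig psi_ge0
  psi_cont psi_homog psi_neq0 alpha alpha_gt0 disp Omega P W W_stable X X_harm
  H (d.*2.*2.+1) HH.
have h0 : 0 < 2^-1 :> R by [].
have h1 : 2^-1 < 1 :> R by rewrite invf_lt1// ltr1n.
pose e := Num.min eps 1.
have e0 : 0 < e by rewrite lt_min eps0 ltr01.
pose A : R := (4 ^ d.*2)%:R.
apply: (borel_cantelli_geometric _ _ _ _ _ (C * (1 + A)) (2^-1 `^ e)).
- by rewrite mulr_ge0// addr_ge0.
- exact: powR_ge0.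
- exact: half_powR_lt1.
- exact: measurable_large_increment.
move=> n; set rho : R := 2^-1 ^+ n.
have rho0 : 0 < rho by rewrite exprn_gt0.
have rho1 : rho <= 1 by rewrite exprn_ile1 ?(ltW h0) ?(ltW h1).
apply: le_trans (CP (N n) (x n) (y n) rho rho0 rho1 (xy n)) _.
rewrite lee_fin -mulrA ler_wpM2l// -powR_exprn ?(ltW h0)// mulrDl mul1r lerD//.
  by apply: ger_powR; rewrite ?rho0 ?rho1 ?ge_min ?lexx.
apply: (@le_trans _ _ (A * rho)); last first.
  rewrite ler_wpM2l// -[leLHS]powRr1 ?(ltW rho0)//.
  by apply: ger_powR; rewrite ?rho0 ?rho1 ?ge_min ?lexx ?orbT.
rewrite exprSr mulrA ler_wpM2r ?(ltW rho0)//.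
apply: (@le_trans _ _ (((4 ^ n.+1) ^ d.*2)%:R * rho ^+ d.*2.*2)).
  by rewrite ler_wpM2r ?exprn_ge0 ?(ltW rho0)// ler_nat.
rewrite /A expnS expnMn natrM -mulrA ler_piMr// /rho -exprM.
rewrite -expnM -[4%N]/(2 ^ 2)%N -expnM natrX exprVn.
have -> : (2 * (n * d.*2) = n * d.*2.*2)%N by rewrite -[in RHS]muln2 mulnC mulnA.
by rewrite divff// expf_neq0.
Qed.

Lemma dyadic_holder_almost_surely (H : R) : 0 < H < Hmax E ->
  exists B, [/\ measurable B, P B = 0%E & forall w, ~ B w ->
    exists n0, dyadic_holder R d (fun x => X x w) H n0].
Proof.
move=> HH.
pose a n (i : 'I_#|grid_pair d n|) := grid_point R d n (enum_val i).1.
pose b n (i : 'I_#|grid_pair d n|) :=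
  let p := grid_point R d n (enum_val i).2 in
  if `|a n i - p| <= 2^-1 ^+ n then p else a n i.
have ab n i : `|a n i - b n i| <= 2^-1 ^+ n.
  by rewrite /b; case: ifP => // _; rewrite subrr normr0 exprn_ge0 ?invr_ge0.
(* Pairs of points that are not neighbours are replaced by trivial pairs. *)
exists (lim_sup_set (large_increment H _ a b)); split.
- by apply: measurable_lim_sup_set => n; exact: measurable_large_increment.
- by apply: large_increment_limsup => // n; exact: card_grid_pair.
move=> w /(notin_lim_sup_set _ _ w)[n0 h]; exists n0 => n n0n x y xn yn xM yM xy.
have [z xz] := grid_point_surj R d n x xn xM.
have [z' yz'] := grid_point_surj R d n y yn yM.
rewrite leNgt; apply/negP => lt; apply: (h n n0n).
exists (enum_rank ((z, z') : grid_pair d n)).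
by rewrite /b /a enum_rankK /= -xz -yz' xy.
Qed.

(** A fixed [x] is in general on no grid, so the events for grid pairs say nothing about [X x]. This
    null event, depending on [x], is what identifies the dyadic limit with the field. *)
Lemma dyadic_part_cvg_almost_surely (x : 'cV[R]_d) :
  exists B, [/\ measurable B, P B = 0%E & forall w, ~ B w ->
    X (dyadic_part R d n x) w @[n --> \oo] --> X x w].
Proof.
have /andP[Hm0 Hm1] := Hmax_bounds R d E d_gt0 E_eig.
pose H := Hmax E / 2.
have HH : 0 < H < Hmax E by rewrite /H; apply/andP; split; lra.
pose a (n : nat) (i : 'I_1) := x.
pose b n (i : 'I_1) := dyadic_part R d n x.
exists (lim_sup_set (large_increment H (fun=> 1%N) a b)); split.
- by apply: measurable_lim_sup_set => n; exact: measurable_large_increment.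
- apply: large_increment_limsup => // n; first by rewrite !expn_gt0.
  by move=> i; exact: dyadic_part_dist.
move=> w /(notin_lim_sup_set _ _ w)[n0 h].
have r0 : (2^-1 `^ H) ^+ n @[n --> \oo] --> (0 : R).
  apply: cvg_expr; rewrite ger0_norm ?powR_ge0//.
  by apply: half_powR_lt1; case/andP: HH.
have d0 : (X x w - X (dyadic_part R d n x) w) @[n --> \oo] --> (0 : R).
  apply/norm_cvg0P; apply: (squeeze_cvgr _ (@cvg_cst _ _ _ _ _) r0).
  near=> n; rewrite normr_ge0 /=.
  have nn : (n0 <= n)%N by near: n; exact: nbhs_infty_ge.
  rewrite leNgt; apply/negP => lt; apply: (h n nn); exists ord0.
  by rewrite powR_exprn// invr_ge0.
have -> : (fun n => X (dyadic_part R d n x) w) =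
    (fun n => X x w - (X x w - X (dyadic_part R d n x) w)).
  by apply/funext => n; lra.
rewrite -[X in _ --> X]subr0; apply: cvgB => //; exact: cvg_cst.
Unshelve. all: by end_near.
Qed.

Lemma holder_modification : exists Xs : 'cV[R]_d -> Omega -> R,
  modification P X Xs /\
  {ae P, forall w, forall H : R, 0 < H < Hmax E ->
    locally_holder H (fun x => Xs x w)}.
Proof.
have /andP[Hm0 Hm1] := Hmax_bounds R d E d_gt0 E_eig.
(* Countably many exponents increasing to [H_m], so that a single null event serves all [H]; with
   [k.+2] the first one is already positive. *)
pose Hk (k : nat) := Hmax E - Hmax E / k.+2%:R.
have HkP k : 0 < Hk k < Hmax E.
  rewrite /Hk subr_gt0 gtrBl divr_gt0// andbT ltr_pdivrMr// ltr_pMr//.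
  by rewrite ltr1n.
have /choice[B BP] k := dyadic_holder_almost_surely (Hk k) (HkP k).
pose N := \bigcup_k B k.
have mN : measurable N by apply: bigcupT_measurable => k; have [] := BP k.
have PN : P N = 0%E.
  apply/(negligibleP _ mN); apply: negligible_bigcup => k.
  by have [mB PB _] := BP k; apply/negligibleP.
have NP w k : ~ N w -> exists n0, dyadic_holder R d (fun x => X x w) (Hk k) n0.
  by move=> Nw; have [_ _] := BP k; apply => Bw; apply: Nw; exists k.
have cvgX w x : ~ N w -> cvgn (fun n => X (dyadic_part R d n x) w).
  move=> /(NP w 0%N)[n0 fH].
  have /andP[h0 _] := HkP 0%N.
  have xM : `|x| <= (Num.bound `|x|)%:R by rewrite ltW// archi_boundP.
  by have [] := dyadic_limit_cvg R d _ (Hk 0%N) n0 h0 fH _ x xM.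
(* Set to [0] on the exceptional event, so that [Xs x] is a limit of measurable functions at every
   point and hence measurable. *)
pose Xs x w := \1_(~` N) w * dyadic_limit R d (fun x => X x w) x.
have XsE x w : ~ N w -> Xs x w = dyadic_limit R d (fun x => X x w) x.
  by move=> Nw; rewrite /Xs indicE mem_set// mul1r.
exists Xs; split; last first.
  exists N; split => // w; apply: contra_notP => Nw H /andP[H0 Hm].
  rewrite (_ : (fun x => _) = dyadic_limit R d (fun x => X x w)); last first.
    by apply/funext => x; rewrite XsE.
  have [k hk] : exists k, H <= Hk k.
    exists (Num.bound (Hmax E / (Hmax E - H))).
    set k := Num.bound _.
    rewrite /Hk lerBrDr -lerBrDl ler_pdivrMr// mulrC -ler_pdivrMr ?subr_gt0//.
    apply: (@le_trans _ _ k%:R); last by rewrite ler_nat -addn2 leq_addr.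
    by apply/ltW/archi_boundP; rewrite divr_ge0 ?(ltW Hm0) ?subr_ge0 ?(ltW Hm).
  have [n0 fH] := NP w k Nw.
  apply: (dyadic_limit_holder R d _ H n0 H0).
  exact: dyadic_holder_le hk fH.
move=> x.
have mXs : measurable_fun setT (Xs x).
  apply: (measurable_fun_cvg (h := fun n w => \1_(~` N) w * X (dyadic_part R d n x) w)).
    move=> n; apply: measurable_funM => //; apply: measurable_indic; exact: measurableC.
  move=> w _; have [Nw|Nw] := pselect (N w).
    rewrite /Xs indicE memNset ?mul0r//=.
    under eq_fun do rewrite mul0r.
    exact: cvg_cst.
  by apply: cvgMl_tmp; exact: cvgX.
split => //.
have mS : measurable [set w | Xs x w = X x w].
  rewrite (_ : [set w | _] = [set w | (Xs x w <= X x w)%R] `&` [set w | (X x w <= Xs x w)%R]).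
    by apply: measurableI; apply: measurable_set_ler.
  by apply/seteqP; split => w /=; [move=> ->|move=> [h1 h2]; apply: le_anti; rewrite h1].
have [B' [mB' PB' B'P]] := dyadic_part_cvg_almost_surely x.
have PC : P (~` [set w | Xs x w = X x w]) = 0%E.
  apply: (@subset_measure0 _ _ _ _ _ (N `|` B')); first exact: measurableC.
  - exact: measurableU.
  - move=> w /=; apply: contra_notP => /not_orP[Nw B'w].
    rewrite XsE//; exact: (cvg_lim _ (B'P w B'w)).
  - by apply: null_set_setU.
by have := probability_setC P (measurableC mS); rewrite setCK PC sube0.
Qed.

End sample_paths.

Theorem corollary5p5 (R : realType) (d : nat) (d_ge1 : (1 <= d)%N)
    (E : 'M[R]_d)
    (E_eig : forall l : R[i], cplx_eigenvalue E l -> 1 < complex.Re l)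
    (psi : 'cV[R]_d -> R)
    (psi_ge0 : forall x, 0 <= psi x)
    (psi_cont : continuous psi)
    (psi_homog : forall (c : R) (x : 'cV[R]_d), 0 < c ->
       psi (powmx c E^T *m x) = c * psi x)
    (psi_neq0 : forall x, x != 0 -> psi x != 0)
    (alpha : R) (alpha_gt0 : 0 < alpha) (alpha_le2 : alpha <= 2)
    (disp : measure_display) (Omega : measurableType disp)
    (P : probability Omega R)
    (W : set 'cV[R]_d -> Omega -> R[i])
    (W_stable : isotropic_stable_measure P alpha W)
    (X : 'cV[R]_d -> Omega -> R)
    (X_harm : harmonizable_field P alpha E psi W X) :
  exists Xs : 'cV[R]_d -> Omega -> R,
    modification P X Xs /\
    {ae P, forall w, forall H : R, 0 < H < Hmax E ->
      locally_holder H (fun x => Xs x w)}.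
Proof.
exact: (holder_modification R d E psi d_ge1 E_eig psi_ge0 psi_cont psi_homog
  psi_neq0 alpha alpha_gt0 disp Omega P W W_stable X X_harm).
Qed.
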